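(* For each $n\ge2$, let $\Phi_{\mathrm{OL}}^{(n)}:(\mathcal S^+(n-1),g^{\mathrm{LE}})\to(\mathrm{Cor}^+(n),g^{\mathrm{OL}})$ be the isometric isomorphism $X\mapsto\exp\bigl(\mathcal D(\psi_{\mathrm{OL}}^{(n)}(\log X))+\psi_{\mathrm{OL}}^{(n)}(\log X)\bigr)$, let $i^{(n)}:\mathrm{Cor}^+(n)\hookrightarrow\mathcal S^+(n)$ be the standard inclusion, and let $J^{(n)}:\mathcal S^+(n)\to\mathcal S^+(n)$ be $J^{(n)}(\Sigma)=\exp\bigl(\log\Sigma-\mathcal D(\mathrm{off}(\log\Sigma))\bigr)$. Define $$F_n:=J^{(n)}\circ i^{(n)}\circ\Phi_{\mathrm{OL}}^{(n)}:(\mathcal S^+(n-1),g^{\mathrm{LE}})\longrightarrow(\mathcal S^+(n),g^{\mathrm{LE}}).$$ Then $F_n$ is a totally geodesic isometric embedding and admits the closed-form expression $$F_n(X)=\exp\bigl(\psi_{\mathrm{OL}}^{(n)}(\log X)\bigr)\in K^{(n)}:=\exp(\mathrm{Hol}(n))\subset\mathcal S^+(n).$$ Consequently, for every $1\le m<n$ the composition $F_n\circ\cdots\circ F_{m+1}$ is a totally geodesic isometric embedding $(\mathcal S^+(m),g^{\mathrm{LE}})\hookrightarrow(\mathcal S^+(n),g^{\mathrm{LE}})$, and the family $(\mathcal S^+(n),g^{\mathrm{LE}})_{n\ge1}$ forms a nested sequence of totally geodesic isometric embeddings.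
   Context: $\mathcal S(k)$ = real symmetric $k\times k$ matrices, $\mathcal S^+(k)$ = symmetric positive-definite ones, $\mathrm{Cor}^+(n)$ = matrices in $\mathcal S^+(n)$ with unit diagonal, $\mathrm{Hol}(n)$ = symmetric matrices with zero diagonal, $\mathrm{Diag}(n)$ = diagonal matrices; $\mathrm{off}(A)$ is $A$ with its diagonal set to zero; $\exp,\log$ are the matrix exponential and logarithm; $\langle A,B\rangle=\mathrm{tr}(AB)$ is the Frobenius inner product. $g^{\mathrm{LE}}=\log^*\langle\cdot,\cdot\rangle$ on $\mathcal S^+(k)$. Known facts: for each $S\in\mathcal S(n)$ there is a unique $\mathcal D(S)\in\mathrm{Diag}(n)$ with $\exp(S+\mathcal D(S))\in\mathrm{Cor}^+(n)$, and $\mathcal D$ is smooth; $\mathrm{Log}:=\mathrm{off}\circ\log:\mathrm{Cor}^+(n)\to\mathrm{Hol}(n)$ is a diffeomorphism with inverse $S\mapsto\exp(S+\mathcal D(S))$. $g^{\mathrm{OL}}=\mathrm{Log}^*\langle\cdot,\cdot\rangle$ on $\mathrm{Cor}^+(n)$. $\psi_{\mathrm{OL}}^{(n)}:\mathcal S(n-1)\to\mathrm{Hol}(n)$ is the linear isometry $$\psi_{\mathrm{OL}}^{(n)}(S)=\begin{bmatrix}0&\tfrac1{\sqrt2}\mathrm{diag}(S)^\top\\\tfrac1{\sqrt2}\mathrm{diag}(S)&\mathrm{off}(S)\end{bmatrix},$$ with $\mathrm{diag}(S)\in\mathbb R^{n-1}$ the column vector of diagonal entries of $S$. *)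

(* Defs.v *)
From HB Require Import structures.
From mathcomp Require Import all_boot all_order all_algebra.
From mathcomp Require Import all_classical all_reals all_analysis.
Set Implicit Arguments.
Unset Strict Implicit.
Unset Printing Implicit Defensive.
Import Order.TTheory GRing.Theory Num.Theory.
Import numFieldNormedType.Exports.
Local Open Scope classical_set_scope.
Local Open Scope ring_scope.

(** Riemannian geometry on relatively open subsets of affine subspaces.

    All the manifolds considered are relatively open in an affine subspace of a
    finite-dimensional normed space [V]: such a manifold is [carrier], the
    direction of the affine subspace, which is the tangent space at every point,
    is [tangent], and [metric p u v] is the inner product at [p].  Maps and
    metrics are total functions on [V] whose values matter only on [carrier]:
    for [p] in [carrier] and [v] in [tangent], the points [p + h v] are in
    [carrier] for all small [h], so that the library's directional derivative
    ['D_v f p] depends only on the restriction of [f] to [carrier]. *)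

Record riem (R : realType) (V : normedModType R) := Riem {
  carrier : set V;
  tangent : set V;
  metric : V -> V -> V -> R }.

Section Geometry.
Context {R : realType}.

(* C^k on M, by iterated directional derivatives along T *)
Fixpoint Ck (V W : normedModType R) (k : nat) (M T : set V) (f : V -> W) : Prop :=
  {within M, continuous f} /\
  match k with
  | 0 => True
  | k'.+1 => forall v, T v ->
      (forall x, M x -> derivable f x v) /\ Ck k' M T (fun x => 'D_v f x)
  end.

Definition smooth (V W : normedModType R) (M T : set V) (f : V -> W) : Prop :=
  forall k, Ck k M T f.

(* [covariant M p u v c]: [c] is the value at [p] of nabla_u v, where nabla is
   the Levi-Civita connection and u, v are constant vector fields (Koszul
   formula; the Lie brackets of constant fields vanish). *)
Definition covariant (V : normedModType R) (M : riem V) (p u v c : V) : Prop :=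
  tangent M c /\
  forall w, tangent M w ->
    metric M p c w = 2^-1 * ('D_u (fun q => metric M q v w : R^o) p
                           + 'D_v (fun q => metric M q u w : R^o) p
                           - 'D_w (fun q => metric M q u v : R^o) p).

(* Geodesic equation gamma'' + Gamma(gamma', gamma') = 0 on an open interval,
   Gamma(u, v) = nabla_u v for constant fields being the Christoffel term. *)
Definition geodesic (V : normedModType R) (M : riem V) (I : set R) (g : R^o -> V)
    : Prop :=
  [/\ open I, is_interval I, (forall t, I t -> carrier M (g t)),
      smooth (I : set R^o) setT g &
      forall t, I t -> covariant M (g t) (derive1 g t) (derive1 g t) (- derive1n 2 g t)].

Definition isometric (V W : normedModType R) (M : riem V) (N : riem W)
    (F : V -> W) : Prop :=
  forall p u v, carrier M p -> tangent M u -> tangent M v ->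
    metric N (F p) ('D_u F p) ('D_v F p) = metric M p u v.

(* smooth immersion that is a homeomorphism onto its image *)
Definition smooth_embedding (V W : normedModType R) (M : riem V) (N : riem W)
    (F : V -> W) : Prop :=
  [/\ (forall p, carrier M p -> carrier N (F p)),
      smooth (carrier M) (tangent M) F,
      (forall p v, carrier M p -> tangent M v -> 'D_v F p = 0 -> v = 0) &
      exists G : W -> V, (forall p, carrier M p -> G (F p) = p) /\
        {within F @` carrier M, continuous G}].

Definition totally_geodesic (V W : normedModType R) (M : riem V) (N : riem W)
    (F : V -> W) : Prop :=
  forall I g, geodesic M I g -> geodesic N I (F \o g).

Definition tg_isometric_embedding (V W : normedModType R)
    (M : riem V) (N : riem W) (F : V -> W) : Prop :=
  [/\ smooth_embedding M N F, isometric M N F & totally_geodesic M N F].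

Definition isometric_isomorphism (V W : normedModType R)
    (M : riem V) (N : riem W) (F : V -> W) : Prop :=
  [/\ (forall p, carrier M p -> carrier N (F p)),
      smooth (carrier M) (tangent M) F,
      (exists G : W -> V,
        [/\ (forall q, carrier N q -> carrier M (G q)),
            smooth (carrier N) (tangent N) G,
            (forall p, carrier M p -> G (F p) = p) &
            (forall q, carrier N q -> F (G q) = q)]) &
      isometric M N F].

Definition nested_sequence (V : nat -> normedModType R)
    (M : forall n, riem (V n)) (F : forall n, V n -> V n.+1) : Prop :=
  forall n, (1 <= n)%N -> tg_isometric_embedding (M n) (M n.+1) (@F n).

End Geometry.

Section OffLog.
Context {R : realType}.

Definition Sym (n : nat) : set 'M[R]_n := [set A | A^T = A].

Definition SPD (n : nat) : set 'M[R]_n :=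
  [set A | Sym A /\ forall x : 'cV[R]_n, x != 0 -> 0 < (x^T *m A *m x) 0 0].

Definition Cor (n : nat) : set 'M[R]_n :=
  [set A | SPD A /\ forall i, A i i = 1].

Definition Hol (n : nat) : set 'M[R]_n :=
  [set A | Sym A /\ forall i, A i i = 0].

Definition off (n : nat) (A : 'M[R]_n) : 'M[R]_n :=
  \matrix_(i, j) if i == j then 0 else A i j.

Definition expm (n : nat) (A : 'M[R]_n) : 'M[R]_n :=
  limn (series (fun k : nat => (k`!%:R)^-1 *: A ^+ k)).

(* inverse of exp : S(n) -> S^+(n); meaningful on S^+(n) *)
Definition logm (n : nat) (P : 'M[R]_n) : 'M[R]_n :=
  xget 0 [set S | Sym S /\ expm S = P].

(* the unique diagonal matrix E with exp(S + E) in Cor^+(n) *)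
Definition calD (n : nat) (S : 'M[R]_n) : 'M[R]_n :=
  xget 0 [set E | is_diag_mx E /\ Cor (expm (S + E))].

Definition Logm (n : nat) (C : 'M[R]_n) : 'M[R]_n := off (logm C).

Definition frob (n : nat) (A B : 'M[R]_n) : R := \tr (A *m B).

Definition pullback_frob (n : nat) (phi : 'M[R]_n -> 'M[R]_n)
    (p u v : 'M[R]_n) : R := frob ('D_u phi p) ('D_v phi p).

Definition SPD_LE (n : nat) : riem 'M[R]_n :=
  Riem (@SPD n) (@Sym n) (pullback_frob (@logm n)).

Definition Cor_OL (n : nat) : riem 'M[R]_n :=
  Riem (@Cor n) (@Hol n) (pullback_frob (@Logm n)).

(* Below, [k] stands for n - 1: the source is S^+(k) and the target has size
   k.+1 = n, so that e.g. [FOL k] is F_n = F_(k+1). *)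
Definition psiOL (k : nat) (S : 'M[R]_k) : 'M[R]_k.+1 :=
  block_mx (0 : 'M[R]_1) ((Num.sqrt 2)^-1 *: \row_i S i i)
           ((Num.sqrt 2)^-1 *: \col_i S i i) (off S) : 'M[R]_(1 + k).

Definition PhiOL (k : nat) (X : 'M[R]_k) : 'M[R]_k.+1 :=
  expm (calD (psiOL (logm X)) + psiOL (logm X)).

Definition incl (n : nat) (A : 'M[R]_n) : 'M[R]_n := A.

Definition JOL (n : nat) (Sigma : 'M[R]_n) : 'M[R]_n :=
  expm (logm Sigma - calD (off (logm Sigma))).

Definition FOL (k : nat) : 'M[R]_k -> 'M[R]_k.+1 :=
  @JOL k.+1 \o @incl k.+1 \o @PhiOL k.

Definition KOL (n : nat) : set 'M[R]_n := [set expm S | S in @Hol n].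

(* F_(d+m) o ... o F_(m+1), d factors *)
Fixpoint FOLcomp (m d : nat) : 'M[R]_m -> 'M[R]_(d + m) :=
  match d return 'M[R]_m -> 'M[R]_(d + m) with
  | 0 => fun X => X
  | d'.+1 => @FOL (d' + m) \o @FOLcomp m d'
  end.

End OffLog.

(* Main.v *)
(* The matrix logarithm is a global flat chart: in log-coordinates the
   log-Euclidean metric is the Frobenius inner product, the Koszul formula says
   that a curve is a geodesic iff its logarithm has zero acceleration, and [FOL]
   is the linear isometry [psiOL].  The work lies in the smoothness of [logm] and
   [calD].  Both are of the form q |-> the solution D in the range of an
   orthogonal projection Pi of Pi (exp (S q + D)) = Pi (P q).  Existence: D
   minimises the coercive convex potential tr exp (S + D) - tr (P D).  Uniqueness,
   stability and the implicit function theorem: exp is strongly monotone on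
   bounded sets of symmetric matrices.  The calculus of exp itself is obtained
   from a single fact, A X = X B implies exp A X = X exp B, applied to block
   triangular matrices; in particular its derivative is the corner block of the
   exponential of [[A, H], [0, A]]. *)
Require Import Defs.
From HB Require Import structures.
From mathcomp Require Import all_boot all_order all_algebra.
From mathcomp Require Import all_classical all_reals all_analysis.
From mathcomp Require Import ring lra.
Import Order.TTheory GRing.Theory Num.Theory.
Import numFieldNormedType.Exports.
Local Open Scope classical_set_scope.
Local Open Scope ring_scope.

Set Implicit Arguments.
Unset Strict Implicit.
Unset Printing Implicit Defensive.

(** * The matrix exponential *)

Section MatrixNorm.
Context {R : realType}.

(** The obstacle is that the carriers [SPD] and [Cor] are thin in the space of all matrices, and
    that [logm] and [calD], being choices with a default value, are uncontrolled off their domains.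
    The chain rule and the symmetry of second derivatives, however, need differentiability on open
    sets. Everything is therefore proved first for extensions obtained by precomposing with A -> (A
    + A^T) / 2, and then brought back to the carriers: a directional derivative sees only a line,
    and lines in tangent directions stay in the carrier for short times. Integrals and eigenvalues
    are avoided throughout. The mean value theorem, applied to a suitable scalar function, replaces
    Duhamel's integral for the derivative of exp, and the square roots exp (A / 2) replace
    diagonalisation in the positivity arguments. *)

Lemma mx_norm_entry m n (A : 'M[R]_(m, n)) i j : `|A i j| <= `|A|.
Proof.
rewrite [leRHS]/Num.Def.normr/= mx_normrE.
exact: (le_bigmax _ (fun ij => `|A ij.1 ij.2|) (i, j)).
Qed.

Lemma mx_norm_le m n (A : 'M[R]_(m, n)) e : 0 <= e ->
  (forall i j, `|A i j| <= e) -> `|A| <= e.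
Proof.
by move=> e0 Ae; rewrite [leLHS]/Num.Def.normr/= mx_normrE; apply: bigmax_le.
Qed.

Lemma mx_norm_mul m n p (A : 'M[R]_(m, n)) (B : 'M[R]_(n, p)) :
  `|A *m B| <= n%:R * `|A| * `|B|.
Proof.
apply: mx_norm_le => [|i j]; first by rewrite !mulr_ge0.
rewrite mxE (le_trans (ler_norm_sum _ _ _))//.
rewrite (le_trans (ler_sum _ (G := fun=> `|A| * `|B|) _))//.
  by move=> k _; rewrite normrM ler_pM// mx_norm_entry.
by rewrite sumr_const card_ord -[leLHS]mulr_natl mulrA.
Qed.

Lemma mx_norm_block m1 m2 n1 n2 (A : 'M[R]_(m1, n1)) (B : 'M[R]_(m1, n2))
    (C : 'M[R]_(m2, n1)) (D : 'M[R]_(m2, n2)) e : 0 <= e ->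
  `|A| <= e -> `|B| <= e -> `|C| <= e -> `|D| <= e -> `|block_mx A B C D| <= e.
Proof.
move=> e0 Ae Be Ce De; apply: mx_norm_le => // i j.
by rewrite !mxE; case: splitP => i' _; rewrite !mxE; case: splitP => j' _;
  rewrite (le_trans (mx_norm_entry _ _ _)).
Qed.

Lemma mx_norm_tr m n (A : 'M[R]_(m, n)) : `|A^T| = `|A|.
Proof.
apply/le_anti/andP; split; apply: mx_norm_le => // i j.
  by rewrite mxE mx_norm_entry.
by have := mx_norm_entry A^T j i; rewrite mxE.
Qed.

Lemma cvg_sum (T I : Type) (F : set_system T) {FF : Filter F}
    (V : normedModType R) (r : seq I) (f : I -> T -> V) (l : I -> V) :
  (forall i, f i x @[x --> F] --> l i) ->
  (\sum_(i <- r) f i x) @[x --> F] --> \sum_(i <- r) l i.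
Proof.
move=> fl; elim: r => [|i r IHr].
  by under eq_fun do rewrite big_nil; rewrite big_nil; exact: cvg_cst.
under eq_fun do rewrite big_cons; rewrite big_cons.
by apply: cvgD => //; exact: IHr.
Qed.

Lemma linear_mx_continuous m n (W : normedModType R)
  (f : {linear 'M[R]_(m, n) -> W}) : continuous f.
Proof.
have -> : (f : _ -> _) = fun A => \sum_i \sum_j A i j *: f (delta_mx i j).
  apply/funext => A; rewrite {1}[A]matrix_sum_delta !linear_sum.
  by apply: eq_bigr => i _; rewrite linear_sum; apply: eq_bigr => j _; rewrite linearZ.
move=> A; apply: (@cvg_sum _ _ (nbhs A)) => i; apply: (@cvg_sum _ _ (nbhs A)) => j.
by apply: cvgZr_tmp; apply: coord_continuous.
Qed.

Lemma linear_mx_differentiable m n (W : normedModType R)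
  (f : {linear 'M[R]_(m, n) -> W}) A : differentiable f A.
Proof. exact/linear_differentiable/linear_mx_continuous. Qed.

Lemma diff_lin_mx m n (W : normedModType R)
  (f : {linear 'M[R]_(m, n) -> W}) A : 'd f A = f :> (_ -> _).
Proof. exact/diff_lin/linear_mx_continuous. Qed.

End MatrixNorm.

(** Completeness turns absolute convergence of the exponential series into convergence. *)
HB.instance Definition _ (R : realType) (m n : nat) :=
  Uniform_isComplete.Build 'M[R]_(m, n) (@mx_complete R m n).

Section Exp.
Context {R : realType}.

Definition expm_coef n (A : 'M[R]_n) (k : nat) : 'M[R]_n := (k`!%:R)^-1 *: A ^+ k.

(** The norm is the largest absolute value of an entry, submultiplicative only up to the factor n;
    this is the origin of n |A| here and in every bound on exp. The factor |1| accounts for k =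
    0. *)
Lemma mx_norm_expr n (A : 'M[R]_n) k :
  `|A ^+ k| <= `|1 : 'M[R]_n| * (n%:R * `|A|) ^+ k.
Proof.
elim: k => [|k IHk]; first by rewrite !expr0 mulr1.
rewrite exprS (le_trans (mx_norm_mul _ _))// [in leRHS]exprS mulrCA.
by rewrite ler_wpM2l ?mulr_ge0.
Qed.

Lemma mx_norm_expm_coef n (A : 'M[R]_n) k :
  `|expm_coef A k| <= `|1 : 'M[R]_n| * exp_coeff (n%:R * `|A|) k.
Proof.
rewrite /expm_coef normrZ ger0_norm ?invr_ge0// mulrC /exp_coeff /= mulrA.
by rewrite ler_wpM2r ?invr_ge0// mx_norm_expr.
Qed.

Lemma is_cvg_expm n (A : 'M[R]_n) : cvgn (series (expm_coef A)).
Proof.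
apply: (@normed_cvg R 'M[R]_n).
have h : 0 <= n%:R * `|A| by rewrite mulr_ge0.
apply: (@series_le_cvg _ _ (`|1 : 'M[R]_n| *: exp_coeff (n%:R * `|A|))).
- by move=> k /=.
- by move=> k; exact: mulr_ge0 (normr_ge0 _) (exp_coeff_ge0 k h).
- by move=> k; exact: mx_norm_expm_coef.
- by apply: is_cvg_seriesZ; exact: is_cvg_series_exp_coeff.
Qed.

Lemma cvg_expm n (A : 'M[R]_n) : series (expm_coef A) @ \oo --> expm A.
Proof. exact: is_cvg_expm. Qed.

Lemma mx_norm_expm n (A : 'M[R]_n) :
  `|expm A| <= `|1 : 'M[R]_n| * expR (n%:R * `|A|).
Proof.
have h : (fun k => `|series (expm_coef A) k|) @ \oo --> `|expm A|.
  by apply: cvg_norm; exact: cvg_expm.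
have h2 : (`|1 : 'M[R]_n| \*o series (exp_coeff (n%:R * `|A|))) @ \oo -->
    `|1 : 'M[R]_n| * expR (n%:R * `|A|).
  by apply: cvgZ; [exact: cvg_cst|exact: is_cvg_series_exp_coeff].
rewrite -(cvg_lim _ h)// -(cvg_lim _ h2)//.
apply: ler_lim; [exact/cvgP/h|exact/cvgP/h2|].
apply: nearW => k /=; rewrite /series /=.
rewrite (le_trans (ler_norm_sum _ _ _))// mulr_sumr ler_sum// => i _.
exact: mx_norm_expm_coef.
Qed.

(** Termwise, A^k X = X B^k. The matrix [X] is rectangular and need not be invertible: block
    inclusions, block projections and block scalings are the choices made below. *)
Lemma expm_intertwine n p (A : 'M[R]_n) (B : 'M[R]_p) (X : 'M[R]_(n, p)) :
  A *m X = X *m B -> expm A *m X = X *m expm B.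
Proof.
move=> AX.
have AXk k : A ^+ k *m X = X *m B ^+ k.
  elim: k => [|k IHk]; first by rewrite !expr0 mul1mx mulmx1.
  by rewrite !exprSr -!mulmxE -mulmxA AX mulmxA IHk mulmxA.
have h1 : (fun k => series (expm_coef A) k *m X) @ \oo --> expm A *m X.
  apply: (continuous_cvg (h := mulmxr X) _ _ (@cvg_expm _ A)).
  exact: linear_mx_continuous.
have h2 : (fun k => X *m series (expm_coef B) k) @ \oo --> X *m expm B.
  apply: (continuous_cvg _ _ (@cvg_expm _ B)).
  exact: (@linear_mx_continuous _ _ _ _ (mulmx X)).
rewrite -(cvg_lim _ h1)// -(cvg_lim _ h2)//; congr (limn _); apply/funext => k.
rewrite /series /= mulmx_suml mulmx_sumr; apply: eq_bigr => i _.
by rewrite -scalemxAl -scalemxAr AXk.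
Qed.

Lemma expm0 n : expm (0 : 'M[R]_n) = 1.
Proof.
rewrite /expm -(cvg_lim _ (_ : series (expm_coef 0) @ \oo --> (1 : 'M[R]_n)))//.
rewrite -cvg_shiftS (_ : [sequence _]_n = cst 1); first exact: cvg_cst.
apply/funext => k; rewrite /series /=.
rewrite big_nat_recl//= /expm_coef expr0 fact0 invr1 scale1r big1 ?addr0// => i _.
by rewrite expr0n scaler0.
Qed.

Lemma expm_tr n (A : 'M[R]_n) : (expm A)^T = expm A^T.
Proof.
have h1 : (fun k => (series (expm_coef A) k)^T) @ \oo --> (expm A)^T.
  apply: (continuous_cvg _ _ (@cvg_expm _ A)).
  exact: (@linear_mx_continuous _ _ _ _ (@trmx R n n)).
rewrite -(cvg_lim _ h1)//; congr (limn _); apply/funext => k.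
rewrite /series /= linear_sum; apply: eq_bigr => i _; rewrite linearZ /=; congr (_ *: _).
elim: i => [|i IHi]; first by rewrite !expr0 trmx1.
by rewrite exprSr -mulmxE trmx_mul IHi exprS.
Qed.

End Exp.

(** * Derivative of the exponential *)

Section Dexp.
Context {R : realType}.

Fact ursubmx_linear m1 m2 n1 n2 : linear (@ursubmx R m1 m2 n1 n2).
Proof. by move=> c A B; rewrite /ursubmx !linearP. Qed.

HB.instance Definition _ m1 m2 n1 n2 := GRing.isLinear.Build R
  'M[R]_(m1 + m2, n1 + n2) 'M[R]_(m1, n2) *:%R (@ursubmx R m1 m2 n1 n2)
  (@ursubmx_linear m1 m2 n1 n2).

(** This is Duhamel's integral of exp ((1 - t) A) H exp (t B) over t in [0, 1], the divided
    difference of exp at [A] and [B] in direction [H]; the corner block defines it without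
    integration. *)
Definition divexpm n p (A : 'M[R]_n) (H : 'M[R]_(n, p)) (B : 'M[R]_p) : 'M[R]_(n, p) :=
  ursubmx (expm (block_mx A H 0 B : 'M[R]_(n + p))).

Definition dexpm n (A H : 'M[R]_n) : 'M[R]_n := divexpm A H A.

Lemma expm_block n p (A : 'M[R]_n) (H : 'M[R]_(n, p)) (B : 'M[R]_p) :
  expm (block_mx A H 0 B : 'M[R]_(n + p)) =
  block_mx (expm A) (divexpm A H B) 0 (expm B).
Proof.
set T := block_mx A H 0 B.
(* The first block column spans a subspace invariant under [T], with restriction [A]; dually, [B] is
   the induced quotient map. These two intertwiners determine every block except the upper right
   one. *)
have h1 : T *m col_mx 1%:M 0 = col_mx 1%:M 0 *m A.
  by rewrite mul_block_col mul_col_mx !mul1mx !mul0mx !mulmx1 !mulmx0 addr0 add0r.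
have h2 : B *m row_mx 0 1%:M = row_mx 0 1%:M *m T.
  by rewrite mul_row_block mul_mx_row !mul1mx !mul0mx !mulmx1 !mulmx0 !add0r.
have /= e1 := expm_intertwine h1; have /= e2 := expm_intertwine h2.
rewrite -[expm T in LHS]submxK; congr block_mx.
- move: e1; rewrite -{1}[expm T]submxK mul_block_col mul_col_mx !mulmx1 !mulmx0 !addr0.
  by rewrite mul1mx mul0mx => /eq_col_mx[].
- move: e1; rewrite -{1}[expm T]submxK mul_block_col mul_col_mx !mulmx1 !mulmx0 !addr0.
  by rewrite mul1mx mul0mx => /eq_col_mx[].
- move: e2; rewrite -{1}[expm T]submxK mul_row_block mul_mx_row !mul1mx !mul0mx !mulmx0.
  by rewrite !mulmx1 !add0r => /eq_row_mx[].
Qed.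

(** The intertwiner diag(H, 1) relates the block matrix with corner [H] to the one with corner 1,
    also for singular [H]. *)
Lemma dexpm_comm n (A H : 'M[R]_n) : A *m H = H *m A -> dexpm A H = H *m dexpm A 1.
Proof.
move=> AH.
have : block_mx A H 0 A *m block_mx H 0 0 1%:M = block_mx H 0 0 1%:M *m block_mx A 1%:M 0 A.
  rewrite !mulmx_block !mul0mx !mulmx0 !mulmx1 !mul1mx !addr0 !add0r.
  by rewrite AH.
move=> /expm_intertwine; rewrite !expm_block !mulmx_block.
rewrite !mul0mx !mulmx0 !mulmx1 !mul1mx !addr0 !add0r => /eq_block_mx[_ + _ _].
by [].
Qed.

(* Second-order divided difference: the intertwiner is the column (1, 1, 1). *)
Lemma expm_taylor n (A H : 'M[R]_n) :
  expm (A + H) = expm A + dexpm A H +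
    usubmx (divexpm (block_mx A H 0 A) (col_mx 0 H) (A + H)).
Proof.
set D := block_mx A H 0 A; set K := col_mx _ _.
have : block_mx D K 0 (A + H) *m col_mx (col_mx 1%:M 1%:M) 1%:M =
    col_mx (col_mx 1%:M 1%:M) 1%:M *m (A + H).
  rewrite !mul_block_col !mul_col_mx !mulmx1 !mul1mx mul0mx !add0r add_col_mx addr0.
  by rewrite addrC.
move=> /expm_intertwine; rewrite expm_block mul_block_col mul_col_mx !mulmx1 => /eq_col_mx[+ _].
rewrite {1}/D expm_block mul_block_col mul_col_mx !mulmx1 mul1mx.
rewrite -{1}[divexpm D _ _]vsubmxK add_col_mx => /eq_col_mx[+ _].
by move=> <-.
Qed.

(** Homogeneity comes from the intertwiner diag(c, 1). For additivity, a single matrix [T] with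
    diagonal blocks A, A, A carries [H1] and [H2] side by side; the columns (1, 1), (1, 0) and (0,
    1) read off the directions H1 + H2, H1 and H2. *)
Lemma dexpm_linear n (A : 'M[R]_n) : linear (dexpm A).
Proof.
have dZ c H : dexpm A (c *: H) = c *: dexpm A H.
  have : block_mx A (c *: H) 0 A *m block_mx c%:M 0 0 1%:M =
      block_mx c%:M 0 0 1%:M *m block_mx A H 0 A.
    rewrite !mulmx_block !mul0mx !mulmx0 !mulmx1 !mul1mx !addr0 !add0r.
    by rewrite -scalar_mxC !mul_scalar_mx.
  move=> /expm_intertwine; rewrite !expm_block !mulmx_block.
  rewrite !mul0mx !mulmx0 !mulmx1 !mul1mx !addr0 !add0r => /eq_block_mx[_ + _ _].
  by rewrite mul_scalar_mx.
have dD H1 H2 : dexpm A (H1 + H2) = dexpm A H1 + dexpm A H2.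
  pose T := block_mx A (row_mx H1 H2) 0 (block_mx A 0 0 A).
  pose U := divexpm A (row_mx H1 H2) (block_mx A 0 0 A).
  have e0 : T *m block_mx 1%:M 0 0 (col_mx 1%:M 1%:M) =
      block_mx 1%:M 0 0 (col_mx 1%:M 1%:M) *m block_mx A (H1 + H2) 0 A.
    rewrite !mulmx_block !mul0mx !mulmx0 !mulmx1 !mul1mx !addr0 !add0r.
    by rewrite mul_row_col mul_block_col !mulmx1 mul_col_mx mul1mx addr0 add0r.
  have e1 : T *m block_mx 1%:M 0 0 (col_mx 1%:M 0) =
      block_mx 1%:M 0 0 (col_mx 1%:M 0) *m block_mx A H1 0 A.
    rewrite !mulmx_block !mul0mx !mulmx0 !mulmx1 !mul1mx !addr0 !add0r.
    by rewrite mul_row_col mul_block_col !mulmx1 mul_col_mx !mul0mx !mulmx0 mul1mx !addr0.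
  have e2 : T *m block_mx 1%:M 0 0 (col_mx 0 1%:M) =
      block_mx 1%:M 0 0 (col_mx 0 1%:M) *m block_mx A H2 0 A.
    rewrite !mulmx_block !mul0mx !mulmx0 !mulmx1 !mul1mx !addr0 !add0r.
    by rewrite mul_row_col mul_block_col !mulmx1 mul_col_mx !mul0mx !mulmx0 mul1mx !add0r.
  have aux H X : T *m block_mx 1%:M 0 0 X = block_mx 1%:M 0 0 X *m block_mx A H 0 A ->
      U *m X = dexpm A H.
    move=> /expm_intertwine; rewrite {1}/T !expm_block -/U !mulmx_block.
    by rewrite !mul0mx !mulmx0 !mulmx1 !mul1mx !addr0 !add0r => /eq_block_mx[_ + _ _].
  rewrite -(aux _ _ e0) -(aux _ _ e1) -(aux _ _ e2) -mulmxDr; congr (_ *m _).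
  by rewrite add_col_mx addr0 add0r.
by move=> c H1 H2; rewrite dD dZ.
Qed.

HB.instance Definition _ n (A : 'M[R]_n) :=
  GRing.isLinear.Build R 'M[R]_n 'M[R]_n *:%R (dexpm A) (dexpm_linear A).

Lemma dexpm1 n (A : 'M[R]_n) : dexpm A 1 = expm A.
Proof.
pose T := block_mx A 1%:M 0 A.
have Tk k : ursubmx (T ^+ k) = A ^+ k.-1 *+ k /\ T ^+ k = block_mx (A ^+ k) (A ^+ k.-1 *+ k) 0 (A ^+ k).
  suff h : T ^+ k = block_mx (A ^+ k) (A ^+ k.-1 *+ k) 0 (A ^+ k).
    by split=> //; rewrite h block_mxKur.
  elim: k => [|k IHk]; first by rewrite !expr0 mulr0n -[1]/(1%:M) scalar_mx_block.
  rewrite exprS IHk -mulmxE mulmx_block !mul0mx mulmx0 mul1mx addr0 !add0r !mulmxE.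
  rewrite -!exprS !mulr0; congr block_mx; case: k {IHk} => [|k]; first by rewrite mulr0n mulr0 add0r.
  by rewrite mulrnAr -exprS /= [RHS]mulrS addrC.
(* The corner of T^k / k! is k A^(k-1) / k!: it vanishes for k = 0 and is otherwise the term of
   index k - 1 of the exponential series, hence the shift by one. *)
have h1 : (fun k => ursubmx (series (expm_coef T) k.+1)) @ \oo --> dexpm A 1.
  have h0 : (fun k => ursubmx (series (expm_coef T) k)) @ \oo --> dexpm A 1.
    apply: (continuous_cvg (h := @ursubmx R n n n n) _ _ (@cvg_expm R _ T)).
    exact: linear_mx_continuous.
  by move: h0; rewrite -cvg_shiftS.
rewrite -(cvg_lim _ h1)//; congr (limn _); apply/funext => k.
rewrite /series /= linear_sum big_nat_recl//= /expm_coef linearZ /= (Tk 0).1 mulr0n scaler0 add0r.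
apply: eq_bigr => i _; rewrite linearZ /= (Tk i.+1).1 /= factS natrM invfM.
by rewrite -[A ^+ i *+ _]scaler_nat scalerA mulrAC mulVf ?pnatr_eq0// mul1r.
Qed.

Lemma dexpm_commE n (A H : 'M[R]_n) : A *m H = H *m A -> dexpm A H = H *m expm A.
Proof. by move=> AH; rewrite dexpm_comm// dexpm1. Qed.

Lemma mx_norm_ursub m1 m2 n1 n2 (A : 'M[R]_(m1 + m2, n1 + n2)) : `|ursubmx A| <= `|A|.
Proof. by apply: mx_norm_le => // i j; rewrite !mxE mx_norm_entry. Qed.

Lemma mx_norm_usub m1 m2 n (A : 'M[R]_(m1 + m2, n)) : `|usubmx A| <= `|A|.
Proof. by apply: mx_norm_le => // i j; rewrite !mxE mx_norm_entry. Qed.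

(* Conjugation by diag(s^2, s, 1) scales the two off-diagonal blocks, which makes
   the second-order remainder explicitly quadratic in [H]. *)
Lemma expm_taylor_scale n (A H : 'M[R]_n) (s : R) : s != 0 ->
  expm (A + H) = expm A + dexpm A H + s ^+ 2 *:
    usubmx (divexpm (block_mx A (s^-1 *: H) 0 A) (col_mx 0 (s^-1 *: H)) (A + H)).
Proof.
move=> s0; rewrite expm_taylor; congr (_ + _).
set D := block_mx A H 0 A; set Ds := block_mx A _ 0 A.
pose Z : 'M[R]_(n + n) := block_mx (s ^+ 2)%:M 0 0 s%:M.
have : block_mx D (col_mx 0 H) 0 (A + H) *m block_mx Z 0 0 1%:M =
   block_mx Z 0 0 1%:M *m block_mx Ds (col_mx 0 (s^-1 *: H)) 0 (A + H).
  rewrite !mulmx_block !mul0mx !mulmx0 !mulmx1 !mul1mx !addr0 !add0r.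
  congr block_mx.
    by rewrite !scalar_mxC !mul_scalar_mx scalerA expr2 mulfK.
  rewrite mul_block_col !mul0mx mulmx0 !add0r mul_scalar_mx.
  by rewrite scalerA divff// scale1r.
move=> /expm_intertwine; rewrite !expm_block !mulmx_block.
rewrite !mul0mx !mulmx0 !mulmx1 !mul1mx !addr0 !add0r => /eq_block_mx[_ -> _ _].
by rewrite -[divexpm Ds _ _]vsubmxK mul_block_col mul0mx addr0 mul_scalar_mx !col_mxKu.
Qed.

Lemma expm_taylor_bound n (A : 'M[R]_n) : exists2 C, 0 <= C & forall H, `|H| <= 1 ->
  `|expm (A + H) - expm A - dexpm A H| <= C * `|H| ^+ 2.
Proof.
(* With s = |H| in [expm_taylor_scale] the scaled directions have norm 1, so |A| + 1 bounds every
   block of the 3n x 3n matrix, and [C] bounds its exponential uniformly in [H]. *)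
pose C := `|1 : 'M[R]_(n + n + n)| * expR ((n + n + n)%:R * (`|A| + 1)).
exists C => [|H H1]; first by rewrite /C mulr_ge0 ?expR_ge0.
have [->|H0] := eqVneq H 0.
  by rewrite addr0 subrr linear0 subrr !normr0 expr0n mulr0.
have s0 : `|H| != 0 by rewrite normr_eq0.
rewrite (expm_taylor_scale A H s0) [_ + _ *: _]addrC -addrA -opprD addrK.
rewrite normrZ ger0_norm ?exprn_ge0// mulrC ler_wpM2r ?exprn_ge0//.
rewrite (le_trans (mx_norm_usub _))// (le_trans (mx_norm_ursub _))//.
rewrite (le_trans (mx_norm_expm _))// ler_wpM2l// ler_expR ler_wpM2l//.
have Hs : `| `|H|^-1 *: H | = 1 by rewrite normrZ normfV normr_id mulVf.
have A1 : `|A| <= `|A| + 1 by rewrite lerDl.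
have A2 : 1 <= `|A| + 1 by rewrite lerDr.
have A3 : 0 <= `|A| + 1 by rewrite addr_ge0.
apply: mx_norm_block => //; rewrite ?normr0//.
- by apply: mx_norm_block => //; rewrite ?normr0// Hs.
- apply: mx_norm_le => // i j; rewrite !mxE; case: splitP => k _; rewrite ?mxE ?normr0//.
  by rewrite (le_trans _ A2)// -Hs; have := mx_norm_entry (`|H|^-1 *: H) k j; rewrite mxE.
- by rewrite (le_trans (ler_normD _ _))// lerD2l.
Qed.

End Dexp.

Section DiffCriterion.
Context {R : realType}.

Lemma is_diff_eps (V W : normedModType R) (f : V -> W) (L : {linear V -> W}) x :
  continuous L ->
  (forall e, 0 < e -> \forall h \near (0 : V), `|f (x + h) - f x - L h| <= e * `|h|) ->
  is_diff x f L.
Proof.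
move=> Lc fL.
have E : f \o shift x = cst (f x) + L +o_ (0 : V) id.
  apply/eqaddoP => e e0; have := fL _ e0; apply: filterS => h.
  by rewrite /= !fctE /= opprD addrA [h + x]addrC.
have D := diff_unique Lc E.
by apply: DiffDef => //; apply/diff_locallyP; rewrite D.
Qed.

Lemma is_diff_quad (V W : normedModType R) (f : V -> W) (L : {linear V -> W}) x C :
  continuous L -> (\forall h \near (0 : V), `|f (x + h) - f x - L h| <= C * `|h| ^+ 2) ->
  is_diff x f L.
Proof.
move=> Lc fL; apply: is_diff_eps => // e e0; near=> h.
have h1 : `|f (x + h) - f x - L h| <= C * `|h| ^+ 2 by near: h.
rewrite (le_trans h1)// expr2 mulrA ler_wpM2r//.
rewrite (@le_trans _ _ (`|C| * `|h|))// ?ler_wpM2r ?ler_norm//.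
have C1 : 0 < `|C| + 1 by rewrite ltr_wpDl.
have : `|h| <= e / (`|C| + 1) by near: h; apply: nbhs0_le; rewrite divr_gt0.
rewrite ler_pdivlMr// => /(le_trans _); apply; rewrite mulrC ler_wpM2l// lerDl//.
Unshelve. all: by end_near. Qed.

Lemma is_diff_expm n (A : 'M[R]_n) : is_diff A (@expm R n) (dexpm A).
Proof.
have [C _ AC] := expm_taylor_bound A.
apply: (@is_diff_quad _ _ _ _ _ C); first exact: linear_mx_continuous.
by apply: filterS (@nbhs0_le R 'M[R]_n 1 ltr01) => H; exact: AC.
Qed.

Lemma differentiable_expm n (A : 'M[R]_n) : differentiable (@expm R n) A.
Proof. exact: (@ex_diff _ _ _ _ _ _ _ (is_diff_expm A)). Qed.

Lemma diff_expm n (A : 'M[R]_n) : 'd (@expm R n) A = dexpm A :> (_ -> _).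
Proof. exact: (@diff_val _ _ _ _ _ _ _ (is_diff_expm A)). Qed.

End DiffCriterion.

(** * Differential calculus on open sets *)

(* Unlike [Defs.Ck], [Cd] asks for total differentiability on an open set of the
   ambient space, which makes it stable under composition. *)
Fixpoint Cd {R : realType} (V W : normedModType R) (k : nat) (U : set V) (f : V -> W) : Prop :=
  match k with
  | 0 => forall x, U x -> {for x, continuous f}
  | k'.+1 => (forall x, U x -> differentiable f x) /\
             forall v, Cd k' U (fun x => 'D_v f x)
  end.

Section CdTheory.
Context {R : realType}.
Implicit Types V W : normedModType R.

Lemma Cd_diff V W k U (f : V -> W) x : Cd k.+1 U f -> U x -> differentiable f x.
Proof. by move=> [+ _]; apply. Qed.

Lemma Cd_cont V W k U (f : V -> W) x : Cd k U f -> U x -> {for x, continuous f}.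
Proof.
case: k => [|k]; first by apply.
by move=> [df _] /df; exact: differentiable_continuous.
Qed.

Lemma Cd_lt V W k U (f : V -> W) : Cd k.+1 U f -> Cd k U f.
Proof.
elim: k f => [|k IHk] f [df Df]; first by move=> x /df; exact: differentiable_continuous.
by split=> // v; apply: IHk; exact: Df.
Qed.

Lemma near_eq_diff V W (f g : V -> W) x : (\near x, f x = g x) ->
  differentiable f x -> differentiable g x.
Proof.
move=> fg df.
suff h : is_diff x g ('d f x) by exact: (@ex_diff _ _ _ _ _ _ _ h).
apply: is_diff_eps => [|e e0]; first exact: diff_continuous.
have /diff_locallyP[_ /eqaddoP/(_ _ e0)] := df.
have fgx : f x = g x := nbhs_singleton fg.
have : \forall h \near (0 : V), f (x + h) = g (x + h).
  have : (x + h) @[h --> (0 : V)] --> x.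
    by rewrite -[X in _ --> X]addr0; apply: cvgD; [exact: cvg_cst|exact: cvg_id].
  by move=> /(_ _ fg).
apply: filterS2 => h /= fgh; rewrite !fctE /= opprD addrA [h + x]addrC.
by rewrite fgh fgx.
Qed.

Lemma Cd_eq V W k (U : set V) (f g : V -> W) : open U -> {in U, f =1 g} ->
  Cd k U f -> Cd k U g.
Proof.
move=> oU; elim: k f g => [|k IHk] f g fg.
  move=> /= Cf x Ux.
  have nfg : \near x, f x = g x.
    by apply: filterS (open_nbhs_nbhs (conj oU Ux)) => y Uy; apply: fg; rewrite inE.
  have := Cf x Ux; rewrite /prop_for /continuous_at -(nbhs_singleton nfg) => h.
  by apply: cvg_trans h; apply: near_eq_cvg.
move=> [df Df].
have nfg x : U x -> \near x, f x = g x.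
  by move=> Ux; apply: filterS (open_nbhs_nbhs (conj oU Ux)) => y Uy; apply: fg; rewrite inE.
split=> [x Ux|v]; first by apply: near_eq_diff (df x Ux); exact: nfg.
apply: (IHk _ _ _ (Df v)) => x; rewrite inE => Ux.
by apply: near_eq_derive; exact: nfg.
Qed.

Lemma Cd_eqfun V W k (U : set V) (f g : V -> W) : f =1 g -> Cd k U f -> Cd k U g.
Proof. by move=> /funext ->. Qed.

Lemma Cd_cst V W k (U : set V) (c : W) : Cd k U (fun=> c).
Proof.
elim: k c => [|k IHk] c /=; first by move=> x _; exact: cvg_cst.
split=> [x _|v]; first exact: differentiable_cst.
by apply: (Cd_eqfun (f := fun=> 0)) => // x; rewrite derive_cst.
Qed.

Lemma Cd_linear V W k (U : set V) (f : {linear V -> W}) : continuous f -> Cd k U f.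
Proof.
move=> cf; case: k => [|k] /=; first by move=> x _; exact: cf.
split=> [x _|v]; first exact: linear_differentiable.
apply: (Cd_eqfun (f := fun=> f v)); last exact: Cd_cst.
by move=> x; rewrite deriveE ?diff_lin//; exact: linear_differentiable.
Qed.

Lemma Cd_linear_mx W m n k (U : set 'M[R]_(m, n)) (f : {linear 'M[R]_(m, n) -> W}) :
  Cd k U f.
Proof. by apply: Cd_linear; exact: linear_mx_continuous. Qed.

Lemma CdD V W k (U : set V) (f g : V -> W) : open U ->
  Cd k U f -> Cd k U g -> Cd k U (fun x => f x + g x).
Proof.
move=> oU; elim: k f g => [|k IHk] f g /= => [cf cg x Ux|[df Df] [dg Dg]].
  by apply: cvgD; [exact: cf|exact: cg].
split=> [x Ux|v]; first by apply: differentiableD; [exact: df|exact: dg].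
apply: (Cd_eq (f := fun x => 'D_v f x + 'D_v g x)) => //; last exact: IHk.
by move=> x; rewrite inE => Ux; rewrite deriveD//; apply: diff_derivable; [exact: df|exact: dg].
Qed.

Lemma Cd_lin_comp V W W' k (U : set V) (f : V -> W) (L : {linear W -> W'}) : open U ->
  continuous L -> Cd k U f -> Cd k U (L \o f).
Proof.
move=> oU cL; elim: k f => [|k IHk] f /= => [cf x Ux|[df Df]].
  by apply: continuous_comp; [exact: cf|exact: cL].
have dL x : differentiable L x by exact: linear_differentiable.
split=> [x Ux|v]; first by apply: differentiable_comp => //; exact: df.
apply: (Cd_eq (f := L \o (fun x => 'D_v f x))) => //; last exact: IHk.
move=> x; rewrite inE => Ux /=; have dfx := df _ Ux.
rewrite [RHS]deriveE; last exact: differentiable_comp.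
by rewrite diff_comp// deriveE// /= diff_lin.
Qed.

Lemma Cd_sum V W k (U : set V) I (r : seq I) (f : I -> V -> W) : open U ->
  (forall i, Cd k U (f i)) -> Cd k U (fun x => \sum_(i <- r) f i x).
Proof.
move=> oU Cf; elim: r => [|i r IHr].
  by apply: (Cd_eqfun (f := fun=> 0)) => [x|]; [rewrite big_nil|exact: Cd_cst].
apply: (Cd_eqfun (f := fun x => f i x + \sum_(j <- r) f j x)) => [x|].
  by rewrite big_cons.
exact: CdD.
Qed.

Lemma cvg_mulmx (T : Type) (F : set_system T) {FF : Filter F} m n p
    (f : T -> 'M[R]_(m, n)) (g : T -> 'M[R]_(n, p)) (A : 'M[R]_(m, n)) (B : 'M[R]_(n, p)) :
  f x @[x --> F] --> A -> g x @[x --> F] --> B -> (f x *m g x) @[x --> F] --> A *m B.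
Proof.
move=> fA gB.
have mE (C : 'M[R]_(m, n)) (D : 'M[R]_(n, p)) :
    C *m D = \sum_i \sum_j \sum_k (C i k * D k j) *: delta_mx i j.
  rewrite [LHS]matrix_sum_delta; apply: eq_bigr => i _; apply: eq_bigr => j _.
  by rewrite mxE scaler_suml.
under eq_fun do rewrite mE.
rewrite mE; apply: cvg_sum => i; apply: cvg_sum => j; apply: cvg_sum => k.
apply: cvgZr_tmp; apply: cvgM.
  exact: (cvg_comp _ _ fA (@coord_continuous R m n i k A)).
exact: (cvg_comp _ _ gB (@coord_continuous R n p k j B)).
Qed.

Fact mulmx_bilinear m n p : bilinear_for
  (GRing.Scale.Law.clone _ _ *:%R _) (GRing.Scale.Law.clone _ _ *:%R _)
  (@mulmx R m n p).
Proof.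
split=> [A c B C|A c B C].
  by rewrite mulmxDl -scalemxAl.
by rewrite mulmxDr -scalemxAr.
Qed.

HB.instance Definition _ m n p := bilinear_isBilinear.Build R 'M[R]_(m, n) 'M[R]_(n, p)
  'M[R]_(m, p) _ _ (@mulmx R m n p) (@mulmx_bilinear m n p).

Lemma is_diff_mulmx V m n p (f df : V -> 'M[R]_(m, n)) (g dg : V -> 'M[R]_(n, p)) x :
  is_diff x f df -> is_diff x g dg ->
  is_diff x (fun y => f y *m g y) (fun v => df v *m g x + f x *m dg v).
Proof.
move=> fx gx.
have cm : continuous (fun p : 'M[R]_(m, n) * 'M[R]_(n, p) => p.1 *m p.2).
  by move=> q; apply: (@cvg_mulmx _ (nbhs q)); [exact: cvg_fst|exact: cvg_snd].
have dm : is_diff (f x, g x) (fun p : 'M[R]_(m, n) * 'M[R]_(n, p) => p.1 *m p.2)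
    (fun q => f x *m q.2 + q.1 *m g x).
  by apply: DiffDef; [exact: differentiable_bilin|rewrite (@diff_bilin _ _ _ _ (@mulmx R m n p))].
have := @is_diff_comp _ _ _ _ _ _ _ _ _ (is_diff_pair fx gx) dm.
move=> h; apply: is_diff_eq h _; apply/funext => v /=; by rewrite addrC.
Qed.

Lemma Cd_mulmx V m n p k (U : set V) (f : V -> 'M[R]_(m, n)) (g : V -> 'M[R]_(n, p)) :
  open U -> Cd k U f -> Cd k U g -> Cd k U (fun x => f x *m g x).
Proof.
move=> oU; elim: k f g => [|k IHk] f g => [cf cg x Ux|Cf Cg].
  by apply: cvg_mulmx; [exact: cf|exact: cg].
have dfg x : U x -> is_diff x (fun y => f y *m g y)
    (fun v => 'd f x v *m g x + f x *m 'd g x v).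
  by move=> Ux; apply: is_diff_mulmx; apply: differentiableP; [exact: Cd_diff Cf _|exact: Cd_diff Cg _].
split=> [x Ux|v]; first by exact: (@ex_diff _ _ _ _ _ _ _ (dfg x Ux)).
apply: (Cd_eq (f := fun x => 'D_v f x *m g x + f x *m 'D_v g x)) => //.
  move=> x; rewrite inE => Ux; rewrite [RHS]deriveE; last exact: (@ex_diff _ _ _ _ _ _ _ (dfg x Ux)).
  rewrite (@diff_val _ _ _ _ _ _ _ (dfg x Ux)) !deriveE//.
    exact: Cd_diff Cg _.
  exact: Cd_diff Cf _.
apply: CdD => //; apply: IHk.
- by case: Cf => _; apply.
- exact: Cd_lt.
- exact: Cd_lt.
- by case: Cg => _; apply.
Qed.

Lemma derive_mulmx V m n p (f : V -> 'M[R]_(m, n)) (g : V -> 'M[R]_(n, p)) x v :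
  differentiable f x -> differentiable g x ->
  'D_v (fun y => f y *m g y) x = 'D_v f x *m g x + f x *m 'D_v g x.
Proof.
move=> /[dup] df /differentiableP fx /[dup] dg /differentiableP gx.
have h := is_diff_mulmx fx gx; rewrite deriveE; last exact: (@ex_diff _ _ _ _ _ _ _ h).
by rewrite (@diff_val _ _ _ _ _ _ _ h) !deriveE.
Qed.

Lemma diff_delta m n W (g : 'M[R]_(m, n) -> W) A H : differentiable g A ->
  'd g A H = \sum_i \sum_j H i j *: 'D_(delta_mx i j) g A.
Proof.
move=> dg; rewrite {1}[H]matrix_sum_delta linear_sum; apply: eq_bigr => i _.
rewrite linear_sum; apply: eq_bigr => j _.
by rewrite linearZ deriveE.
Qed.

Lemma derive_comp V W W' (f : V -> W) (g : W -> W') x v :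
  differentiable f x -> differentiable g (f x) ->
  'D_v (g \o f) x = 'd g (f x) ('D_v f x).
Proof.
move=> df dg; have h := differentiable_comp df dg.
by rewrite (deriveE v h) (diff_comp df dg) (deriveE v df).
Qed.

Lemma Cd_scale_mx V m n p q k (U : set V) (f : V -> 'M[R]_(m, n)) (g : V -> 'M[R]_(p, q)) i j :
  open U -> Cd k U f -> Cd k U g -> Cd k U (fun x => f x i j *: g x).
Proof.
move=> oU Cf Cg.
apply: (Cd_eqfun (f := fun x => (f x i j)%:M *m g x)) => [x|]; first by rewrite mul_scalar_mx.
apply: Cd_mulmx => //.
pose L (A : 'M[R]_(m, n)) : 'M[R]_p := (A i j)%:M.
have Llin : linear L by move=> c A B; rewrite /L !mxE raddfD /= -scale_scalar_mx.
pose LL : {linear _ -> _} := HB.pack L (GRing.isLinear.Build _ _ _ _ L Llin).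
apply: (Cd_lin_comp (L := LL)) => //; exact: linear_mx_continuous.
Qed.

(** The derivative of g o f along v is taken in the direction 'D_v f x, which moves with x, whereas
    [Cd] knows only fixed directions. Expanding that direction in elementary matrices gives a finite
    sum of entries of 'D_v f x times fixed directional derivatives of g at f x, to which the
    induction hypothesis applies; hence the matrix space in the middle. *)
Lemma Cd_comp V m n p q k (U : set V) (U' : set 'M[R]_(m, n)) (f : V -> 'M[R]_(m, n))
    (g : 'M[R]_(m, n) -> 'M[R]_(p, q)) :
  open U -> (forall x, U x -> U' (f x)) -> Cd k U f -> Cd k U' g -> Cd k U (g \o f).
Proof.
move=> oU fU; elim: k f g fU => [|k IHk] f g fU => [cf cg x Ux|Cf Cg].
  by apply: continuous_comp; [exact: cf|apply: cg; exact: fU].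
have df x : U x -> differentiable f x by exact: Cd_diff Cf.
have dg x : U x -> differentiable g (f x) by move=> Ux; exact: Cd_diff Cg (fU _ Ux).
split=> [x Ux|v]; first by apply: differentiable_comp; [exact: df|exact: dg].
apply: (Cd_eq (f := fun x => \sum_i \sum_j ('D_v f x) i j *: 'D_(delta_mx i j) g (f x))) => //.
  by move=> x; rewrite inE => Ux; rewrite (derive_comp _ (df _ Ux) (dg _ Ux)) (diff_delta _ (dg _ Ux)).
apply: Cd_sum => // i; apply: Cd_sum => // j; apply: Cd_scale_mx => //.
  by case: Cf => _; apply.
by apply: (IHk f (fun x => 'D_(delta_mx i j) g x)) => //; [exact: Cd_lt|case: Cg => _; apply].
Qed.

(** This exchanges a map known only on a carrier for its smooth extension, although the two may
    agree on no neighbourhood of the point. *)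
Lemma line_near_eq V W (f g : V -> W) x v : (\forall h \near (0 : R), f (x + h *: v) = g (x + h *: v)) ->
  'D_v f x = 'D_v g x /\ (derivable g x v -> derivable f x v).
Proof.
move=> fg.
have fgx : f x = g x by have := nbhs_singleton fg; rewrite scale0r addr0.
have E : \forall h \near (0 : R)^',
    h^-1 *: ((f \o shift x) (h *: v) - f x) = h^-1 *: ((g \o shift x) (h *: v) - g x).
  apply: cvg_within; apply: filterS fg => h /= e.
  by rewrite fgx [h *: v + x]addrC e.
have E' : \forall h \near (0 : R)^',
    h^-1 *: ((g \o shift x) (h *: v) - g x) = h^-1 *: ((f \o shift x) (h *: v) - f x).
  by apply: filterS E => h ->.
split.
  rewrite /derive; congr (lim _).
  by rewrite eqEsubset; split; apply: near_eq_cvg.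
rewrite /derivable => /cvg_ex[/= l gl]; apply/cvg_ex; exists l => /=.
by apply: cvg_trans gl; apply: near_eq_cvg.
Qed.

End CdTheory.

(** * Smoothness of the exponential and of matrix inversion *)

Section CdExamples.
Context {R : realType}.
Implicit Types V W : normedModType R.

(** Induction on the order for all sizes at once: the derivative along [H] is a corner of an
    exponential of twice the size, composed with an affine map. *)
Lemma Cd_expm n k (U : set 'M[R]_n) : open U -> Cd k U (@expm R n).
Proof.
move=> oU; elim: k n U oU => [|k IHk] n U oU.
  by move=> x _; apply: differentiable_continuous; exact: differentiable_expm.
split=> [x _|H]; first exact: differentiable_expm.
apply: (Cd_eqfun (f := @ursubmx R n n n n \o (fun A => expm (block_mx A H 0 A : 'M[R]_(n + n))))).
  by move=> A /=; rewrite deriveE ?diff_expm//; exact: differentiable_expm.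
apply: Cd_lin_comp => //; first exact: linear_mx_continuous.
apply: (Cd_comp (U' := setT) (f := fun A => block_mx A H 0 A : 'M[R]_(n + n)) (g := @expm R _)) => //.
  apply: (Cd_eqfun (f := fun A => (block_mx A 0 0 A : 'M[R]_(n + n)) + block_mx 0 H 0 0)).
    by move=> A; rewrite add_block_mx !addr0 add0r.
  apply: CdD => //; last exact: Cd_cst.
  have bl : linear (fun A => block_mx A 0 0 A : 'M[R]_(n + n)).
    by move=> c A B; rewrite scale_block_mx add_block_mx !scaler0 !addr0.
  pose LL : {linear _ -> _} := HB.pack (fun A => block_mx A 0 0 A : 'M[R]_(n + n))
    (GRing.isLinear.Build _ _ _ _ _ bl).
  exact: (@Cd_linear_mx R _ _ _ k U LL).
by apply: IHk; exact: openT.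
Qed.

Lemma invmxD n (A H : 'M[R]_n) : A \in unitmx -> A + H \in unitmx ->
  invmx (A + H) = invmx A - invmx A *m H *m invmx (A + H).
Proof.
move=> uA uAH; have : invmx A *m (A + H) *m invmx (A + H) = invmx A by rewrite mulmxK.
by rewrite mulmxDr mulVmx// mulmxDl mul1mx => h; apply/esym/eqP; rewrite subr_eq h.
Qed.

Lemma unitmx_near n (A : 'M[R]_n) : A \in unitmx -> exists C, exists2 r, 0 < r &
  forall H, `|H| <= r -> A + H \in unitmx /\ `|invmx (A + H)| <= C.
Proof.
(* The factors n come from two products in the max norm. For |H| <= 1 / (2c) the map X -> A^-1 H X
   at least halves norms, so X = Y - A^-1 H X forces |X| <= 2 |Y|. With Y = 0 this gives the
   invertibility of A + H, with Y = A^-1 the bound on its inverse. *)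
move=> uA; pose c := n%:R * (n%:R * `|invmx A|) + 1 : R.
have c0 : 0 < c by rewrite ltr_wpDl// !mulr_ge0.
exists (2 * `|invmx A|), (2 * c)^-1 => [|H Hr]; first by rewrite invr_gt0 mulr_gt0.
have small p (X : 'M[R]_(n, p)) : n%:R * (n%:R * `|invmx A| * `|H|) * `|X| <= 2^-1 * `|X|.
  rewrite ler_wpM2r// mulrA; apply: (@le_trans _ _ (c * `|H|)).
    by rewrite ler_wpM2r// /c lerDl.
  by rewrite mulrC -ler_pdivlMr// -invfM.
have nm p (X : 'M[R]_(n, p)) : `|invmx A *m H *m X| <= 2^-1 * `|X|.
  rewrite (le_trans (mx_norm_mul _ _))// (le_trans _ (small _ X))// ler_wpM2r//.
  by rewrite ler_wpM2l// mx_norm_mul.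
have small0 p (X Y : 'M[R]_(n, p)) : X = Y - invmx A *m H *m X -> `|X| <= 2 * `|Y|.
  move=> XE; have : `|X| <= `|Y| + 2^-1 * `|X|.
    by rewrite {1}XE (le_trans (ler_normB _ _))// lerD2l.
  lra.
have uAH : A + H \in unitmx.
  rewrite -unitmx_tr -row_free_unit -kermx_eq0; apply/eqP.
  set K := kermx _; have : (A + H) *m K^T = 0.
    by apply: trmx_inj; rewrite trmx_mul trmxK trmx0 mulmx_ker.
  rewrite mulmxDl => /(congr1 (mulmx (invmx A))); rewrite mulmxDr !mulmxA mulVmx// mul1mx mulmx0.
  move=> /eqP; rewrite addr_eq0 => /eqP h.
  have := small0 _ K^T 0; rewrite sub0r normr0 mulr0 => /(_ h).
  by rewrite normr_le0 => /eqP h0; rewrite -[K]trmxK h0 trmx0.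
split=> //; apply: small0.
exact: invmxD.
Qed.

Lemma is_diff_invmx n (A : 'M[R]_n) : A \in unitmx ->
  is_diff A invmx (fun H => - (invmx A *m H *m invmx A)).
Proof.
move=> uA; have [C [r r0 AH]] := unitmx_near uA.
pose L H := - (invmx A *m H *m invmx A).
have Llin : linear L.
  by move=> c H1 H2; rewrite /L mulmxDr mulmxDl -scalemxAr -scalemxAl opprD scalerN.
pose LL : {linear _ -> _} := HB.pack L (GRing.isLinear.Build _ _ _ _ L Llin).
pose D : R := n%:R * (n%:R * `|invmx A|) * (n%:R * (n%:R * `|invmx A|)) * `|C|.
apply: (@is_diff_quad _ _ _ invmx LL A D); first exact: linear_mx_continuous.
apply: filterS (@nbhs0_le R 'M[R]_n r r0) => H /AH[uH CH].
(* Applying [invmxD] twice leaves A^-1 H A^-1 H (A + H)^-1, which is quadratic in [H] because the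
   last factor is bounded. *)
have -> : invmx (A + H) - invmx A - LL H = invmx A *m H *m (invmx A *m H *m invmx (A + H)).
  rewrite /= /L opprK {1}invmxD// [_ - _ - _]addrAC subrr add0r addrC -mulmxBr.
  by congr (_ *m _); rewrite {1}invmxD// opprB addrC subrK.
have C0 : `|invmx (A + H)| <= `|C| by rewrite (le_trans CH)// ler_norm.
rewrite (le_trans (mx_norm_mul _ _))//.
have h1 : `|invmx A *m H| <= n%:R * `|invmx A| * `|H| by exact: mx_norm_mul.
have h2 : `|invmx A *m H *m invmx (A + H)| <= n%:R * (n%:R * `|invmx A| * `|H|) * `|C|.
  rewrite (le_trans (mx_norm_mul _ _))// ler_pM// ?mulr_ge0//.
  by rewrite ler_wpM2l.
have -> : D * `|H| ^+ 2 = n%:R * (n%:R * `|invmx A| * `|H|) * (n%:R * (n%:R * `|invmx A| * `|H|) * `|C|).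
  rewrite /D expr2; ring.
by rewrite ler_pM// ?mulr_ge0// ler_wpM2l.
Qed.

Lemma differentiable_invmx n (A : 'M[R]_n) : A \in unitmx -> differentiable invmx A.
Proof. by move=> uA; exact: (@ex_diff _ _ _ _ _ _ _ (is_diff_invmx uA)). Qed.

(** The derivative of the inverse is a product of the derivative of f and two copies of the inverse,
    so each order of smoothness yields the next. *)
Lemma Cd_invmx V n k (U : set V) (f : V -> 'M[R]_n) : open U ->
  (forall x, U x -> f x \in unitmx) -> Cd k U f -> Cd k U (fun x => invmx (f x)).
Proof.
move=> oU uf; elim: k => [|k IHk] Cf.
  move=> x Ux; apply: continuous_comp; first exact: Cf.
  by apply: differentiable_continuous; apply: differentiable_invmx; exact: uf.
have df x : U x -> differentiable f x by exact: Cd_diff Cf.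
have dg x : U x -> differentiable invmx (f x).
  by move=> Ux; apply: differentiable_invmx; exact: uf.
split=> [x Ux|v]; first by apply: (differentiable_comp (f := f)); [exact: df|exact: dg].
apply: (Cd_eq (f := fun x => (- 1)%:M *m (invmx (f x) *m 'D_v f x *m invmx (f x)))) => //.
  move=> x; rewrite inE => Ux.
  rewrite [RHS](derive_comp (g := invmx) _ (df _ Ux) (dg _ Ux)).
  rewrite (@diff_val _ _ _ _ _ _ _ (is_diff_invmx (uf _ Ux))).
  by rewrite mul_scalar_mx scaleN1r.
have Ci : Cd k U (fun x => invmx (f x)) by apply: IHk; exact: Cd_lt.
apply: Cd_mulmx => //; first exact: Cd_cst.
by do 2! apply: Cd_mulmx => //; case: Cf => _; apply.
Qed.

End CdExamples.

(** * Curves, the exponential group and monotonicity of exp *)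

Section Curves.
Context {R : realType}.

(** Phrased as a differential on [R^o] rather than with [is_derive], so that the chain and product
    rules for [is_diff] apply directly to curves. *)
Definition has_velocity (W : normedModType R) (g : R^o -> W) (t : R) (D : W) :=
  is_diff (t : R^o) g (fun h : R^o => (h : R) *: D).

Lemma velocity_derive (g : R^o -> R^o) (t D : R) : has_velocity g t D -> is_derive t 1 g D.
Proof.
move=> gt; apply: DeriveDef.
  by apply/derivable1_diffP; exact: (@ex_diff _ _ _ _ _ _ _ gt).
rewrite deriveE; last exact: (@ex_diff _ _ _ _ _ _ _ gt).
by rewrite (@diff_val _ _ _ _ _ _ _ gt) scale1r.
Qed.

Lemma velocity_comp (V W : normedModType R) (g : R^o -> V) (f df : V -> W) t D :
  has_velocity g t D -> is_diff (g t) f df -> has_velocity (f \o g) t (df D).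
Proof.
move=> gt ft; have h := is_diff_comp gt ft; apply: is_diff_eq h _.
apply/funext => h /=; have <- := @diff_val _ _ _ _ _ _ _ ft.
by rewrite linearZ.
Qed.

Lemma velocity_lin_mx m n (W : normedModType R) (g : R^o -> 'M[R]_(m, n))
    (L : {linear 'M[R]_(m, n) -> W}) t D :
  has_velocity g t D -> has_velocity (L \o g) t (L D).
Proof.
move=> gt; apply: velocity_comp gt _; apply: DiffDef; first exact: linear_mx_differentiable.
exact: diff_lin_mx.
Qed.

Lemma velocity_mulmx m n p (f : R^o -> 'M[R]_(m, n)) (g : R^o -> 'M[R]_(n, p)) t D E :
  has_velocity f t D -> has_velocity g t E ->
  has_velocity (fun s => f s *m g s) t (D *m g t + f t *m E).
Proof.
move=> ft gt; apply: is_diff_eq (is_diff_mulmx ft gt) _; apply/funext => h.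
by rewrite -scalemxAl -scalemxAr scalerDr.
Qed.

Lemma velocityD (W : normedModType R) (f g : R^o -> W) t D E :
  has_velocity f t D -> has_velocity g t E -> has_velocity (fun s => f s + g s) t (D + E).
Proof.
move=> ft gt; apply: is_diff_eq (is_diffD ft gt) _; apply/funext => h.
by rewrite scalerDr.
Qed.

Lemma velocity_cst (W : normedModType R) (c : W) t : has_velocity (fun=> c) t 0.
Proof.
by apply: is_diff_eq (is_diff_cst _ _) _; apply/funext => h; rewrite scaler0.
Qed.

Lemma velocity_line (W : normedModType R) (c d : R) (v : W) t :
  has_velocity (fun s : R^o => (c + d * s) *: v) t (d *: v).
Proof.
have h1 : has_velocity (fun s : R^o => (c + d * s) : R^o) t d.
  have hd : has_velocity (fun s : R^o => d * s : R^o) t d.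
    by apply: is_diff_eq (is_diff_scaler d (t : R^o)) _; apply/funext => h; exact: mulrC.
  by have := velocityD (velocity_cst (c : R^o) t) hd; rewrite add0r.
exact: (velocity_comp (f := fun s : R^o => (s : R) *: v) (df := fun h : R^o => (h : R) *: v) h1).
Qed.

Lemma velocity_add_line (W : normedModType R) (x v : W) t :
  has_velocity (fun s : R^o => x + (s : R) *: v) t v.
Proof.
have -> : v = 0 + 1 *: v by rewrite add0r scale1r.
apply: (velocityD (f := fun=> x)); first exact: velocity_cst.
have := velocity_line 0 1 v t; congr (has_velocity _ _ _).
  by apply/funext => s; rewrite add0r mul1r add0r scale1r.
Qed.

Lemma velocity_mvt (f : R^o -> R^o) (df : R -> R) :
  (forall t, has_velocity f t (df t)) -> exists2 c, 0 < c < 1 & f (1 : R) - f (0 : R) = df c.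
Proof.
move=> fdf.
have [||c] := @MVT R f df 0 1 ltr01.
- by move=> t _; exact: velocity_derive.
- apply: continuous_subspaceT => t; apply: differentiable_continuous.
  exact: (@ex_diff _ _ _ _ _ _ _ (fdf t)).
- rewrite in_itv /= => c01 ->; exists c => //.
  by rewrite subr0 mulr1.
Qed.

Lemma velocity0_mx m n (g : R^o -> 'M[R]_(m, n)) : (forall t, has_velocity g t 0) -> g (1 : R) = g (0 : R).
Proof.
move=> g0; apply/matrixP => i j.
have cl : linear (fun A : 'M[R]_(m, n) => A i j : R^o) by move=> c A B; rewrite !mxE.
pose LL : {linear _ -> _} := HB.pack (fun A : 'M[R]_(m, n) => A i j : R^o)
  (GRing.isLinear.Build _ _ _ _ _ cl).
have [|c _] := @velocity_mvt (fun t => g t i j) (fun=> 0).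
  by move=> t; have := velocity_lin_mx LL (g0 t); rewrite /= mxE.
by move/eqP; rewrite subr_eq0 => /eqP.
Qed.

Lemma velocity_expm n (A : 'M[R]_n) (c d t : R) :
  has_velocity (fun s : R^o => expm ((c + d * s) *: A)) t (d *: A *m expm ((c + d * t) *: A)).
Proof.
have -> : d *: A *m expm ((c + d * t) *: A) = dexpm ((c + d * t) *: A) (d *: A).
  by rewrite dexpm_commE// -!scalemxAl -!scalemxAr scalerA mulrC -scalerA.
exact: (velocity_comp (velocity_line c d A t) (is_diff_expm _)).
Qed.

End Curves.

Section ExpGroup.
Context {R : realType}.

Lemma expm_comm n (A : 'M[R]_n) t : A *m expm (t *: A) = expm (t *: A) *m A.
Proof.
by apply/esym/expm_intertwine; rewrite -scalemxAl -scalemxAr.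
Qed.

Lemma expm_addZ n (A : 'M[R]_n) s t : expm (s *: A) *m expm (t *: A) = expm ((s + t) *: A).
Proof.
(* [g] runs from exp ((s + t) A) at 0 to exp (s A) exp (t A) at 1, the two exponents always adding
   up to (s + t) A; its velocity vanishes because [A] commutes with the exponentials. *)
pose g (r : R^o) := expm ((0 + s * r) *: A) *m expm ((s + t + (- s) * r) *: A).
suff : g (1 : R) = g (0 : R).
  by rewrite /g !mulr1 !mulr0 !addr0 add0r scale0r expm0 mul1mx addrAC subrr add0r.
apply: velocity0_mx => r.
have := velocity_mulmx (velocity_expm A 0 s r) (velocity_expm A (s + t) (- s) r).
congr (has_velocity _ _ _).
rewrite -!scalemxAl expm_comm -scalemxAr scaleNr mulmxA.
by rewrite subrr.
Qed.

Lemma expmN n (A : 'M[R]_n) : expm A *m expm (- A) = 1%:M.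
Proof. by have := expm_addZ A 1 (-1); rewrite scale1r scaleN1r subrr scale0r expm0. Qed.

Lemma expm_half n (A : 'M[R]_n) : expm A = expm (2^-1 *: A) *m expm (2^-1 *: A).
Proof. by rewrite expm_addZ (_ : 2^-1 + 2^-1 = 1) ?scale1r//; field. Qed.

(** Mean-value form of Duhamel's integral. If X(t) is the corner of exp (t D), then tr (G exp ((1 -
    t) A) X(t)) goes from 0 to tr (G dexpm A H), and in its derivative the two terms containing X(t)
    cancel, leaving the integrand. *)
Lemma dexpm_mvt n (A H G : 'M[R]_n) : exists2 c, 0 < c < 1 &
  \tr (G *m dexpm A H) = \tr (G *m expm ((1 - c) *: A) *m H *m expm (c *: A)).
Proof.
pose D : 'M[R]_(n + n) := block_mx A H 0 A.
pose m (t : R^o) : R^o := \tr (G *m expm ((1 + (-1) * t) *: A) *m ursubmx (expm ((0 + 1 * t) *: D))).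
pose dm (t : R) := \tr (G *m expm ((1 - t) *: A) *m H *m expm (t *: A)).
have trl : linear (fun X : 'M[R]_n => \tr X : R^o) by move=> c X Y; rewrite linearP.
pose TT : {linear _ -> _} := HB.pack (fun X : 'M[R]_n => \tr X : R^o)
  (GRing.isLinear.Build _ _ _ _ _ trl).
have E t : expm (t *: D) = block_mx (expm (t *: A)) (ursubmx (expm (t *: D))) 0 (expm (t *: A)).
  by rewrite /D scale_block_mx scaler0 expm_block block_mxKur.
have mdm t : has_velocity m t (dm t).
  have := velocity_lin_mx TT (velocity_mulmx
    (velocity_mulmx (velocity_cst G t) (velocity_expm A 1 (-1) t))
    (velocity_lin_mx (@ursubmx R n n n n) (velocity_expm D 0 1 t))).
  congr (has_velocity _ _ _); rewrite /= /dm add0r mul1r mulN1r scale1r scaleN1r mul0mx add0r.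
  rewrite {2}E mulmx_block block_mxKur mulmxDr !mulmxA.
  rewrite mulmxN !mulNmx -[G *m A *m _]mulmxA expm_comm mulmxA.
  by rewrite addrA addNr add0r.
have m1 : m (1 : R) = \tr (G *m dexpm A H).
  by rewrite /m mulr1 subrr scale0r expm0 mulmx1 mul1r add0r scale1r.
have m0 : m (0 : R) = 0.
  rewrite /m !mulr0 add0r scale0r expm0 -[X in ursubmx X]/(1%:M) scalar_mx_block block_mxKur.
  by rewrite mulmx0 linear0.
by have [c c01] := velocity_mvt mdm; rewrite m1 m0 subr0 => h; exists c.
Qed.

(** For G = 1 the intermediate point of [dexpm_mvt] disappears by cyclicity of the trace. *)
Lemma mxtrace_dexpm n (A H : 'M[R]_n) : \tr (dexpm A H) = \tr (expm A *m H).
Proof.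
have [c _] := dexpm_mvt A H 1%:M; rewrite !mul1mx => ->.
by rewrite mxtrace_mulC mulmxA expm_addZ addrC subrK scale1r.
Qed.

(* Unlike [frob], positive definite also off the symmetric matrices. *)
Definition mxdot m n (A B : 'M[R]_(m, n)) : R := \tr (A^T *m B).

Lemma mxdotE m n (A B : 'M[R]_(m, n)) : mxdot A B = \sum_i \sum_j A i j * B i j.
Proof.
rewrite /mxdot /mxtrace exchange_big /=; apply: eq_bigr => j _.
by rewrite !mxE; apply: eq_bigr => i _; rewrite !mxE.
Qed.

Lemma mxdotC m n (A B : 'M[R]_(m, n)) : mxdot A B = mxdot B A.
Proof. by rewrite !mxdotE; apply: eq_bigr => i _; apply: eq_bigr => j _; rewrite mulrC. Qed.

Lemma mxdot_ge n m (A : 'M[R]_(m, n)) : `|A| ^+ 2 <= mxdot A A.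
Proof.
rewrite mxdotE; have [->|A0] := eqVneq A 0.
  by rewrite normr0 expr0n; apply: sumr_ge0 => i _; apply: sumr_ge0 => j _; rewrite -expr2 sqr_ge0.
have [|[i j] /= Aij] := @mx_norm_neq0 R m n A; first by rewrite -[mx_norm A]/(`|A|) normr_eq0.
rewrite -[`|A|]/(mx_norm A) Aij real_normK ?num_real// (bigD1 i)//= (bigD1 j)//= expr2 -addrA lerDl.
apply: addr_ge0; apply: sumr_ge0 => k _; first by rewrite -expr2 sqr_ge0.
by apply: sumr_ge0 => l _; rewrite -expr2 sqr_ge0.
Qed.

Lemma mxdot_le m n (A B : 'M[R]_(m, n)) : `|mxdot A B| <= (m * n)%:R * `|A| * `|B|.
Proof.
rewrite mxdotE (le_trans (ler_norm_sum _ _ _))//.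
rewrite (@le_trans _ _ (\sum_(i < m) n%:R * (`|A| * `|B|)))//; last first.
  by rewrite sumr_const card_ord -[leLHS]mulr_natl natrM !mulrA.
apply: ler_sum => i _; rewrite (le_trans (ler_norm_sum _ _ _))//.
rewrite (@le_trans _ _ (\sum_(j < n) (`|A| * `|B|)))//; last first.
  by rewrite sumr_const card_ord -[leLHS]mulr_natl.
by apply: ler_sum => j _; rewrite normrM ler_pM// mx_norm_entry.
Qed.

Lemma mxdot_ge0 m n (A : 'M[R]_(m, n)) : 0 <= mxdot A A.
Proof. by rewrite (le_trans _ (mxdot_ge A))// sqr_ge0. Qed.

Lemma mxdot_eq0 m n (A : 'M[R]_(m, n)) : mxdot A A <= 0 -> A = 0.
Proof.
move=> A0; apply/eqP; rewrite -normr_eq0 -sqrf_eq0 eq_le sqr_ge0 andbT.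
exact: le_trans (mxdot_ge A) A0.
Qed.

Lemma trmx_expm_sym n (A : 'M[R]_n) t : Sym A -> (expm (t *: A))^T = expm (t *: A).
Proof. by move=> SA; rewrite expm_tr linearZ /= SA. Qed.

Lemma expm_sym n (A : 'M[R]_n) : Sym A -> Sym (expm A).
Proof. by move=> SA; rewrite /Sym /= expm_tr SA. Qed.

Lemma mxdotDr m n (A B C : 'M[R]_(m, n)) : mxdot A (B + C) = mxdot A B + mxdot A C.
Proof. by rewrite /mxdot mulmxDr linearD. Qed.

Lemma mxdotZr m n c (A B : 'M[R]_(m, n)) : mxdot A (c *: B) = c * mxdot A B.
Proof. by rewrite /mxdot -scalemxAr linearZ. Qed.

Fact mxdot_linear m n (A : 'M[R]_(m, n)) : linear (mxdot A : 'M[R]_(m, n) -> R^o).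
Proof. by move=> c B C; rewrite mxdotDr mxdotZr. Qed.

Definition mxdot_lin m n (A : 'M[R]_(m, n)) : {linear 'M[R]_(m, n) -> R^o} :=
  HB.pack (mxdot A : 'M[R]_(m, n) -> R^o) (GRing.isLinear.Build _ _ _ _ _ (mxdot_linear A)).

Lemma mxdotDl m n (A B C : 'M[R]_(m, n)) : mxdot (B + C) A = mxdot B A + mxdot C A.
Proof. by rewrite mxdotC mxdotDr !(mxdotC A). Qed.

Lemma mxdotZl m n c (A B : 'M[R]_(m, n)) : mxdot (c *: B) A = c * mxdot B A.
Proof. by rewrite mxdotC mxdotZr (mxdotC A). Qed.

Lemma mxdotBr m n (A B C : 'M[R]_(m, n)) : mxdot A (B - C) = mxdot A B - mxdot A C.
Proof. by rewrite mxdotDr -scaleN1r mxdotZr mulN1r. Qed.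

Lemma mxdotBl m n (A B C : 'M[R]_(m, n)) : mxdot (B - C) A = mxdot B A - mxdot C A.
Proof. by rewrite mxdotC mxdotBr !(mxdotC A). Qed.

Lemma mxdot_mulr m n p (A : 'M[R]_(m, n)) (B : 'M[R]_(m, p)) (C : 'M[R]_(p, n)) :
  mxdot A (B *m C) = mxdot (B^T *m A) C.
Proof. by rewrite /mxdot trmx_mul trmxK mulmxA. Qed.

(* By the mean value theorem, tr (H dexpm A H) = |P H Q|^2 where P and Q are square
   roots of exp ((1 - t) A) and exp (t A), whose inverses are bounded. *)
Lemma dexpm_coercive n (r : R) : exists2 mu, 0 < mu & forall A H : 'M[R]_n,
  Sym A -> Sym H -> `|A| <= r -> mu * `|H| ^+ 2 <= \tr (H *m dexpm A H).
Proof.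
(* [c] bounds the inverse square roots exp (- s A / 2) for |A| <= r and s in [0, 1]. Recovering H as
   P' X Q' costs a factor n^2 c^2 <= K, whence the modulus K^-2; n + 1 in place of n keeps [K]
   positive for n = 0. *)
pose c := `|1 : 'M[R]_n| * expR (n%:R * `|r|) + 1.
have c0 : 0 < c by rewrite ltr_wpDl// mulr_ge0// expR_ge0.
pose K : R := (n%:R + 1) ^+ 2 * c ^+ 2.
have K0 : 0 < K by rewrite mulr_gt0// exprn_gt0// ltr_wpDl.
exists (K ^- 2) => [|A H SA SH Ar]; first by rewrite invr_gt0 exprn_gt0.
have root s : 0 <= s <= 1 -> exists P P' : 'M[R]_n,
    [/\ expm (s *: A) = P *m P, P^T = P, P' *m P = 1%:M, P *m P' = 1%:M & `|P'| <= c].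
  move=> /andP[s0 s1]; exists (expm ((s / 2) *: A)), (expm ((- (s / 2)) *: A)); split.
  - by rewrite expm_addZ -splitr.
  - exact: trmx_expm_sym.
  - by rewrite expm_addZ addNr scale0r expm0.
  - by rewrite expm_addZ addrN scale0r expm0.
  - rewrite (le_trans (mx_norm_expm _))// /c ler_wpDr// ler_wpM2l// ler_expR ler_wpM2l//.
    have s2 : `|- (s / 2)| <= 1 by rewrite normrN ger0_norm; lra.
    by rewrite normrZ (le_trans (ler_wpM2r _ s2))// mul1r (le_trans Ar)// ler_norm.
have [t /andP[t0 t1] ->] := dexpm_mvt A H H.
have [|P [P' [-> PT P'P _ nP']]] := root (1 - t); first by lra.
have [|Q [Q' [-> QT _ QQ' nQ']]] := root t; first by lra.
set X := P *m H *m Q.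
have -> : \tr (H *m (P *m P) *m H *m (Q *m Q)) = mxdot X X.
  by rewrite /mxdot /X !trmx_mul PT QT SH mulmxA mxtrace_mulC !mulmxA.
apply: le_trans (mxdot_ge _).
have nH : `|H| <= K * `|X|.
  have -> : `|H| = `|P' *m X *m Q'|.
    by rewrite /X -mulmxA -[_ *m Q']mulmxA QQ' mulmx1 mulmxA P'P mul1mx.
  rewrite (le_trans (mx_norm_mul _ _))//.
  rewrite (@le_trans _ _ (n%:R * (n%:R * c * `|X|) * c))//.
    rewrite ler_pM// ?mulr_ge0// ler_wpM2l// (le_trans (mx_norm_mul _ _))//.
    by rewrite ler_wpM2r// ler_wpM2l.
  rewrite (_ : n%:R * (n%:R * c * `|X|) * c = n%:R ^+ 2 * c ^+ 2 * `|X|); last by ring.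
  rewrite ler_wpM2r// ler_wpM2r ?sqr_ge0// ler_pXn2r// ?nnegrE// ?addr_ge0// lerDl//.
rewrite mulrC ler_pdivrMr ?exprn_gt0// mulrC -exprMn ler_pXn2r// ?nnegrE//.
by rewrite mulr_ge0// ltW.
Qed.

(** Mean value theorem along A + t H, whose points stay in the ball of radius [r]: the derivative of
    tr (H exp (A + t H)) is the quantity bounded below by [dexpm_coercive]. *)
Lemma expm_strong_mono n (r : R) : exists2 mu, 0 < mu & forall A H : 'M[R]_n,
  Sym A -> Sym H -> `|A| + `|H| <= r -> mu * `|H| ^+ 2 <= \tr (H *m (expm (A + H) - expm A)).
Proof.
have [mu mu0 Hmu] := dexpm_coercive n r; exists mu => // A H SA SH AH.
have trl : linear (fun X : 'M[R]_n => \tr (H *m X) : R^o).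
  by move=> c X Y; rewrite !linearP.
pose TT : {linear _ -> _} := HB.pack (fun X : 'M[R]_n => \tr (H *m X) : R^o)
  (GRing.isLinear.Build _ _ _ _ _ trl).
have h t : has_velocity (fun s : R^o => \tr (H *m expm (A + (s : R) *: H)) : R^o) t
    (\tr (H *m dexpm (A + t *: H) H)).
  exact: (velocity_lin_mx TT (velocity_comp (velocity_add_line A H t) (is_diff_expm _))).
have [t /andP[t0 t1]] := velocity_mvt h.
rewrite scale1r scale0r addr0 -linearB -mulmxBr => ->.
apply: Hmu => //.
  by rewrite /Sym /= linearD linearZ /= SA SH.
rewrite (le_trans (ler_normD _ _))// (le_trans _ AH)// lerD2l normrZ gtr0_norm//.
by rewrite ler_piMl// ltW.
Qed.

Lemma expm_mono n (A B : 'M[R]_n) : Sym A -> Sym B ->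
  \tr ((B - A) *m (expm B - expm A)) <= 0 -> A = B.
Proof.
move=> SA SB AB; have [mu mu0 Hmu] := expm_strong_mono n (`|A| + `|B - A|).
have SBA : Sym (B - A) by rewrite /Sym /= linearB /= SA SB.
have := Hmu A (B - A) SA SBA (lexx _); rewrite [A + _]addrC subrK => h.
apply/eqP; rewrite eq_sym -subr_eq0 -normr_eq0 -sqrf_eq0 eq_le sqr_ge0 andbT.
by rewrite -(pmulr_rle0 _ mu0) (le_trans h).
Qed.

End ExpGroup.

(** * Solving Pi (exp (S + D)) = Pi P *)

Section QuadraticForms.
Context {R : realType}.

Definition qform n (P : 'M[R]_n) (x : 'cV[R]_n) : R := (x^T *m P *m x) 0 0.

Definition psd n (P : 'M[R]_n) := forall x, 0 <= qform P x.

Lemma qformE n (P : 'M[R]_n) x : qform P x = mxdot x (P *m x).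
Proof. by rewrite /qform /mxdot /mxtrace big_ord1 mulmxA. Qed.

Lemma qform_trace n (P : 'M[R]_n) x : qform P x = \tr (x *m x^T *m P).
Proof. by rewrite qformE /mxdot mulmxA mxtrace_mulC mulmxA. Qed.

Lemma qform_tr n (P : 'M[R]_n) p (M : 'M[R]_(n, p)) :
  \tr (M^T *m P *m M) = \sum_i qform P (col i M).
Proof.
rewrite /mxtrace; apply: eq_bigr => i _.
rewrite /qform !mxE; apply: eq_bigr => k _; rewrite !mxE; congr (_ * _).
by apply: eq_bigr => l _; rewrite !mxE.
Qed.

Lemma psd_trace n (P : 'M[R]_n) p (M : 'M[R]_(n, p)) : psd P -> 0 <= \tr (M^T *m P *m M).
Proof. by move=> P0; rewrite qform_tr; apply: sumr_ge0 => i _. Qed.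

Lemma psd_outer n (x : 'cV[R]_n) : psd (x *m x^T).
Proof.
move=> y; have -> : qform (x *m x^T) y = mxdot (x^T *m y) (x^T *m y).
  by rewrite qformE /mxdot trmx_mul trmxK !mulmxA.
exact: mxdot_ge0.
Qed.

Lemma SPD_psd n (P : 'M[R]_n) : SPD P -> psd P.
Proof.
move=> [_ P0] x; have [->|/P0/ltW//] := eqVneq x 0.
by rewrite /qform mulmx0 mxE.
Qed.

Lemma SPD_expm n (A : 'M[R]_n) : Sym A -> SPD (expm A).
Proof.
move=> SA; split=> [|x x0]; first exact: expm_sym.
have -> : (x^T *m expm A *m x) 0 0 = mxdot (expm (2^-1 *: A) *m x) (expm (2^-1 *: A) *m x).
  by rewrite -/(qform _ _) qformE expm_half /mxdot trmx_mul (trmx_expm_sym _ SA) !mulmxA.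
rewrite lt_neqAle mxdot_ge0 andbT eq_sym; apply: contra x0 => /eqP h.
have /mxdot_eq0 h0 : mxdot (expm (2^-1 *: A) *m x) (expm (2^-1 *: A) *m x) <= 0 by rewrite h.
have := expmN (2^-1 *: (- A)); rewrite scalerN opprK => /(congr1 (mulmx^~ x)).
by rewrite -mulmxA h0 mulmx0 mul1mx => <-.
Qed.

Lemma SPD_unit n (P : 'M[R]_n) : SPD P -> P \in unitmx.
Proof.
move=> [SP P0]; rewrite -row_free_unit -kermx_eq0; apply/eqP/row_matrixP => i.
rewrite row0; apply/eqP; apply: contraT => k0.
have xT0 : (row i (kermx P))^T != 0.
  by apply: contra k0 => /eqP /(congr1 trmx); rewrite trmxK trmx0 => ->.
have := P0 _ xT0; rewrite trmxK -row_mul mulmx_ker row0 mul0mx mxE ltxx //.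
Qed.

(** Let [c] bound the form of P^-1. The form of [P] is nonnegative at x - c^-1 P^-1 x, and expanding
    it there gives x^T P x >= 2 c^-1 <x, x> - c^-2 <x, P^-1 x> >= c^-1 <x, x>. *)
Lemma SPD_lower n (P : 'M[R]_n) : SPD P ->
  exists2 p, 0 < p & forall x, p * mxdot x x <= qform P x.
Proof.
move=> SP; have uP := SPD_unit SP; have [PT _] := SP.
pose c : R := (n * 1)%:R * n%:R * `|invmx P| + 1.
have c0 : 0 < c by rewrite ltr_wpDl// !mulr_ge0.
exists c^-1 => [|x]; first by rewrite invr_gt0.
have iT : (invmx P)^T = invmx P by rewrite trmx_inv PT.
have Px : mxdot x (invmx P *m x) <= c * mxdot x x.
  rewrite (le_trans (ler_norm _))// (le_trans (mxdot_le _ _))//.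
  rewrite (@le_trans _ _ (c * `|x| ^+ 2))//; last by rewrite ler_wpM2l ?mxdot_ge// ltW.
  rewrite (@le_trans _ _ ((n * 1)%:R * `|x| * (n%:R * `|invmx P| * `|x|)))//.
    by rewrite ler_wpM2l ?mulr_ge0// mx_norm_mul.
  rewrite /c mulrDl mul1r expr2 [leLHS](_ : _ = (n * 1)%:R * n%:R * `|invmx P| * (`|x| * `|x|)); last by ring.
  by rewrite lerDl mulr_ge0.
have := SPD_psd SP (x - c^-1 *: (invmx P *m x)).
rewrite !qformE mulmxBr -scalemxAr mulKVmx// mxdotBl !mxdotBr !mxdotZr !mxdotZl.
rewrite [mxdot (invmx P *m x) (P *m x)]mxdot_mulr PT mulKVmx// [mxdot (invmx P *m x) x]mxdotC.
move=> h; have : c^-1 * (c^-1 * mxdot x (invmx P *m x)) <= c^-1 * mxdot x x.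
  by apply: ler_wpM2l; [rewrite invr_ge0 ltW|rewrite ler_pdivrMl].
lra.
Qed.

(** The scalar inequality e^a >= 1 + a, weighted by [P]. Two mean value steps bring the trace to c
    tr (P A exp (t A) A) with c > 0, and writing exp (t A) = Q Q with Q symmetric exhibits it as c
    tr ((A Q)^T P (A Q)). *)
Lemma trace_expm_ge n (P A : 'M[R]_n) : psd P -> Sym A -> 0 <= \tr (P *m (expm A - 1%:M - A)).
Proof.
move=> P0 SA.
have trl B : linear (fun X : 'M[R]_n => \tr (B *m X) : R^o) by move=> c X Y; rewrite !linearP.
pose TT B : {linear _ -> _} := HB.pack (fun X : 'M[R]_n => \tr (B *m X) : R^o)
  (GRing.isLinear.Build _ _ _ _ _ (trl B)).
pose h (t : R^o) : R^o := \tr (P *m (expm ((0 + 1 * t) *: A) + (- 1%:M + (0 + (-1) * t) *: A))).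
pose h1 (t : R) : R := \tr (P *m (A *m expm (t *: A) - A)).
have hh1 t : has_velocity h t (h1 t).
  have := velocity_lin_mx (TT P) (velocityD (velocity_expm A 0 1 t)
    (velocityD (velocity_cst (- 1%:M : 'M[R]_n) t) (velocity_line 0 (-1) A t))).
  by congr (has_velocity _ _ _); rewrite /= /h1 add0r mul1r scale1r add0r scaleN1r.
have [c /andP[c0 _]] := velocity_mvt hh1.
have -> : h (0 : R) = 0 by rewrite /h !mulr0 !add0r !scale0r expm0 addr0 subrr mulmx0 linear0.
have -> : h (1 : R) = \tr (P *m (expm A - 1%:M - A)).
  by rewrite /h !mulr1 !add0r scale1r scaleN1r addrA.
rewrite subr0 => ->.
pose k (t : R^o) : R^o := \tr (P *m A *m (expm ((0 + c * t) *: A))).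
pose k1 (t : R) : R := \tr (P *m A *m (c *: A *m expm ((0 + c * t) *: A))).
have kk1 t : has_velocity k t (k1 t) by exact: (velocity_lin_mx (TT (P *m A)) (velocity_expm A 0 c t)).
have [s _] := velocity_mvt kk1.
have -> : k (0 : R) = \tr (P *m A) by rewrite /k mulr0 addr0 scale0r expm0 mulmx1.
have -> : k (1 : R) = \tr (P *m A *m expm (c *: A)) by rewrite /k mulr1 add0r.
move=> E; rewrite /h1 mulmxBr linearB /= mulmxA E /k1.
rewrite -scalemxAl -scalemxAr linearZ /= mulr_ge0 //; first exact: ltW.
set t := 0 + c * s; rewrite expm_comm.
have [Q QT ->] : exists2 Q : 'M[R]_n, Q^T = Q & expm (t *: A) = Q *m Q.
  exists (expm ((t / 2) *: A)); first exact: trmx_expm_sym.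
  by rewrite expm_addZ -splitr.
have -> : \tr (P *m A *m (Q *m Q *m A)) = \tr ((A *m Q)^T *m P *m (A *m Q)).
  rewrite trmx_mul SA QT mulmxA mxtrace_mulC !mulmxA.
  by rewrite [in LHS]mxtrace_mulC !mulmxA.
exact: psd_trace.
Qed.

Lemma psd_expm_ge n (A : 'M[R]_n) : Sym A -> psd (expm A - 1%:M - A).
Proof. by move=> SA x; rewrite qform_trace; apply: trace_expm_ge => //; exact: psd_outer. Qed.

Lemma psd_norm n (X : 'M[R]_n) : Sym X -> psd X -> `|X| <= \tr X.
Proof.
move=> SX X0.
have qd i j (s : R) : qform X (delta_mx i 0 + s *: delta_mx j 0) = X i i + s * X i j + s * X j i + s ^+ 2 * X j j.
  have dd k l : mxdot (delta_mx k 0 : 'cV[R]_n) (X *m delta_mx l 0) = X k l.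
    rewrite /mxdot trmx_delta mulmxA -rowE -colE /mxtrace big_ord1 !mxE //.
  by rewrite qformE mulmxDr -scalemxAr mxdotDl !mxdotDr !mxdotZl !mxdotZr !dd; ring.
have diag_ge i : 0 <= X i i.
  by have := X0 (delta_mx i 0 + 0 *: delta_mx i 0); rewrite qd; lra.
have tr_ge i : X i i <= \tr X.
  by rewrite /mxtrace (bigD1 i)//= lerDl sumr_ge0.
apply: mx_norm_le => [|i j]; first by apply: sumr_ge0.
(* Testing on e_i + e_j and e_i - e_j bounds an entry by the mean of two diagonal entries, each at
   most the trace. *)
have := X0 (delta_mx i 0 + 1 *: delta_mx j 0); have := X0 (delta_mx i 0 + (-1) *: delta_mx j 0).
rewrite !qd.
have -> : X j i = X i j by rewrite -{1}SX mxE.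
have := tr_ge i; have := tr_ge j.
rewrite ler_norml => ? ? ? ?; apply/andP; split; lra.
Qed.

End QuadraticForms.

(** * Existence, uniqueness and stability of the solution *)

Section LogEquation.
Context {R : realType}.

Lemma mx_bounded_closed_compact m n (A : set 'M[R]_(m, n)) (c : R) :
  (forall X, A X -> `|X| <= c) -> closed A -> compact A.
Proof.
move=> Ac Acl.
have vm_cont : continuous (vec_mx : 'rV[R]_(m * n) -> 'M[R]_(m, n)) by exact: linear_mx_continuous.
have -> : A = vec_mx @` (vec_mx @^-1` A).
  apply/seteqP; split=> [X AX|_ [v Av <-]//].
  by exists (mxvec X); rewrite /= mxvecK.
apply: continuous_compact; first exact: continuous_subspaceT.
apply: bounded_closed_compact; last by apply: closed_comp => // x _; exact: vm_cont.
exists c; split=> [|x cx v /= /Ac vc]; first exact: num_real.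
apply: mx_norm_le => [|i j]; first by rewrite (le_trans _ (ltW cx))// (le_trans _ vc).
rewrite -[v]vec_mxK; case/mxvec_indexP: j => k l; rewrite ord1 mxvecE.
by rewrite (le_trans (mx_norm_entry _ _ _))// (le_trans vc)// ltW.
Qed.

(** An orthogonal projection for [mxdot] onto a space of symmetric matrices. Projecting onto all
    symmetric matrices yields [logm], onto the diagonal ones [calD]. *)
Definition sym_projector n (Pi : {linear 'M[R]_n -> 'M[R]_n}) :=
  [/\ forall X, Pi (Pi X) = Pi X, forall X, Sym (Pi X) &
      forall X Y, mxdot (Pi X) Y = mxdot X (Pi Y)].

Variables (n : nat) (Pi : {linear 'M[R]_n -> 'M[R]_n}).
Hypothesis PiP : sym_projector Pi.

Let potential (S P D : 'M[R]_n) : R := \tr (expm (S + D)) - mxdot P D.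

(** Put A = S + D and B = exp (A / 2): the potential is <B, B> - <P, D>, and halving the exponent
    has produced a square that dominates the linear term. Indeed X = B - 1 - A / 2 is positive
    semidefinite, and <P, X> >= 0 bounds <P, D> by 2 <P, B> plus a constant, so <B - P, B - P> is
    bounded on the sublevel set. Then <P, X> is bounded above, hence so are tr X and X because P >=
    p, and finally D = 2 (B - 1) - 2 X - S. *)
Lemma potential_coercive S P : Sym S -> SPD P -> exists c, forall D, Sym D ->
  potential S P D <= potential S P 0 -> `|D| <= c.
Proof.
move=> SS SP; have [p p0 Pp] := SPD_lower SP; have [PT _] := SP.
(* [c1] will bound <B - P, B - P>, [b] will bound |B|, and [c2] will bound 2 <P, X>. *)
pose c1 := potential S P 0 + mxdot P P - 2 * mxdot P 1%:M - mxdot P S.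
pose b := `|P| + (`|c1| + 1).
pose c2 := 2 * ((n * n)%:R * `|P| * b) - 2 * mxdot P 1%:M + potential S P 0 - mxdot P S.
exists (2 * (b + `|1%:M : 'M[R]_n|) + c2 / p + `|S|) => D SD le0.
pose A := S + D; pose B := expm (2^-1 *: A).
have SA : Sym A by rewrite /Sym /= linearD /= SS SD.
have SA2 : Sym (2^-1 *: A) by rewrite /Sym /= linearZ /= SA.
have BT : B^T = B by exact: trmx_expm_sym.
have trA : \tr (expm A) = mxdot B B by rewrite expm_half /mxdot -/B BT.
pose X := B - 1%:M - 2^-1 *: A.
have X0 : psd X by exact: psd_expm_ge.
have SX : Sym X by rewrite /Sym /= /X !linearB linearZ /= BT SA trmx1.
have PX : p * \tr X <= mxdot P X.
  have : psd (P - p *: 1%:M).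
    move=> x; have := Pp x; rewrite !qformE mulmxBl -scalemxAl mul1mx mxdotBr mxdotZr; lra.
  move=> /(fun h => trace_expm_ge h SA2); rewrite -/B -/X mulmxBl linearB /= -scalemxAl linearZ /=.
  by rewrite mul1mx /mxdot PT; lra.
have trX : 0 <= \tr X by rewrite (le_trans _ (psd_norm SX X0)).
have PXE : mxdot P X = mxdot P B - mxdot P 1%:M - 2^-1 * (mxdot P S + mxdot P D).
  by rewrite /X /A !mxdotBr mxdotZr mxdotDr.
have le1 : mxdot B B - mxdot P D <= potential S P 0 by move: le0; rewrite /potential -/A trA.
have PX0 : 0 <= mxdot P X by rewrite (le_trans _ PX)// mulr_ge0// ltW.
have BP : mxdot (B - P) (B - P) <= c1.
  rewrite mxdotBl !mxdotBr [mxdot B P]mxdotC /c1; move: PX0; rewrite PXE; lra.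
have nBP : `|B - P| <= `|c1| + 1.
  have h1 : `|B - P| ^+ 2 <= `|c1| by rewrite (le_trans (mxdot_ge _))// (le_trans BP)// ler_norm.
  rewrite leNgt; apply/negP => h2.
  have : `|c1| < `|B - P| ^+ 2.
    have c10 : 0 <= `|c1| by [].
    rewrite expr2; nra.
  by rewrite ltNge h1.
have nB : `|B| <= b by rewrite -[B](subrK P) addrC (le_trans (ler_normD _ _))// lerD2l.
have PB : mxdot P B <= (n * n)%:R * `|P| * b.
  by rewrite (le_trans (ler_norm _))// (le_trans (mxdot_le _ _))// ler_wpM2l// mulr_ge0.
have BB0 : 0 <= mxdot B B by exact: mxdot_ge0.
have PX2 : 2 * mxdot P X <= c2 by rewrite PXE /c2; lra.
have nX : `|2 *: X| <= c2 / p.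
  rewrite normrZ ger0_norm// ler_pdivlMr// (le_trans _ PX2)// -mulrA ler_wpM2l//.
  by rewrite mulrC (le_trans _ PX)// ler_wpM2l ?psd_norm// ltW.
have -> : D = 2 *: (B - 1%:M) - 2 *: X - S.
  by apply/matrixP => i j; rewrite /X /A !mxE; lra.
rewrite (le_trans (ler_normB _ _))// lerD2r (le_trans (ler_normB _ _))// lerD//.
rewrite normrZ ger0_norm// ler_wpM2l// (le_trans (ler_normB _ _))// lerD2r//.
Qed.

Lemma log_equation_exists S P : Sym S -> SPD P ->
  exists2 D, Pi D = D & Pi (expm (S + D)) = Pi P.
Proof.
move=> SS SP; have [Pi2 PiS PiA] := PiP.
have [c cP] := potential_coercive SS SP.
pose K := [set D | `|D| <= c /\ Pi D = D].
have potE : potential S P = (fun D => mxdot_lin 1%:M (expm (S + D)) - mxdot_lin P D).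
  by apply/funext => D /=; rewrite /potential /mxdot trmx1 mul1mx.
have potc : continuous (fun D => potential S P D : R^o).
  rewrite potE => D; apply: (@cvgB _ R^o _ (nbhs D)).
    apply: (cvg_comp (fun D => expm (S + D)) (mxdot_lin 1%:M) (G := nbhs (expm (S + D)))).
      apply: (cvg_comp (fun D => S + D) (@expm R n) (G := nbhs (S + D))).
        by apply: cvgD; [exact: cvg_cst|exact: cvg_id].
      exact: differentiable_continuous (differentiable_expm _).
    exact: linear_mx_continuous.
  exact: (@linear_mx_continuous R n n _ (mxdot_lin P) D).
have Kcl : closed K.
  apply: closedI.
    apply: (@closed_comp _ R^o (fun X : 'M[R]_n => `|X| : R^o) [set x | x <= c]).
      by move=> x _; exact: norm_continuous.
    exact: closed_le.
  have -> : (fun D => Pi D = D) = (fun D => `|D - Pi D| : R^o) @^-1` [set x | x <= 0].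
    apply/funext => D /=; apply/propext; rewrite normr_le0 subr_eq0.
    by split=> [->|/eqP].
  apply: closed_comp; last exact: closed_le.
  move=> D _; apply: (@cvg_norm _ _ _ (nbhs D)); apply: cvgB; first exact: cvg_id.
  exact: (@linear_mx_continuous R n n _ Pi D).
have Kc : compact K by apply: (mx_bounded_closed_compact (c := c)) Kcl => X [].
have K0 : K !=set0.
  exists 0; split; last exact: linear0.
  by apply: cP => //; rewrite /Sym /= trmx0.
have [D] := compact_EVT_min K0 Kc (continuous_subspaceT potc).
rewrite inE => -[Dc PD] Dmin; exists D => //.
(* Off the sublevel set of 0 the potential exceeds its value at 0, and 0 lies in [K]; so the minimum
   over the compact [K] is a minimum over the whole range of [Pi]. *)
have Dmin' E : Pi E = E -> potential S P D <= potential S P E.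
  move=> PE; have [/cP Ec|] := leP (potential S P E) (potential S P 0).
    apply: Dmin; rewrite inE; split=> //; apply: Ec.
    by rewrite -PE; exact: PiS.
  move=> /ltW; apply: le_trans; apply: Dmin; rewrite inE; split; last exact: linear0.
  by apply: cP => //; rewrite /Sym /= trmx0.
have crit H : Pi H = H -> mxdot (expm (S + D) - P) H = 0.
  move=> PH.
  pose f (t : R^o) : R^o := potential S P (D + (t : R) *: H).
  have vf t : has_velocity f t (mxdot 1%:M (dexpm (S + D + t *: H) H) - mxdot P H).
    have -> : f = (fun t : R^o => mxdot_lin 1%:M (expm (S + D + (t : R) *: H)) +
        (mxdot_lin (- P) (D + (t : R) *: H))).
      by apply/funext => s; rewrite /f potE /= addrA /mxdot linearN /= mulNmx linearN.
    have -> : - mxdot P H = mxdot_lin (- P) H by rewrite /= /mxdot linearN /= mulNmx linearN.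
    apply: velocityD.
      apply: (velocity_lin_mx (mxdot_lin 1%:M)).
      exact: (velocity_comp (velocity_add_line (S + D) H t) (is_diff_expm _)).
    apply: (velocity_lin_mx (mxdot_lin (- P))); exact: velocity_add_line.
  have Hexp : mxdot 1%:M (dexpm (S + D + 0 *: H) H) = mxdot (expm (S + D)) H.
    have SE : Sym (S + D) by rewrite /Sym /= linearD /= SS -PD PiS.
    by rewrite scale0r addr0 /mxdot trmx1 mul1mx mxtrace_dexpm (expm_sym SE).
  rewrite mxdotBl -Hexp; have [_ <-] := velocity_derive (vf 0).
  have m0 : (0 : R) \in `](-1), 1[ by rewrite in_itv /= ltrN10 ltr01.
  have [|t _|t _|_ ->//] := @derive1_at_min R f (-1) 1 0 _ _ m0.
  - by rewrite (@le_trans _ _ 0)// lerN10.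
  - by have [] := velocity_derive (vf t).
  - rewrite /f scale0r addr0; apply: Dmin'.
    by rewrite linearD linearZ /= PD PH.
(* The gradient exp (S + D) - P is orthogonal to the range of [Pi]; testing on its own projection
   makes that projection vanish. *)
have : mxdot (Pi (expm (S + D) - P)) (Pi (expm (S + D) - P)) <= 0.
  by rewrite PiA Pi2 crit.
by move=> /mxdot_eq0 /eqP; rewrite linearB subr_eq0 => /eqP.
Qed.

Lemma mxdot_sym_projector (D X : 'M[R]_n) : Pi D = D -> \tr (D *m X) = mxdot D (Pi X).
Proof.
have [_ PiS PiA] := PiP; move=> PD; rewrite -PiA PD /mxdot; congr (\tr (_ *m _)).
by rewrite -PD PiS.
Qed.

(** D - E lies in the range of [Pi], so its pairing with exp (S + D) - exp (S + E) sees only the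
    projection of the latter, which is 0; [expm_mono] concludes. *)
Lemma log_equation_uniq S D E : Sym S -> Pi D = D -> Pi E = E ->
  Pi (expm (S + D)) = Pi (expm (S + E)) -> D = E.
Proof.
have [_ PiS PiA] := PiP; move=> SS PD PE DE.
have SD : Sym (S + D) by rewrite /Sym /= linearD /= SS -PD PiS.
have SE : Sym (S + E) by rewrite /Sym /= linearD /= SS -PE PiS.
apply: (addrI S); apply: expm_mono => //.
rewrite opprD addrACA subrr add0r mxdot_sym_projector; last by rewrite linearB /= PD PE.
by rewrite linearB /= DE subrr /mxdot mulmx0 linear0.
Qed.

(* The truncation [t] confines the comparison to a bounded set, where the
   monotonicity of [expm] is uniformly strong. *)
Lemma log_equation_stable S0 D0 : Sym S0 -> Pi D0 = D0 ->
  exists C, exists2 r, 0 < r & forall S D, Sym S -> Pi D = D -> `|S - S0| <= 1 ->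
    `|Pi (expm (S + D)) - Pi (expm (S + D0))| <= r ->
    `|D - D0| <= C * `|Pi (expm (S + D)) - Pi (expm (S + D0))|.
Proof.
have [_ PiS PiA] := PiP; move=> SS0 PD0.
(* One unit allows for |S - S0| <= 1, the other for the truncated increment. *)
have [mu mu0 Hmu] := expm_strong_mono n (`|S0 + D0| + 1 + 1).
pose C : R := (n * n)%:R / mu; have C0 : 0 <= C by rewrite divr_ge0// ltW.
(* This radius r satisfies C r < 1, which at the end excludes |D - D0| > 1: truncating at norm 1
   would give 1 <= C |Y| < 1. *)
exists C, (2 * (C + 1))^-1 => [|S D SS PD S1 rho]; first by rewrite invr_gt0 mulr_gt0// ltr_wpDl.
set Y := _ - _ in rho *.
pose A := S + D0.
have SD0 : Sym D0 by rewrite -PD0; exact: PiS.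
have SDD : Sym D by rewrite -PD; exact: PiS.
have SA : Sym A by rewrite /Sym /= linearD /= SS SD0.
have SDl : Sym (D - D0) by rewrite /Sym /= linearB /= SDD SD0.
have nA : `|A| <= `|S0 + D0| + 1.
  have -> : A = (S0 + D0) + (S - S0) by apply/matrixP => i j; rewrite /A !mxE; lra.
  by rewrite (le_trans (ler_normD _ _))// lerD2l.
have trunc t : 0 < t -> t <= 1 -> `|t *: (D - D0)| <= 1 -> `|t *: (D - D0)| <= C * `|Y|.
  move=> t0 t1 nt; set Dt := t *: (D - D0).
  have SDt : Sym Dt by rewrite /Sym /= linearZ /= SDl.
  have h1 : mu * `|Dt| ^+ 2 <= \tr (Dt *m (expm (A + Dt) - expm A)).
    by apply: Hmu => //; rewrite lerD.
  (* The remaining increment (1 - t) (D - D0) is parallel to [Dt]. Only the sign matters here, so a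
     modulus [mu'] depending on [D] is enough. *)
  have h2 : 0 <= \tr (Dt *m (expm (S + D) - expm (A + Dt))).
    have [mu' mu'0 Hmu'] := expm_strong_mono n (`|A + Dt| + `|(1 - t) *: (D - D0)|).
    have := Hmu' (A + Dt) ((1 - t) *: (D - D0)).
    have -> : A + Dt + (1 - t) *: (D - D0) = S + D.
      by apply/matrixP => i j; rewrite /Dt /A !mxE; ring.
    have SADt : Sym (A + Dt) by rewrite /Sym /= linearD /= SA SDt.
    have S1t : Sym ((1 - t) *: (D - D0)) by rewrite /Sym /= linearZ /= SDl.
    move=> /(_ SADt S1t (lexx _)) h.
    have {h} : 0 <= (1 - t) * \tr ((D - D0) *m (expm (S + D) - expm (A + Dt))).
      have -> : (1 - t) * \tr ((D - D0) *m (expm (S + D) - expm (A + Dt))) =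
         \tr ((1 - t) *: (D - D0) *m (expm (S + D) - expm (A + Dt))).
        by rewrite -scalemxAl linearZ.
      by rewrite (le_trans _ h)// mulr_ge0 ?sqr_ge0// ltW.
    rewrite [in X in _ -> X]/Dt -scalemxAl linearZ /=.
    have [t1' |] := ltP t 1; first by rewrite !pmulr_rge0// subr_gt0.
    move=> t1' _; rewrite /Dt; have -> : t = 1 by apply/le_anti; rewrite t1 t1'.
    by rewrite scale1r /A -addrA subrKC subrr mulmx0 linear0.
  have h3 : mu * `|Dt| ^+ 2 <= (n * n)%:R * `|Dt| * `|Y|.
    apply: (le_trans h1); apply: (@le_trans _ _ (\tr (Dt *m (expm (S + D) - expm A)))).
      by rewrite -subr_ge0 -linearB -mulmxBr opprB addrA subrK.
    rewrite mxdot_sym_projector; last by rewrite linearZ linearB /= PD PD0.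
    by rewrite linearB /= (le_trans (ler_norm _))// mxdot_le.
  have [->|Dt0] := eqVneq Dt 0; first by rewrite normr0 mulr_ge0.
  have nDt : 0 < `|Dt| by rewrite normr_gt0.
  rewrite /C mulrAC ler_pdivlMr// mulrC -(ler_pM2r nDt) -mulrA -expr2.
  by rewrite (le_trans h3)// mulrAC.
have [D1|D1] := leP `|D - D0| 1.
  by have := trunc 1 ltr01 (lexx _); rewrite scale1r => /(_ D1).
have D0' : 0 < `|D - D0| by rewrite (lt_trans _ D1).
have := trunc `|D - D0|^-1; rewrite invr_gt0 D0' => /(_ isT).
rewrite normrZ normfV normr_id mulVf ?gt_eqF// => /(_ _ (lexx _)).
rewrite invf_le1// => /(_ (ltW D1)) h.
have : C * `|Y| <= C * (2 * (C + 1))^-1 by rewrite ler_wpM2l.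
move=> /(le_trans h); rewrite ler_pdivlMr; last by rewrite mulr_gt0// ltr_wpDl.
lra.
Qed.

End LogEquation.

#[local] Opaque expm dexpm divexpm diff.

(** * Smooth dependence of the solution on parameters *)

Section ImplicitFunction.
Context {R : realType}.
Variables (n : nat) (Pi : {linear 'M[R]_n -> 'M[R]_n}).
Hypothesis PiP : sym_projector Pi.

(** The linearisation of D -> Pi (exp (S + D)) on the range of [Pi], completed by the identity on
    the kernel of [Pi] so that it is invertible on all matrices. *)
Definition log_op (A X : 'M[R]_n) : 'M[R]_n := Pi (dexpm A (Pi X)) + (X - Pi X).

Fact log_op_linear A : linear (log_op A).
Proof.
move=> c X Y; rewrite /log_op (linearP Pi c X Y) (linearP (dexpm A)) (linearP Pi).
set x2 := Pi X; set y2 := Pi Y; set x1 := Pi _; set y1 := Pi _.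
clearbody x1 y1 x2 y2.
by apply/matrixP => i j; rewrite !mxE; ring.
Qed.

HB.instance Definition _ A :=
  GRing.isLinear.Build R 'M[R]_n 'M[R]_n *:%R (log_op A) (log_op_linear A).

(** Pairing with [X] gives <Pi X, dexpm A (Pi X)> + <X - Pi X, X - Pi X> = 0. Both terms are
    nonnegative, and the first is coercive in Pi X. *)
Lemma log_op_inj A X : Sym A -> log_op A X = 0 -> X = 0.
Proof.
have [Pi2 PiS PiA] := PiP; move=> SA AX.
have [mu mu0 Hmu] := dexpm_coercive n `|A|.
have h1 := Hmu A (Pi X) SA (PiS X) (lexx _).
have h2 : mxdot X (Pi (dexpm A (Pi X))) + mxdot X (X - Pi X) = 0.
  by rewrite -mxdotDr -/(log_op A X) AX /mxdot mulmx0 linear0.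
have h3 : mxdot X (Pi (dexpm A (Pi X))) = \tr (Pi X *m dexpm A (Pi X)).
  by rewrite -PiA /mxdot PiS.
have h4 : mxdot X (X - Pi X) = mxdot (X - Pi X) (X - Pi X).
  have z : mxdot (Pi X) (X - Pi X) = 0 by rewrite PiA linearB /= Pi2 subrr /mxdot mulmx0 linear0.
  by rewrite [RHS]mxdotBl z subr0.
have p1 : 0 <= mu * `|Pi X| ^+ 2 by rewrite mulr_ge0 ?sqr_ge0// ltW.
have p2 := mxdot_ge0 (X - Pi X).
have : mxdot (X - Pi X) (X - Pi X) <= 0 by rewrite -h4; lra.
move=> /mxdot_eq0 /eqP; rewrite subr_eq0 => /eqP ->.
have : mu * `|Pi X| ^+ 2 <= 0 by lra.
by rewrite pmulr_rle0// => h; apply/eqP; rewrite -normr_eq0 -sqrf_eq0 eq_le sqr_ge0 andbT.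
Qed.

Lemma log_op_unit A : Sym A -> lin_mx (log_op A) \in unitmx.
Proof.
move=> SA; rewrite -row_free_unit -kermx_eq0; apply/eqP/row_matrixP => i.
rewrite row0; set v := row i _.
have : v *m lin_mx (log_op A) = 0 by rewrite -row_mul mulmx_ker row0.
rewrite -[v]vec_mxK mul_vec_lin => /(congr1 vec_mx); rewrite mxvecK linear0.
by move=> /(log_op_inj SA) ->; rewrite linear0.
Qed.

(** Written through the matrix of [log_op A] in vectorised coordinates, so that smooth dependence on
    [A] reduces to that of [invmx]. *)
Definition log_op_inv (A X : 'M[R]_n) : 'M[R]_n := vec_mx (mxvec X *m invmx (lin_mx (log_op A))).

Fact log_op_inv_linear A : linear (log_op_inv A).
Proof. by move=> c X Y; rewrite /log_op_inv linearP mulmxDl -scalemxAl linearP. Qed.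

HB.instance Definition _ A :=
  GRing.isLinear.Build R 'M[R]_n 'M[R]_n *:%R (log_op_inv A) (log_op_inv_linear A).

Lemma log_opK A X : Sym A -> log_op_inv A (log_op A X) = X.
Proof. by move=> SA; rewrite /log_op_inv -mul_vec_lin mulmxK ?log_op_unit// mxvecK. Qed.

Variables (V : normedModType R) (U : set V) (a b g : V -> 'M[R]_n).
Hypotheses (oU : open U) (aS : forall q, U q -> Sym (a q))
  (gP : forall q, U q -> Pi (g q) = g q)
  (gE : forall q, U q -> Pi (expm (a q + g q)) = Pi (b q)).

Let arg_sym q : U q -> Sym (a q + g q).
Proof.
by have [_ PiS _] := PiP; move=> Uq; rewrite /Sym /= linearD /= aS// -gP// PiS.
Qed.

Lemma near_diff_lipschitz (W W' : normedModType R) (f : W -> W') x : differentiable f x ->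
  exists2 K, 0 < K & \forall h \near (0 : W), `|f (x + h) - f x| <= K * `|h|.
Proof.
move=> df; have [k k0 Hk] := linear_lipschitz (diff_continuous df).
exists (k + 1); first by rewrite addr_gt0.
have /diff_locallyP[_ /eqaddoP/(_ _ ltr01)] := df.
apply: filterS => h; rewrite !fctE /= opprD addrA [h + x]addrC mul1r => hh.
rewrite -[f (x + h) - f x](subrK ('d f x h)) (le_trans (ler_normD _ _))// mulrDl mul1r addrC.
by rewrite lerD.
Qed.

Lemma near_diff_eps (W W' : normedModType R) (f : W -> W') x e : differentiable f x -> 0 < e ->
  \forall h \near (0 : W), `|f (x + h) - f x - 'd f x h| <= e * `|h|.
Proof.
move=> df e0; have /diff_locallyP[_ /eqaddoP/(_ _ e0)] := df.
by apply: filterS => h; rewrite !fctE /= opprD addrA [h + x]addrC.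
Qed.

Lemma implicit_continuous q : U q -> {for q, continuous a} -> {for q, continuous b} ->
  {for q, continuous g}.
Proof.
move=> Uq ca cb; have [C [r r0 Hst]] := log_equation_stable PiP (aS Uq) (gP Uq).
(* [f p] is the residual at p of the old solution [g q]: it tends to 0, and stability bounds |g p -
   g q| by a multiple of it. *)
pose f p := Pi (b p) - Pi (expm (a p + g q)).
have cf : f p @[p --> q] --> (0 : 'M[R]_n).
  have -> : 0 = f q by rewrite /f gE// subrr.
  have cPi : continuous Pi by exact: linear_mx_continuous.
  have ce : expm (a p + g q) @[p --> q] --> expm (a q + g q).
    apply: (cvg_comp (fun p => a p + g q) (@expm R n) (G := nbhs (a q + g q))).
      by apply: cvgD => //; exact: cvg_cst.
    exact: differentiable_continuous (differentiable_expm _).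
  apply: cvgB; first exact: (cvg_comp b Pi cb (cPi (b q))).
  exact: (cvg_comp _ Pi ce (cPi _)).
have nU : \forall p \near q, U p by exact: open_nbhs_nbhs.
have na : \forall p \near q, `|a q - a p| <= 1 by move/cvgrPdist_le : ca; apply.
have C1 : 0 < `|C| + 1 by rewrite ltr_wpDl.
apply/cvgrPdist_le => e e0.
have nf : \forall p \near q, `|0 - f p| <= Num.min r (e / (`|C| + 1)).
  by move/cvgrPdist_le : cf; apply; rewrite lt_min r0 divr_gt0.
apply: filterS (filterI nU (filterI na nf)) => p [Up [ap]].
rewrite sub0r normrN le_min => /andP[f1 f2].
have := Hst (a p) (g p) (aS Up) (gP Up); rewrite distrC ap (gE Up) -/(f p) => /(_ isT f1) h.
rewrite distrC (le_trans h)// (@le_trans _ _ ((`|C| + 1) * `|f p|))//; last first.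
  by rewrite mulrC -ler_pdivlMr.
by rewrite ler_wpM2r// (le_trans (ler_norm _))// lerDl.
Qed.

(** The a priori bound behind [is_diff_implicit]: the Taylor remainder of exp is quadratic in the
    increment of a + g, which includes the unknown increment of g. *)
Lemma implicit_lipschitz q : U q -> differentiable a q -> differentiable b q ->
  exists2 K, 0 < K & \forall h \near (0 : V), `|g (q + h) - g q| <= K * `|h|.
Proof.
move=> Uq da db.
have [C [r r0 Hst]] := log_equation_stable PiP (aS Uq) (gP Uq).
pose f p := Pi (b p) - Pi (expm (a p + g q)).
have df : differentiable f q.
  apply: differentiableB.
    by apply: (differentiable_comp (f := b)) => //; exact: linear_mx_differentiable.
  apply: (differentiable_comp (f := fun p => expm (a p + g q))); last exact: linear_mx_differentiable.
  apply: (differentiable_comp (f := fun p => a p + g q)); last exact: differentiable_expm.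
  by apply: differentiableD.
have fq : f q = 0 by rewrite /f gE// subrr.
have [K K0 fK] := near_diff_lipschitz df; have [Ka Ka0 aK] := near_diff_lipschitz da.
exists ((`|C| + 1) * K); first by rewrite mulr_gt0// ltr_wpDl.
have nU : \forall h \near (0 : V), U (q + h).
  have : (q + h) @[h --> (0 : V)] --> q.
    by rewrite -[X in _ --> X]addr0; apply: cvgD; [exact: cvg_cst|exact: cvg_id].
  by move=> /(_ _ (open_nbhs_nbhs (conj oU Uq))).
near=> h.
have Uh : U (q + h) by near: h.
have fh : `|f (q + h)| <= K * `|h|.
  by have : `|f (q + h) - f q| <= K * `|h| by [near: h]; rewrite fq subr0.
have ah : `|a (q + h) - a q| <= Ka * `|h| by near: h.
have h1 : `|h| <= Ka^-1 by near: h; apply: nbhs0_le; rewrite invr_gt0.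
have h2 : `|h| <= r / K by near: h; apply: nbhs0_le; rewrite divr_gt0.
have := Hst (a (q + h)) (g (q + h)) (aS Uh) (gP Uh).
rewrite (gE Uh) -/(f (q + h)) => /(_ _ _)/le_trans; apply.
- by rewrite (le_trans ah)// mulrC -ler_pdivlMr// div1r.
- by rewrite (le_trans fh)// mulrC -ler_pdivlMr.
- rewrite (@le_trans _ _ (`|C| * `|f (q + h)|))//; first by rewrite ler_wpM2r// ler_norm.
  by rewrite -mulrA ler_pM// lerDl.
Unshelve. all: by end_near. Qed.

(** Differentiating Pi (exp (a + g)) = Pi b gives log_op (dg) = Pi (db - dexpm (da)), since dg lies
    in the range of [Pi]. *)
Definition implicit_diff q : {linear V -> 'M[R]_n} :=
  (log_op_inv (a q + g q) \o Pi) \o ('d b q \- (dexpm (a q + g q) \o 'd a q)).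

(** In use, [e1], [e0] are the exponentials and [b1], [b0] the right-hand sides at the moved and
    base points, and [x], [y] are the images under [dexpm A] of the increments of a and g; e1 - e0 -
    (x + y) is then the Taylor remainder. *)
Let proj_shift (b1 b0 e1 e0 x y : 'M[R]_n) : Pi e1 = Pi b1 -> Pi e0 = Pi b0 ->
  Pi y = Pi (b1 - b0 - x - (e1 - e0 - (x + y))).
Proof.
move=> h1 h0; have -> : b1 - b0 - x - (e1 - e0 - (x + y)) = (b1 - e1) - (b0 - e0) + y.
  by apply/matrixP => i j; rewrite !mxE; ring.
by rewrite (linearD Pi) (linearB Pi) (linearB Pi b1) (linearB Pi b0) h1 h0 !subrr add0r.
Qed.

Let proj_shift2 (u w r x z y : 'M[R]_n) : Pi y = Pi (u - w - r) ->
  Pi y - Pi (x - z) = Pi (u - x - (w - z) - r).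
Proof.
move=> ->; rewrite -(linearB Pi); congr (Pi _).
by apply/matrixP => i j; rewrite !mxE; ring.
Qed.

Lemma is_diff_implicit q : U q -> differentiable a q -> differentiable b q ->
  is_diff q g (implicit_diff q).
Proof.
move=> Uq da db; set A := a q + g q.
have SA : Sym A := arg_sym Uq.
have [Kg Kg0 gK] := implicit_lipschitz Uq da db.
have [Ka Ka0 aK] := near_diff_lipschitz da.
have [C C0 AC] := expm_taylor_bound A.
have [kI kI0 HI] := linear_lipschitz (@linear_mx_continuous R n n _ (log_op_inv A)).
have [kP kP0 HP] := linear_lipschitz (@linear_mx_continuous R n n _ Pi).
have [kD kD0 HD] := linear_lipschitz (@linear_mx_continuous R n n _ (dexpm A)).
apply: is_diff_eps.
  have c1 : continuous (fun h => 'd b q h - dexpm A ('d a q h)).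
    move=> h; apply: (@cvgB _ _ _ (nbhs h) _ ('d b q) (dexpm A \o 'd a q)).
      exact: diff_continuous.
    by apply: continuous_comp; [exact: diff_continuous|exact: linear_mx_continuous].
  move=> h; apply: (continuous_comp (f := fun h => 'd b q h - dexpm A ('d a q h))
    (g := log_op_inv A \o Pi)); first exact: c1.
  by apply: continuous_comp; exact: linear_mx_continuous.
move=> e e0.
(* Three errors of size d |h| occur: from b, from a (multiplied by kD through [dexpm A]) and from
   exp. They add up to (2 + kD) d |h|, and [Pi] and [log_op_inv A] cost the factors kP and kI. *)
pose d := e / (kI * kP * (2 + kD)).
have kk : 0 < kI * kP * (2 + kD) by rewrite !mulr_gt0// addr_gt0.
have d0 : 0 < d by rewrite divr_gt0.
pose L := Ka + Kg; have L0 : 0 < L by rewrite addr_gt0.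
have nU : \forall h \near (0 : V), U (q + h).
  have : (q + h) @[h --> (0 : V)] --> q.
    by rewrite -[X in _ --> X]addr0; apply: cvgD; [exact: cvg_cst|exact: cvg_id].
  by move=> /(_ _ (open_nbhs_nbhs (conj oU Uq))).
have na := near_diff_eps da d0; have nb := near_diff_eps db d0.
have n1 : \forall h \near (0 : V), `|h| <= L^-1 by apply: nbhs0_le; rewrite invr_gt0.
have n2 : \forall h \near (0 : V), `|h| <= d / ((C + 1) * L ^+ 2).
  by apply: nbhs0_le; rewrite divr_gt0// mulr_gt0 ?exprn_gt0// ltr_wpDl.
apply: filterS (filterI nU (filterI (filterI na nb) (filterI (filterI aK gK) (filterI n1 n2)))).
move=> h [Uh [[ha hb] [[ah gh] [h1 h2]]]].
pose D := g (q + h) - g q; pose K := (a (q + h) - a q) + D.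
have nK : `|K| <= L * `|h| by rewrite /L mulrDl (le_trans (ler_normD _ _))// lerD.
have K1 : `|K| <= 1 by rewrite (le_trans nK)// mulrC -ler_pdivlMr// div1r.
pose rK := expm (A + K) - expm A - dexpm A K.
have hr : `|rK| <= d * `|h|.
  rewrite (le_trans (AC _ K1))//.
  rewrite (@le_trans _ _ ((C + 1) * (L * `|h|) ^+ 2))//.
    by rewrite ler_pM ?sqr_ge0 ?lerDl ?ler_pXn2r ?nnegrE ?mulr_ge0// ltW.
  have CL : 0 < (C + 1) * L ^+ 2 by rewrite mulr_gt0 ?exprn_gt0// ltr_wpDl.
  rewrite (_ : (C + 1) * (L * `|h|) ^+ 2 = `|h| * ((C + 1) * L ^+ 2) * `|h|); last by ring.
  by rewrite ler_wpM2r// -ler_pdivlMr.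
(* The main terms cancel because both points satisfy the equation; the error is the inverse
   linearisation applied to the three remainders alone. *)
have E : D - implicit_diff q h = log_op_inv A (Pi ((b (q + h) - b q - 'd b q h) -
    dexpm A (a (q + h) - a q - 'd a q h) - rK)).
  rewrite -[D](log_opK _ SA) /implicit_diff -/A -linearB; congr (log_op_inv _ _).
  have PD : Pi D = D by rewrite /D linearB /= !gP.
  rewrite /log_op PD subrr addr0.
  have AK : A + K = a (q + h) + g (q + h).
    by apply/matrixP => i j; rewrite /A /K /D !mxE; ring.
  have Pr : Pi (dexpm A D) = Pi (b (q + h) - b q - dexpm A (a (q + h) - a q) - rK).
    have -> : rK = expm (a (q + h) + g (q + h)) - expm A -
        (dexpm A (a (q + h) - a q) + dexpm A D).
      by rewrite /rK AK -(linearD (dexpm A)).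
    by apply: proj_shift; exact: gE.
  rewrite (linearB (dexpm A) (a (q + h) - a q) ('d a q h)); exact: proj_shift2 Pr.
rewrite -/D E (le_trans (HI _))// (le_trans (ler_wpM2l (ltW kI0) (HP _)))// mulrA.
have -> : e * `|h| = kI * kP * (d * `|h| + kD * (d * `|h|) + d * `|h|).
  by rewrite /d; field; rewrite !gt_eqF// addr_gt0.
apply: ler_wpM2l; first by apply: mulr_ge0; exact: ltW.
have hD : `|dexpm A (a (q + h) - a q - 'd a q h)| <= kD * (d * `|h|).
  by apply: (le_trans (HD _)); apply: ler_wpM2l; [exact: ltW|exact: ha].
exact: (le_trans (ler_normB _ _) (lerD (le_trans (ler_normB _ _) (lerD hb hD)) hr)).
Qed.

Lemma Cd_dexpm (W : normedModType R) (O : set W) k (A X : W -> 'M[R]_n) : open O ->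
  Cd k O A -> Cd k O X -> Cd k O (fun q => dexpm (A q) (X q)).
Proof.
move=> oO CA CX.
apply: (Cd_eqfun (f := fun q => \sum_i \sum_j (X q) i j *: 'D_(delta_mx i j) (@expm R n) (A q))).
  by move=> q; rewrite -diff_delta ?diff_expm//; exact: differentiable_expm.
apply: Cd_sum => // i; apply: Cd_sum => // j; apply: Cd_scale_mx => //.
apply: (Cd_comp (U' := setT) (f := A) (g := 'D_(delta_mx i j) (@expm R n))) => //.
by have [_] := Cd_expm k.+1 (@openT 'M[R]_n); exact.
Qed.

Lemma Cd_log_op_inv (W : normedModType R) (O : set W) k (A X : W -> 'M[R]_n) : open O ->
  (forall q, O q -> Sym (A q)) -> Cd k O A -> Cd k O X -> Cd k O (fun q => log_op_inv (A q) (X q)).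
Proof.
move=> oO SA CA CX.
apply: (Cd_lin_comp (L := vec_mx)) => //; first exact: linear_mx_continuous.
apply: Cd_mulmx => //; first by apply: (Cd_lin_comp (L := mxvec)) => //; exact: linear_mx_continuous.
apply: Cd_invmx => // [q Oq|]; first exact: log_op_unit (SA _ Oq).
(* The matrix of [log_op (A q)] is assembled row by row, the i-th row being the image of the i-th
   basis vector. *)
apply: (Cd_eqfun (f := fun q => \sum_i delta_mx i (0 : 'I_1) *m
    mxvec (log_op (A q) (vec_mx (delta_mx 0 i))))).
  move=> q; apply/row_matrixP => i; rewrite !rowE.
  rewrite -[delta_mx 0 i in RHS]vec_mxK mul_vec_lin mulmx_sumr (bigD1 i)//= big1 ?addr0.
    by rewrite mulmxA mul_delta_mx [delta_mx 0 0](_ : _ = 1%:M) ?mul1mx//; apply/matrixP => a0 b0; rewrite !ord1 !mxE.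
  by move=> j ji; rewrite mulmxA mul_delta_mx_0 ?mul0mx// eq_sym.
apply: Cd_sum => // i; apply: Cd_mulmx => //; first exact: Cd_cst.
apply: (Cd_lin_comp (L := mxvec)) => //; first exact: linear_mx_continuous.
rewrite /log_op; apply: CdD => //; last exact: Cd_cst.
apply: (Cd_lin_comp (L := Pi)) => //; first exact: linear_mx_continuous.
by apply: Cd_dexpm => //; exact: Cd_cst.
Qed.

(** Bootstrap: the derivative of g is a smooth expression in a, b, their derivatives and g itself,
    so [Cd k] for g gives [Cd k] for its derivatives. *)
Lemma Cd_implicit k : Cd k U a -> Cd k U b -> Cd k U g.
Proof.
elim: k => [|k IHk] Ca Cb.
  move=> q Uq; apply: (implicit_continuous Uq); [exact: Ca|exact: Cb].
have Dg q : U q -> is_diff q g (implicit_diff q).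
  by move=> Uq; apply: is_diff_implicit => //; [exact: Cd_diff Ca Uq|exact: Cd_diff Cb Uq].
have Cg : Cd k U g by apply: IHk; exact: Cd_lt.
have CA : Cd k U (fun q => a q + g q) by apply: CdD => //; exact: Cd_lt.
split=> [q Uq|v]; first exact: (@ex_diff _ _ _ _ _ _ _ (Dg q Uq)).
apply: (Cd_eq (f := fun q => log_op_inv (a q + g q) (Pi ('D_v b q - dexpm (a q + g q) ('D_v a q))))) => //.
  move=> q; rewrite inE => Uq; rewrite [RHS]deriveE; last exact: (@ex_diff _ _ _ _ _ _ _ (Dg q Uq)).
  rewrite (@diff_val _ _ _ _ _ _ _ (Dg q Uq)) /=.
  by rewrite (deriveE v (Cd_diff Ca Uq)) (deriveE v (Cd_diff Cb Uq)).
apply: Cd_log_op_inv => //.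
apply: (Cd_lin_comp (L := Pi)) => //; first exact: linear_mx_continuous.
apply: CdD => //; first by case: Cb => _; apply.
apply: (Cd_lin_comp (L := -%R)) => //; first exact: linear_mx_continuous.
by apply: Cd_dexpm => //; case: Ca => _; apply.
Qed.

End ImplicitFunction.

(** * Smoothness of log and of the diagonal correction *)

#[local] Opaque derive.

Section LogSmooth.
Context {R : realType}.

Definition symmx n (X : 'M[R]_n) : 'M[R]_n := 2^-1 *: (X + X^T).

Fact symmx_linear n : linear (@symmx n).
Proof. by move=> c X Y; apply/matrixP => i j; rewrite !mxE; ring. Qed.

HB.instance Definition _ n :=
  GRing.isLinear.Build R 'M[R]_n 'M[R]_n *:%R (@symmx n) (@symmx_linear n).

Lemma symmx_sym n (X : 'M[R]_n) : Sym (symmx X).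
Proof. by rewrite /Sym /=; apply/matrixP => i j; rewrite !mxE addrC. Qed.

Lemma symmx_id n (X : 'M[R]_n) : Sym X -> symmx X = X.
Proof. by move=> SX; rewrite /symmx SX; apply/matrixP => i j; rewrite !mxE; lra. Qed.

Lemma symmx_projector n : sym_projector (@symmx n).
Proof.
split=> [X|X|X Y]; [by rewrite /= symmx_id//; exact: symmx_sym|exact: symmx_sym|].
rewrite /= mxdotZl mxdotZr mxdotDl mxdotDr; congr (_ * (_ + _)).
by rewrite /mxdot trmxK -mxtrace_tr trmx_mul mxtrace_mulC.
Qed.

Definition diagpart n (X : 'M[R]_n) : 'M[R]_n := \matrix_(i, j) (if i == j then X i j else 0).

Fact diagpart_linear n : linear (@diagpart n).
Proof. by move=> c X Y; apply/matrixP => i j; rewrite !mxE; case: eqP => // _; rewrite mulr0 addr0. Qed.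

HB.instance Definition _ n :=
  GRing.isLinear.Build R 'M[R]_n 'M[R]_n *:%R (@diagpart n) (@diagpart_linear n).

Lemma diagpart_projector n : sym_projector (@diagpart n).
Proof.
split=> [X|X|X Y].
- by apply/matrixP => i j; rewrite !mxE; case: eqP.
- by rewrite /Sym /=; apply/matrixP => i j; rewrite !mxE eq_sym; case: eqP => // ->.
- rewrite !mxdotE; apply: eq_bigr => i _; apply: eq_bigr => j _.
  by rewrite !mxE; case: eqP => _; rewrite ?mul0r ?mulr0.
Qed.

Lemma diagpart_is_diag n (X : 'M[R]_n) : is_diag_mx X <-> diagpart X = X.
Proof.
split=> [/is_diag_mxP dX|<-].
  by apply/matrixP => i j; rewrite !mxE; case: eqP => // /eqP /dX.
by apply/is_diag_mxP => i j ij; rewrite !mxE; case: eqP => // e; move: ij; rewrite e eqxx.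
Qed.

Lemma off_diagpart n (X : 'M[R]_n) : off X = X - diagpart X.
Proof. by apply/matrixP => i j; rewrite !mxE; case: eqP => _; rewrite ?subrr ?subr0. Qed.

Lemma logmP n (P : 'M[R]_n) : SPD P -> Sym (logm P) /\ expm (logm P) = P.
Proof.
move=> SP; have S0 : Sym (0 : 'M[R]_n) by rewrite /Sym /= trmx0.
have [S PS] := log_equation_exists (symmx_projector n) S0 SP.
rewrite add0r /= symmx_id; last by apply: expm_sym; rewrite -PS; exact: symmx_sym.
rewrite symmx_id; last by case: SP.
move=> eS; apply: (@xgetPex _ 0 [set S | Sym S /\ expm S = P]).
by exists S; split=> //; rewrite -PS; exact: symmx_sym.
Qed.

Lemma expm_inj n (S T : 'M[R]_n) : Sym S -> Sym T -> expm S = expm T -> S = T.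
Proof. by move=> SS ST ST'; apply: expm_mono => //; rewrite ST' subrr mulmx0 linear0. Qed.

Lemma logm_expm n (S : 'M[R]_n) : Sym S -> logm (expm S) = S.
Proof.
by move=> SS; have [Sl el] := logmP (SPD_expm SS); exact: expm_inj.
Qed.

(** With P = 1 and the projection onto diagonal matrices, the projected equation says exactly that
    exp (S + D) has unit diagonal. *)
Lemma calDP n (S : 'M[R]_n) : Sym S -> is_diag_mx (calD S) /\ Cor (expm (S + calD S)).
Proof.
move=> SS; have S1 : SPD (1%:M : 'M[R]_n).
  by have := @SPD_expm R n 0; rewrite expm0; apply; rewrite /Sym /= trmx0.
have [D PD eD] := log_equation_exists (diagpart_projector n) SS S1.
apply: (@xgetPex _ 0 [set E | is_diag_mx E /\ Cor (expm (S + E))]).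
exists D; split; first exact/diagpart_is_diag.
have SD : Sym (S + D).
  by have [_ /(_ D)] := diagpart_projector n; rewrite PD /Sym /= linearD /= SS => ->.
split; first exact: SPD_expm.
by move=> i; move/matrixP : eD => /(_ i i); rewrite !mxE eqxx.
Qed.

Lemma is_diag_sym n (D : 'M[R]_n) : is_diag_mx D -> Sym D.
Proof. by move=> /diagpart_is_diag <-; have [_ + _] := diagpart_projector n; apply. Qed.

Lemma calD_uniq n (S E : 'M[R]_n) : Sym S -> is_diag_mx E -> Cor (expm (S + E)) -> calD S = E.
Proof.
move=> SS dE [_ c1]; have [dD [_ c2]] := calDP SS.
apply: (log_equation_uniq (diagpart_projector n) SS); [exact/diagpart_is_diag|exact/diagpart_is_diag|].
by apply/matrixP => i j; rewrite !mxE; case: eqP => // ->; rewrite c1 c2.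
Qed.

(** An open domain for the extensions, since [SPD] has no interior in the space of all matrices once
    n >= 2. *)
Definition SPD_nbhd n : set 'M[R]_n := [set A | SPD (symmx A)].

Lemma SPD_sub_nbhd n : @SPD R n `<=` @SPD_nbhd n.
Proof. by move=> A SA; rewrite /SPD_nbhd /= symmx_id//; case: SA. Qed.

Lemma open_SPD_nbhd n : open (@SPD_nbhd n).
Proof.
rewrite openE => A SA; have [p p0 Ap] := SPD_lower SA.
(* [c] converts the max norm into a bound on quadratic forms, |x^T D x| <= c |D| <x, x>; compared
   with the lower bound [p] for the form of [symmx A], it gives the radius p / c. *)
pose c : R := (n * 1)%:R * n%:R + 1; have c0 : 0 < c by rewrite ltr_wpDl// mulr_ge0.
apply/nbhs_ballP; exists (p / c); first by rewrite /= divr_gt0.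
move=> B; rewrite -ball_normE /= => AB; split=> [|x x0]; first exact: symmx_sym.
rewrite -/(qform _ _); have -> : symmx B = symmx A - symmx (A - B) by rewrite linearB /= opprB addrC subrK.
set D := symmx (A - B).
have nD : `|D| < p / c.
  rewrite (le_lt_trans _ AB)// /D /symmx normrZ ger0_norm ?invr_ge0//.
  rewrite ler_pdivrMl// (le_trans (ler_normD _ _))// mx_norm_tr; lra.
have xx : 0 < mxdot x x.
  by rewrite (lt_le_trans _ (mxdot_ge x))// exprn_gt0// normr_gt0.
rewrite qformE mulmxBl mxdotBr -qformE subr_gt0 (lt_le_trans _ (Ap x))//.
rewrite (le_lt_trans (ler_norm _))// (le_lt_trans (mxdot_le _ _))//.
rewrite (@le_lt_trans _ _ (c * `|D| * mxdot x x))//; last first.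
  by rewrite ltr_pM2r// mulrC -ltr_pdivlMr.
rewrite (@le_trans _ _ (c * `|D| * `|x| ^+ 2))//; last first.
  by rewrite ler_wpM2l ?mxdot_ge// mulr_ge0// ltW.
rewrite (@le_trans _ _ ((n * 1)%:R * `|x| * (n%:R * `|D| * `|x|)))//.
  by rewrite ler_wpM2l ?mulr_ge0// mx_norm_mul.
rewrite [leLHS](_ : _ = (n * 1)%:R * n%:R * (`|D| * `|x| ^+ 2)); last by ring.
by rewrite mulrA; apply: ler_wpM2r; [exact: sqr_ge0|apply: ler_wpM2r => //; rewrite lerDl].
Qed.

(** [logm] is 0 off [SPD] by default, hence not continuous in the ambient space for n >= 2; this
    extension is smooth on [SPD_nbhd]. *)
Definition slogm n (A : 'M[R]_n) : 'M[R]_n := logm (symmx A).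

Lemma slogm_logm n (A : 'M[R]_n) : SPD A -> slogm A = logm A.
Proof. by move=> [SA _]; rewrite /slogm symmx_id. Qed.

Lemma slogm_sym n (A : 'M[R]_n) : SPD_nbhd A -> Sym (slogm A).
Proof. by move=> /logmP[]. Qed.

Lemma expm_slogm n (A : 'M[R]_n) : SPD_nbhd A -> expm (slogm A) = symmx A.
Proof. by move=> /logmP[]. Qed.

Lemma slogm_expm n (S : 'M[R]_n) : Sym S -> slogm (expm S) = S.
Proof. by move=> SS; rewrite slogm_logm ?logm_expm//; exact: SPD_expm. Qed.

Lemma Cd_slogm n k : Cd k (@SPD_nbhd n) (@slogm n).
Proof.
apply: (@Cd_implicit _ _ _ (symmx_projector n) _ _ (fun=> 0) id).
- exact: open_SPD_nbhd.
- by move=> q _; rewrite /Sym /= trmx0.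
- by move=> q Uq; rewrite /= symmx_id//; exact: slogm_sym.
- by move=> q Uq; rewrite add0r expm_slogm//= symmx_id//; exact: symmx_sym.
- exact: Cd_cst.
- exact: (@Cd_linear_mx _ _ _ _ _ _ idfun).
Qed.

Definition scalD n (A : 'M[R]_n) : 'M[R]_n := calD (symmx A).

Lemma Cd_scalD n k : Cd k setT (@scalD n).
Proof.
apply: (@Cd_implicit _ _ _ (diagpart_projector n) _ _ (@symmx n) (fun=> 1%:M)).
- exact: openT.
- by move=> q _; exact: symmx_sym.
- by move=> q _; have [dD _] := calDP (symmx_sym q); exact/diagpart_is_diag.
- move=> q _; have [_ [_ c1]] := calDP (symmx_sym q).
  by apply/matrixP => i j; rewrite !mxE; case: eqP => // ->; rewrite c1.
- exact: Cd_linear_mx.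
- exact: Cd_cst.
Qed.

#[local] Opaque slogm scalD symmx logm.

Lemma diff_slogm_expm n (S H : 'M[R]_n) : Sym S -> Sym H ->
  'd (@slogm n) (expm S) (dexpm S H) = H.
Proof.
move=> SS SH.
have d1 : differentiable (@slogm n) (expm S).
  by apply: Cd_diff (@Cd_slogm n 1) _; apply: SPD_sub_nbhd; exact: SPD_expm.
have d2 : differentiable (@expm R n) S := differentiable_expm S.
(* [slogm] inverts exp only on symmetric matrices; composing with [symmx] makes the identity hold on
   the whole space, where it can be differentiated. *)
have E : (@slogm n \o (@expm R n \o @symmx n)) = @symmx n.
  by apply/funext => X /=; rewrite slogm_expm//; exact: symmx_sym.
have dS : differentiable (@symmx n) S by exact: linear_mx_differentiable.
have SSE := symmx_id SS.
have d2' : differentiable (@expm R n) (symmx S) by exact: differentiable_expm.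
have d3 : differentiable (@expm R n \o @symmx n) S by exact: differentiable_comp.
have d1' : differentiable (@slogm n) ((@expm R n \o @symmx n) S) by rewrite /= SSE.
have DS : 'D_H (@symmx n) S = H by rewrite deriveE// diff_lin_mx /= symmx_id.
have h1 := derive_comp H d3 d1'; have h2 := derive_comp H dS d2'.
have h3 w : 'd (@expm R n) (symmx S) w = dexpm (symmx S) w :=
  congr1 (fun f => f w) (diff_expm (symmx S)).
have h4 : 'D_H (@expm R n \o @symmx n) S = dexpm (symmx S) H.
  by apply: (etrans h2); rewrite DS; exact: h3.
have h5 : 'd (@slogm n) (expm (symmx S)) (dexpm (symmx S) H) = H.
  by rewrite -{1}h4; apply: (etrans (esym h1)); rewrite E.
by move: h5; rewrite SSE.
Qed.

Lemma dexpm_diff_slogm n (p v : 'M[R]_n) : SPD_nbhd p ->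
  dexpm (slogm p) ('d (@slogm n) p v) = symmx v.
Proof.
move=> Up; have d1 : differentiable (@slogm n) p by exact: Cd_diff (@Cd_slogm n 1) _.
have d2 : differentiable (@expm R n) (slogm p) by exact: differentiable_expm.
have : 'D_v (@expm R n \o @slogm n) p = 'D_v (@symmx n) p.
  apply: near_eq_derive; apply: filterS (open_nbhs_nbhs (conj (@open_SPD_nbhd n) Up)) => q Uq /=.
  exact: expm_slogm.
have e1 := derive_comp v d1 d2; have e2 := deriveE v d1.
have e3 w : 'd (@expm R n) (slogm p) w = dexpm (slogm p) w := congr1 (fun f => f w) (diff_expm (slogm p)).
rewrite -e2 -e3 => h; apply: (etrans (esym e1)); apply: (etrans h).
by rewrite deriveE ?diff_lin_mx//; exact: linear_mx_differentiable.
Qed.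

(** A linear constraint on values passes to derivatives. With transposition for [L], derivatives of
    maps with symmetric values are symmetric. *)
Lemma Cd_fixed_linear (V W : normedModType R) k (U : set V) (f : V -> W) (L : {linear W -> W}) x v :
  open U -> U x -> continuous L -> Cd k.+1 U f -> (forall y, U y -> L (f y) = f y) -> L ('D_v f x) = 'D_v f x.
Proof.
move=> oU Ux cL Cf Lf; have df := Cd_diff Cf Ux.
have dL : differentiable L (f x) by exact: linear_differentiable.
have : 'D_v (L \o f) x = 'D_v f x.
  by apply: near_eq_derive; apply: filterS (open_nbhs_nbhs (conj oU Ux)) => y Uy /=; exact: Lf.
by rewrite derive_comp// diff_lin.
Qed.

Lemma diff_slogm_sym n (p v : 'M[R]_n) : SPD_nbhd p -> Sym ('d (@slogm n) p v).
Proof.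
move=> Up; have d1 : differentiable (@slogm n) p by exact: Cd_diff (@Cd_slogm n 1) _.
rewrite -deriveE// /Sym /=.
exact: (@Cd_fixed_linear _ _ 0 _ (@slogm n) (@trmx R n n) p v (@open_SPD_nbhd n) Up
  (@linear_mx_continuous _ _ _ _ (@trmx R n n)) (@Cd_slogm n 1) (@slogm_sym n)).
Qed.

End LogSmooth.

(** * Smooth extensions and symmetry of second derivatives *)

#[local] Opaque calD.

Section Transfer.
Context {R : realType}.
Implicit Types V W : normedModType R.

Definition admissible V (M T : set V) :=
  forall x v, M x -> T v -> \forall h \near (0 : R), M (x + h *: v).

(** Induction on the order: along [T], f and its extension F have the same derivatives on [M], so
    these derivatives again form such a pair. *)
Lemma smooth_ext V W (M T U : set V) (f F : V -> W) : open U -> M `<=` U -> admissible M T ->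
  (forall x, M x -> f x = F x) -> (forall k, Cd k U F) -> smooth M T f.
Proof.
move=> oU MU adm fF CF k; elim: k f F fF CF => [|k IHk] f F fF CF.
  split=> //; apply: (subspace_eq_continuous (A := M) (f := F)).
    by move=> x; rewrite inE => /fF/esym.
  by apply: continuous_in_subspaceT => x; rewrite inE => /MU Ux; exact: Cd_cont (CF 0%N) Ux.
have cf : {within M, continuous f}.
  apply: (subspace_eq_continuous (A := M) (f := F)); first by move=> x; rewrite inE => /fF/esym.
  by apply: continuous_in_subspaceT => x; rewrite inE => /MU Ux; exact: Cd_cont (CF 0%N) Ux.
split=> // v Tv.
have E x : M x -> 'D_v f x = 'D_v F x /\ (derivable F x v -> derivable f x v).
  by move=> Mx; apply: line_near_eq; apply: filterS (adm x v Mx Tv) => h; exact: fF.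
split=> [x Mx|].
  by apply: (E x Mx).2; apply: diff_derivable; exact: Cd_diff (CF 1%N) (MU _ Mx).
by apply: (IHk _ (fun x => 'D_v F x)) => [x /E[]//|j]; have [_] := CF j.+1; exact.
Qed.

(** The passage in the other direction, for curves: on an open subset of the line, derivability is
    differentiability. *)
Lemma smooth_Cd V (I : set R) (g : R^o -> V) : open I -> smooth (I : set R^o) setT g ->
  forall k, Cd k (I : set R^o) g.
Proof.
move=> oI sg k; have {sg} := sg k; elim: k g => [|k IHk] g /=.
  move=> [cg _] x Ix.
  by have := cg; rewrite continuous_open_subspace// => /(_ x); rewrite inE; exact.
move=> [_ dg]; split=> [x Ix|v]; last by apply: IHk; have [] := dg v Logic.I.
by apply/derivable1_diffP; have [+ _] := dg 1 Logic.I; exact.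
Qed.

Lemma mvt01 (f df : R -> R) : (forall t : R, 0 <= t <= 1 -> is_derive t (1 : R) (f : R^o -> R^o) (df t)) ->
  exists2 c : R, 0 <= c <= 1 & f 1 - f 0 = df c.
Proof.
move=> fd; have [||c] := @MVT R f df 0 1 ltr01.
- by move=> t; rewrite in_itv /= => /andP[t0 t1]; apply: fd; rewrite !ltW.
- apply: continuous_in_subspaceT => t; rewrite inE /= in_itv /= => t01.
  apply: differentiable_continuous; apply/derivable1_diffP.
  by have [] := fd _ t01.
- rewrite in_itv /= => /andP[c0 c1] ->; exists c; first by rewrite !ltW.
  by rewrite subr0 mulr1.
Qed.

Lemma is_derive_affine V (f : V -> R^o) (y u : V) (h t : R) :
  differentiable f (y + (h * t) *: u) ->
  is_derive (t : R^o) (1 : R^o) (fun s : R^o => f (y + (h * (s : R)) *: u))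
    (h * ('D_u f (y + (h * t) *: u) : R)).
Proof.
move=> df; apply: velocity_derive.
have v1 : has_velocity (fun s : R^o => y + (0 + h * (s : R)) *: u) t (0 + h *: u).
  by apply: velocityD; [exact: velocity_cst|exact: velocity_line].
have -> : (fun s : R^o => f (y + (h * (s : R)) *: u)) = f \o (fun s : R^o => y + (0 + h * (s : R)) *: u).
  by apply/funext => s /=; rewrite add0r.
have df' : differentiable f (y + (0 + h * t) *: u) by rewrite add0r.
have := velocity_comp v1 (differentiableP df').
rewrite !add0r; suff -> : 'd f (y + (h * t) *: u) (h *: u) = h * ('D_u f (y + (h * t) *: u) : R) by [].
by rewrite (deriveE u df); exact: linearZ.
Qed.

(** Two mean value steps: first for [G], the difference in direction v as a function of the position
    along u, then for [K], the derivative along u as a function of the position along v. *)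
Lemma second_difference V (U : set V) (f : V -> R^o) (x u v : V) (h : R) : Cd 2 U f ->
  (forall s t : R, 0 <= s <= 1 -> 0 <= t <= 1 -> U (x + (h * s) *: u + (h * t) *: v)) ->
  exists s t : R, [/\ 0 <= s <= 1, 0 <= t <= 1 &
    (f (x + h *: u + h *: v) - f (x + h *: u) - (f (x + h *: v) - f x) : R) =
    h ^+ 2 * ('D_v (fun y => 'D_u f y) (x + (h * s) *: u + (h * t) *: v) : R)].
Proof.
move=> C2 Ux.
have [i0 i1] : (0 <= (0 : R) <= 1) /\ (0 <= (1 : R) <= 1) by rewrite !lexx ler01.
have C1 : Cd 1 U (fun y => 'D_u f y) by have [_] := C2; exact.
pose G (s : R) : R := f (x + h *: v + (h * s) *: u) - f (x + (h * s) *: u).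
pose dG (s : R) : R := h * 'D_u f (x + h *: v + (h * s) *: u) - h * 'D_u f (x + (h * s) *: u).
have [s s01 EG] : exists2 c : R, 0 <= c <= 1 & G 1 - G 0 = dG c.
  apply: mvt01 => t t01; apply: is_deriveB; apply: is_derive_affine; apply: (Cd_diff C2).
    by have := Ux t 1 t01 i1; rewrite mulr1 addrAC.
  by have := Ux t 0 t01 i0; rewrite mulr0 scale0r addr0.
pose K (t : R) : R := 'D_u f (x + (h * s) *: u + (h * t) *: v).
pose dK (t : R) : R := h * 'D_v (fun y => 'D_u f y) (x + (h * s) *: u + (h * t) *: v).
have [t t01 EK] : exists2 c : R, 0 <= c <= 1 & K 1 - K 0 = dK c.
  apply: mvt01 => t t01; apply: (is_derive_affine (f := fun y => 'D_u f y)); apply: (Cd_diff C1).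
  exact: Ux.
exists s, t; split=> //.
have -> : (f (x + h *: u + h *: v) - f (x + h *: u) - (f (x + h *: v) - f x) : R) = G 1 - G 0.
  by rewrite /G !mulr1 !mulr0 scale0r !addr0 [x + h *: v + _]addrAC.
rewrite EG /dG expr2 -mulrA -/(dK t) -EK /K mulr1 mulr0 scale0r addr0 -mulrBr.
by rewrite [x + h *: v + _]addrAC.
Qed.

(** The second difference is symmetric in u and v, and equals h^2 times either mixed derivative at
    some point of the parallelogram; for small h, continuity puts both values within e / 2 of those
    at x. *)
Lemma schwarz V (U : set V) (f : V -> R^o) (x u v : V) : open U -> U x -> Cd 2 U f ->
  'D_v (fun y => 'D_u f y) x = 'D_u (fun y => 'D_v f y) x.
Proof.
move=> oU Ux C2.
set A := 'D_v _ x; set B := 'D_u _ x.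
have cA : {for x, continuous (fun y => 'D_v (fun y => 'D_u f y) y)}.
  have C1 : Cd 1 U (fun y => 'D_u f y) by have [_] := C2; exact.
  by have [_ h] := C1; exact: (h v x Ux).
have cB : {for x, continuous (fun y => 'D_u (fun y => 'D_v f y) y)}.
  have C1 : Cd 1 U (fun y => 'D_v f y) by have [_] := C2; exact.
  by have [_ h] := C1; exact: (h u x Ux).
apply/eqP; rewrite -subr_eq0 -normr_le0; apply/ler_addgt0Pr => e e0; rewrite add0r.
have e2 : 0 < e / 2 by rewrite divr_gt0.
have nA : \forall y \near x, `|A - 'D_v (fun y => 'D_u f y) y| <= e / 2.
  by move/cvgrPdist_le : cA => /(_ _ e2).
have nB : \forall y \near x, `|B - 'D_u (fun y => 'D_v f y) y| <= e / 2.
  by move/cvgrPdist_le : cB => /(_ _ e2).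
have /nbhs_ballP[r /= r0 xr] : \forall y \near x, [/\ U y,
    `|A - 'D_v (fun y => 'D_u f y) y| <= e / 2 & `|B - 'D_u (fun y => 'D_v f y) y| <= e / 2].
  by apply: filterS3 (open_nbhs_nbhs (conj oU Ux)) nA nB => y.
(* Then h (|u| + |v| + 1) = r / 2, so the parallelogram lies in the ball of radius r. *)
pose h := r / (2 * (`|u| + `|v| + 1)).
have uv : 0 < `|u| + `|v| + 1 by rewrite ltr_wpDl// addr_ge0.
have h0 : 0 < h by rewrite divr_gt0// mulr_gt0.
have pt s t : 0 <= s <= 1 -> 0 <= t <= 1 -> ball x r (x + (h * s) *: u + (h * t) *: v).
  move=> /andP[s0 s1] /andP[t0 t1]; rewrite -ball_normE /= -addrA opprD addrA subrr add0r normrN.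
  have nz (c : R) (w : V) : 0 <= c -> `|(h * c) *: w| = h * c * `|w|.
    by move=> c0; rewrite normrZ ger0_norm//; apply: mulr_ge0 => //; exact: ltW.
  rewrite (le_lt_trans (ler_normD _ _))// (nz _ _ s0) (nz _ _ t0).
  rewrite (@le_lt_trans _ _ (h * (`|u| + `|v| + 1)))//.
    rewrite -!(mulrA h) -(mulrDr h); apply: ler_wpM2l; first exact: ltW.
    have a1 : s * `|u| <= `|u| by rewrite ler_piMl.
    have a2 : t * `|v| <= `|v| by rewrite ler_piMl.
    by rewrite (le_trans (lerD a1 a2))// lerDl.
  by rewrite /h invfM mulrA -mulrA mulVf ?gt_eqF// mulr1 gtr_pMr// invf_lt1// ltr1n.
have Us s t : 0 <= s <= 1 -> 0 <= t <= 1 -> U (x + (h * s) *: u + (h * t) *: v).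
  by move=> hs ht; have [] := xr _ (pt s t hs ht).
have [s [t [s01 t01 E1]]] := second_difference C2 Us.
have U' s' t' : 0 <= s' <= 1 -> 0 <= t' <= 1 -> U (x + (h * s') *: v + (h * t') *: u).
  by move=> hs ht; rewrite addrAC; exact: Us.
have [s' [t' [s01' t01' E2]]] := second_difference C2 U'.
have EE : h ^+ 2 * ('D_v (fun y => 'D_u f y) (x + (h * s) *: u + (h * t) *: v) : R) =
  h ^+ 2 * ('D_u (fun y => 'D_v f y) (x + (h * s') *: v + (h * t') *: u) : R).
  have aux (y : V) (a b c A' B' : R) : y = x + h *: u + h *: v ->
      f (x + h *: u + h *: v) - a - (b - c) = A' -> f y - b - (a - c) = B' -> A' = B'.
    by move=> -> <- <-; rewrite !opprB !addrA [_ - a + c]addrAC [_ - a - b]addrAC [_ + c - b]addrAC [_ - b + c]addrAC.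
  exact: (aux _ _ _ _ _ _ (addrAC x (h *: v) (h *: u)) E1 E2).
have {}EE := mulfI (lt0r_neq0 (exprn_gt0 2 h0)) EE.
have [_ b1 _] := xr _ (pt _ _ s01 t01).
have [_ _ b2] := xr _ (pt _ _ t01' s01').
move: b2; rewrite [x + _ + _]addrAC -EE => b2.
have fin (a b c q : R) : `|a - c| <= q -> `|b - c| <= q -> `|a - b| <= q + q.
  by rewrite [`|b - c|]distrC => ac bc; apply: le_trans (ler_distD c a b) (lerD ac bc).
by rewrite (splitr e); exact: fin b1 b2.
Qed.

End Transfer.

(** * Geodesics of the log-Euclidean metric *)

Section FlatMetric.
Context {R : realType}.
Implicit Types V W : normedModType R.

Lemma derive_lin V W W' (L : {linear W -> W'}) (f : V -> W) x v : continuous L ->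
  differentiable f x -> 'D_v (L \o f) x = L ('D_v f x).
Proof.
move=> cL df; rewrite derive_comp ?diff_lin//.
exact: linear_differentiable.
Qed.

Fact mxentry_linear m n i j : linear (fun A : 'M[R]_(m, n) => A i j : R^o).
Proof. by move=> c A B; rewrite !mxE. Qed.

Definition mxentry m n i j : {linear 'M[R]_(m, n) -> R^o} :=
  HB.pack (fun A : 'M[R]_(m, n) => A i j : R^o) (GRing.isLinear.Build _ _ _ _ _ (@mxentry_linear m n i j)).

Lemma schwarz_mx V m n (U : set V) (f : V -> 'M[R]_(m, n)) x u v : open U -> U x -> Cd 2 U f ->
  'D_v (fun y => 'D_u f y) x = 'D_u (fun y => 'D_v f y) x.
Proof.
move=> oU Ux Cf; apply/matrixP => i j.
pose L := @mxentry m n i j.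
have cL : continuous L by exact: linear_mx_continuous.
have CL : Cd 2 U (L \o f) by exact: Cd_lin_comp.
have E a b : L ('D_a (fun y => 'D_b f y) x) = 'D_a (fun y => 'D_b (L \o f) y) x.
  have C1 : Cd 1 U (fun y => 'D_b f y) by have [_] := Cf; exact.
  have df := Cd_diff C1 Ux.
  apply: etrans (esym (derive_lin a cL df)) _; apply: near_eq_derive.
  apply: filterS (open_nbhs_nbhs (conj oU Ux)) => y Uy.
  exact: (esym (derive_lin b cL (Cd_diff Cf Uy))).
by apply: etrans (E v u) _; apply: etrans (schwarz u v oU Ux CL) _; rewrite -E.
Qed.

Fact mxtrace_linear n : linear (fun A : 'M[R]_n => \tr A : R^o).
Proof. by move=> c A B; rewrite !linearP. Qed.

Lemma derive_mxtrace V n (f : V -> 'M[R]_n) x v : differentiable f x ->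
  'D_v (fun y => \tr (f y) : R^o) x = \tr ('D_v f x).
Proof.
move=> df; pose L : {linear 'M[R]_n -> R^o} :=
  HB.pack (fun A : 'M[R]_n => \tr A : R^o) (GRing.isLinear.Build _ _ _ _ _ (@mxtrace_linear n)).
by apply: (@derive_lin _ _ _ L f x v) => //; exact: linear_mx_continuous.
Qed.

Lemma derive_frob V n (f g : V -> 'M[R]_n) x v : differentiable f x -> differentiable g x ->
  ('D_v (fun y => frob (f y) (g y) : R^o) x : R) = frob ('D_v f x) (g x) + frob (f x) ('D_v g x).
Proof.
move=> df dg; rewrite /frob derive_mxtrace ?derive_mulmx ?linearD//.
by have h := is_diff_mulmx (differentiableP df) (differentiableP dg); exact: (@ex_diff _ _ _ _ _ _ _ h).
Qed.

Lemma line_near V (U : set V) x v : open U -> U x -> \forall h \near (0 : R), U (x + h *: v).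
Proof.
move=> oU Ux; have c : {for 0, continuous (fun h : R^o => x + (h : R) *: v)}.
  by have h := velocity_add_line x v 0; apply: differentiable_continuous; exact: (@ex_diff _ _ _ _ _ _ _ h).
by apply: (c U); rewrite scale0r addr0; exact: open_nbhs_nbhs.
Qed.

Lemma admissible_open V (U T : set V) : open U -> admissible U T.
Proof. by move=> oU x v Ux _; exact: line_near. Qed.

Lemma admissible_SPD n : admissible (@SPD R n) (@Sym R n).
Proof.
move=> p v Sp Sv; have := line_near v (@open_SPD_nbhd R n) (SPD_sub_nbhd Sp).
apply: filterS => h; rewrite /SPD_nbhd /= symmx_id//.
by rewrite /Sym /= linearD linearZ /=; case: Sp => ->; rewrite Sv.
Qed.

Lemma admissible_Cor n : admissible (@Cor R n) (@Hol R n).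
Proof.
move=> p v [Sp p1] [Sv v0]; apply: filterS (admissible_SPD Sp Sv) => h; split=> // i.
by rewrite !mxE p1 v0 mulr0 addr0.
Qed.

Lemma derive_slogm n (p v : 'M[R]_n) : SPD p -> Sym v -> 'D_v (@logm R n) p = 'D_v (@slogm R n) p.
Proof.
move=> Sp Sv; apply: (line_near_eq _).1; apply: filterS (admissible_SPD Sp Sv) => h Sh.
by rewrite slogm_logm.
Qed.

Lemma metric_SPD n (p u v : 'M[R]_n) : SPD p -> Sym u -> Sym v ->
  metric (SPD_LE n) p u v = frob ('D_u (@slogm R n) p) ('D_v (@slogm R n) p).
Proof. by move=> Sp Su Sv; rewrite /= /pullback_frob !derive_slogm. Qed.

Lemma differentiable_slogm n (p : 'M[R]_n) : SPD p -> differentiable (@slogm R n) p.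
Proof. by move=> Sp; apply: Cd_diff (@Cd_slogm R n 1) _; exact: SPD_sub_nbhd. Qed.

Lemma differentiable_derive_slogm n (p v : 'M[R]_n) : SPD p ->
  differentiable (fun q => 'D_v (@slogm R n) q) p.
Proof.
move=> Sp; have C1 : Cd 1 (@SPD_nbhd R n) (fun q => 'D_v (@slogm R n) q) := (@Cd_slogm R n 2).2 v.
exact: Cd_diff C1 (SPD_sub_nbhd Sp).
Qed.

Lemma derive_metric_SPD n (p u v w : 'M[R]_n) : SPD p -> Sym u -> Sym v -> Sym w ->
  ('D_u (fun q => metric (SPD_LE n) q v w : R^o) p : R) =
  frob ('D_u (fun q => 'D_v (@slogm R n) q) p) ('D_w (@slogm R n) p) +
  frob ('D_v (@slogm R n) p) ('D_u (fun q => 'D_w (@slogm R n) q) p).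
Proof.
move=> Sp Su Sv Sw.
have -> : 'D_u (fun q => metric (SPD_LE n) q v w : R^o) p =
    'D_u (fun q => frob ('D_v (@slogm R n) q) ('D_w (@slogm R n) q) : R^o) p.
  apply: (line_near_eq _).1; apply: filterS (admissible_SPD Sp Su) => h Sh.
  exact: metric_SPD.
by apply: derive_frob; exact: differentiable_derive_slogm.
Qed.

Lemma derive_slogm_sym n (p v : 'M[R]_n) : SPD p -> Sym ('D_v (@slogm R n) p).
Proof.
move=> Sp; rewrite deriveE; last exact: differentiable_slogm.
by apply: diff_slogm_sym; exact: SPD_sub_nbhd.
Qed.

Lemma derive2_slogm_sym n (p u v : 'M[R]_n) : SPD p ->
  Sym ('D_u (fun q => 'D_v (@slogm R n) q) p).
Proof.
move=> Sp; have C1 := (@Cd_slogm R n 2).2 v.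
apply: (@Cd_fixed_linear _ _ _ 0 _ _ (@trmx R n n) p u (@open_SPD_nbhd R n) (SPD_sub_nbhd Sp)) C1 _.
  exact: linear_mx_continuous.
move=> q Uq; rewrite deriveE; first exact: diff_slogm_sym.
exact: Cd_diff (@Cd_slogm R n 1) _.
Qed.

Lemma dexpm_sym n (S H : 'M[R]_n) : Sym S -> Sym H -> Sym (dexpm S H).
Proof.
move=> SS SH; have C1 : Cd 1 setT (@expm R n \o @symmx R n).
  apply: (Cd_comp (U' := setT)) => //; [exact: openT|exact: Cd_linear_mx|].
  by apply: Cd_expm; exact: openT.
have : Sym ('D_H (@expm R n \o @symmx R n) S).
  apply: (@Cd_fixed_linear _ _ _ 0 _ _ (@trmx R n n) S H openT Logic.I) C1 _.
    exact: linear_mx_continuous.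
  by move=> q _; apply: expm_sym; exact: symmx_sym.
have dS : differentiable (@symmx R n) S by exact: linear_mx_differentiable.
have de : differentiable (@expm R n) (symmx S) by exact: differentiable_expm.
have DS : 'D_H (@symmx R n) S = H by rewrite deriveE// diff_lin_mx /= symmx_id.
have h2 := derive_comp H dS de; have E := symmx_id SS.
have h3 w : 'd (@expm R n) (symmx S) w = dexpm (symmx S) w :=
  congr1 (fun f => f w) (diff_expm (symmx S)).
suff -> : 'D_H (@expm R n \o @symmx R n) S = dexpm S H by [].
by apply: etrans h2 _; rewrite DS; apply: etrans (h3 H) _; rewrite E.
Qed.

Lemma frob_cancel n (X Y : 'M[R]_n) : Sym (X - Y) -> frob X (X - Y) = frob Y (X - Y) -> X = Y.
Proof.
move=> SXY h; apply/eqP; rewrite -subr_eq0; apply/eqP/mxdot_eq0.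
by rewrite /mxdot SXY {1}mulmxBl linearB /= -!/(frob _ _) h subrr.
Qed.

(* The Koszul formula reads <c, w> = <u u log, w log>: in the flat chart [log],
   the Christoffel term is the second derivative of the chart. *)
Lemma covariant_SPD n (p u c : 'M[R]_n) : SPD p -> Sym u -> Sym c ->
  covariant (SPD_LE n) p u u c <->
  'D_c (@slogm R n) p = 'D_u (fun q => 'D_u (@slogm R n) q) p.
Proof.
move=> Sp Su Sc; have Up := SPD_sub_nbhd Sp.
(* After halving, the first two terms give <uu log, w log> + <u log, uw log> and the third gives <wu
   log, u log>; the symmetry of second derivatives cancels the latter two. *)
have K w : Sym w -> 2^-1 * (('D_u (fun q => metric (SPD_LE n) q u w : R^o) p : R)
    + 'D_u (fun q => metric (SPD_LE n) q u w : R^o) p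
    - 'D_w (fun q => metric (SPD_LE n) q u u : R^o) p) =
    frob ('D_u (fun q => 'D_u (@slogm R n) q) p) ('D_w (@slogm R n) p).
  move=> Sw.
  have aux (a b x y z t : R) : a = x + y -> b = z + t -> y = t -> z = t -> 2^-1 * (a + a - b) = x.
    by move=> -> -> -> ->; field.
  have sw := schwarz_mx w u (@open_SPD_nbhd R n) Up (@Cd_slogm R n 2).
  apply: (aux _ _ _ _ _ _ (derive_metric_SPD Sp Su Su Sw) (derive_metric_SPD Sp Sw Su Su)
    (congr1 (frob _) sw)).
  exact: mxtrace_mulC.
split=> [[_ cov]|E].
- set X := 'D_c _ _; set Y := 'D_u _ _.
  have SXY : Sym (X - Y).
    have h1 : X^T = X by exact: derive_slogm_sym.
    have h2 : Y^T = Y by exact: derive2_slogm_sym.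
    by rewrite /Sym /= linearB /= h1 h2.
  have [Sl el] := logmP Sp.
  (* The derivative of log at p is onto the symmetric matrices; [w] is the tangent vector with image
     X - Y, and testing on it gives <X - Y, X - Y> = 0. *)
  pose w := dexpm (logm p) (X - Y).
  have Sw : Sym w by exact: dexpm_sym.
  have dw : 'D_w (@slogm R n) p = X - Y.
    rewrite deriveE; last exact: differentiable_slogm.
    by have := diff_slogm_expm Sl SXY; rewrite el.
  have h := etrans (esym (metric_SPD Sp Sc Sw)) (etrans (cov w Sw) (K w Sw)).
  by rewrite dw in h; exact: frob_cancel SXY h.
- split=> // w Sw; apply: etrans (metric_SPD Sp Sc Sw) _; apply: etrans (esym (K w Sw)).
  exact: (congr1 (fun Z => frob Z _) E).
Qed.

End FlatMetric.

(** * Geodesics and isometries read in logarithmic charts *)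

Section Geodesics.
Context {R : realType}.
Implicit Types V W : normedModType R.

Lemma velocity_derive1 W (g : R^o -> W) t D : has_velocity g t D -> 'D_(1 : R^o) g t = D.
Proof.
move=> gt; rewrite deriveE; last exact: (@ex_diff _ _ _ _ _ _ _ gt).
by rewrite (@diff_val _ _ _ _ _ _ _ gt) scale1r.
Qed.

Lemma differentiable_velocity W (g : R^o -> W) (t : R) :
  differentiable g (t : R^o) -> has_velocity g t ('D_(1 : R^o) g t).
Proof.
move=> dg; apply: is_diff_eq (differentiableP dg) _; apply/funext => h.
by rewrite deriveE// -[in RHS]linearZ; congr ('d g _ _); rewrite /GRing.scale /= mulr1.
Qed.

Lemma velocity_sum W I (r : seq I) (f : I -> R^o -> W) (D : I -> W) t :
  (forall i, has_velocity (f i) t (D i)) ->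
  has_velocity (fun s => \sum_(i <- r) f i s) t (\sum_(i <- r) D i).
Proof.
move=> fD; elim: r => [|i r IHr].
  rewrite big_nil; have -> : (fun s => \sum_(i <- [::]) f i s) = fun=> 0.
    by apply/funext => s; rewrite big_nil.
  exact: velocity_cst.
rewrite big_cons; have -> : (fun s => \sum_(j <- i :: r) f j s) = fun s => f i s + \sum_(j <- r) f j s.
  by apply/funext => s; rewrite big_cons.
exact: velocityD.
Qed.

Lemma velocity_scale_mx m n p q (f : R^o -> 'M[R]_(m, n)) (g : R^o -> 'M[R]_(p, q)) i j t D E :
  has_velocity f t D -> has_velocity g t E ->
  has_velocity (fun s => f s i j *: g s) t (D i j *: g t + f t i j *: E).
Proof.
move=> fD gE.
have Ll : linear (fun A : 'M[R]_(m, n) => (A i j)%:M : 'M[R]_p).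
  by move=> c A B; rewrite !mxE raddfD /= scale_scalar_mx.
pose L : {linear 'M[R]_(m, n) -> 'M[R]_p} := HB.pack (fun A : 'M[R]_(m, n) => (A i j)%:M : 'M[R]_p)
  (GRing.isLinear.Build _ _ _ _ _ Ll).
have := velocity_mulmx (velocity_lin_mx L fD) gE.
rewrite /= !mul_scalar_mx; congr has_velocity.
by apply/funext => s; rewrite /= mul_scalar_mx.
Qed.

(** The second-order chain rule (phi o g)'' = D^2 phi (g', g') + D phi (g''). As derivatives are
    taken in fixed directions, g' is expanded in elementary matrices before the second
    differentiation, and [schwarz_mx] reorders the mixed derivatives afterwards. *)
Lemma chart_acceleration m n p q (U : set 'M[R]_(m, n)) (phi : 'M[R]_(m, n) -> 'M[R]_(p, q))
    (I : set R) (g : R^o -> 'M[R]_(m, n)) (t : R) :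
  open U -> open I -> I t -> (forall s, I s -> U (g s)) -> Cd 2 U phi -> Cd 2 (I : set R^o) g ->
  'D_(1 : R^o) (fun s => 'D_(1 : R^o) (phi \o g) s) t =
  'D_('D_(1 : R^o) g t) (fun x => 'D_('D_(1 : R^o) g t) phi x) (g t)
  + 'D_('D_(1 : R^o) (fun s => 'D_(1 : R^o) g s) t) phi (g t).
Proof.
move=> oU oI It gU Cphi Cg; set u := 'D_1 g t; set a := 'D_1 (fun s => 'D_1 g s) t.
pose e i j : 'M[R]_(m, n) := delta_mx i j.
have dphi x : U x -> differentiable phi x := Cd_diff Cphi.
have dg s : I s -> differentiable g (s : R^o) := Cd_diff Cg.
have Dphi v x : U x -> differentiable (fun y => 'D_v phi y) x.
  by have C1 : Cd 1 U (fun y => 'D_v phi y) := Cphi.2 v; exact: Cd_diff C1.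
have gu : has_velocity g t u by apply: differentiable_velocity; exact: dg.
have ga : has_velocity (fun s => 'D_(1 : R^o) g s) t a.
  apply: differentiable_velocity.
  have C1 : Cd 1 (I : set R^o) (fun s => 'D_(1 : R^o) g s) := Cg.2 1.
  exact: Cd_diff C1 It.
pose S s := \sum_i \sum_j ('D_(1 : R^o) g s) i j *: 'D_(e i j) phi (g s).
have ES s : I s -> 'D_(1 : R^o) (phi \o g) s = S s.
  move=> Is; have e1 := derive_comp (1 : R^o) (dg s Is) (dphi _ (gU s Is)).
  have e2 := diff_delta ('D_(1 : R^o) g s) (dphi _ (gU s Is)).
  exact: etrans e1 e2.
have DS : has_velocity S t (\sum_i \sum_j (a i j *: 'D_(e i j) phi (g t) +
    u i j *: 'D_u (fun x => 'D_(e i j) phi x) (g t))).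
  apply: velocity_sum => i; apply: velocity_sum => j; apply: velocity_scale_mx => //.
  rewrite deriveE; last exact: Dphi (gU t It).
  exact: (velocity_comp gu (differentiableP (Dphi (e i j) _ (gU t It)))).
have nI : nbhs (t : R^o) (I : set R^o) := open_nbhs_nbhs (conj oI It).
have -> : 'D_(1 : R^o) (fun s => 'D_(1 : R^o) (phi \o g) s) t =
    \sum_i \sum_j (a i j *: 'D_(e i j) phi (g t) + u i j *: 'D_u (fun x => 'D_(e i j) phi x) (g t)).
  apply: etrans _ (velocity_derive1 DS); apply: near_eq_derive.
  exact: filterS ES nI.
have Ea : 'D_a phi (g t) = \sum_i \sum_j a i j *: 'D_(e i j) phi (g t).
  by rewrite deriveE; [exact: diff_delta (dphi _ (gU t It))|exact: dphi (gU t It)].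
have Eu : 'D_u (fun x => 'D_u phi x) (g t) = \sum_i \sum_j u i j *: 'D_u (fun x => 'D_(e i j) phi x) (g t).
  rewrite (deriveE u (Dphi u _ (gU t It))) (diff_delta u (Dphi u _ (gU t It))).
  apply: eq_bigr => i _; apply: eq_bigr => j _.
  exact: (congr1 (fun X => u i j *: X) (schwarz_mx u (e i j) oU (gU t It) Cphi)).
by rewrite Ea Eu -big_split /=; apply: eq_bigr => i _; rewrite big_split addrC.
Qed.

Lemma geodesic_SPD n (I : set R) (g : R^o -> 'M[R]_n) :
  geodesic (SPD_LE n) I g <->
  [/\ open I, is_interval I, (forall t, I t -> SPD (g t)), smooth (I : set R^o) setT g &
      forall t, I t -> 'D_(1 : R^o) (fun s => 'D_(1 : R^o) (@slogm R n \o g) s) t = 0].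
Proof.
suff K : open I -> (forall t, I t -> SPD (g t)) -> smooth (I : set R^o) setT g -> forall t, I t ->
    covariant (SPD_LE n) (g t) (derive1 g t) (derive1 g t) (- derive1n 2 g t) <->
    'D_(1 : R^o) (fun s => 'D_(1 : R^o) (@slogm R n \o g) s) t = 0.
  by split=> -[oI iI Sg sg H]; split=> // t It; have [h1 h2] := K oI Sg sg t It; [exact: h1 (H t It)|exact: h2 (H t It)].
move=> oI Sg sg t It; have Cg := smooth_Cd oI sg.
have e1 : derive1 g = fun s => 'D_(1 : R^o) g s by apply/funext => s; rewrite derive1E.
have -> : derive1n 2 g t = 'D_(1 : R^o) (fun s => 'D_(1 : R^o) g s) t.
  by rewrite derive1nS derive1n1 derive1E e1.
rewrite e1; set u := 'D_1 g t; set a := 'D_1 _ t.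
have C1 : Cd 1 (I : set R^o) (fun s => 'D_(1 : R^o) g s) := (Cg 2%N).2 1.
have Su s : I s -> Sym ('D_(1 : R^o) g s).
  move=> Is; apply: (@Cd_fixed_linear _ _ _ 0 _ _ (@trmx R n n) s (1 : R^o) oI Is) (Cg 1%N) _.
    exact: linear_mx_continuous.
  by move=> r /Sg[].
have Sa : Sym a.
  apply: (@Cd_fixed_linear _ _ _ 0 _ _ (@trmx R n n) t (1 : R^o) oI It) C1 _ => //.
  exact: linear_mx_continuous.
have SNa : Sym (- a) by rewrite /Sym /= linearN /= Sa.
(* For c = - g'', the condition of [covariant_SPD] says that the two terms of [chart_acceleration]
   add up to 0. *)
have CK := covariant_SPD (Sg t It) (Su t It) SNa.
have E := chart_acceleration (@open_SPD_nbhd R n) oI It (fun s Is => SPD_sub_nbhd (Sg s Is))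
  (@Cd_slogm R n 2) (Cg 2%N).
have DN : 'D_(- a) (@slogm R n) (g t) = - 'D_a (@slogm R n) (g t).
  have ds := differentiable_slogm (Sg t It).
  by rewrite (deriveE (- a) ds) (deriveE a ds); exact: linearN.
split=> [/CK h|h].
  by apply: etrans E _; rewrite -h DN; exact: addNr.
apply/CK; rewrite DN; have := etrans (esym E) h.
by move/eqP; rewrite addr_eq0 => /eqP ->.
Qed.

(** The target chart [f'] is left arbitrary so as to serve both [SPD_LE] and [Cor_OL]; [phi'] and
    [F'] are the ambient extensions of [f'] and [F]. Read in the charts, F is the linear isometry
    [L]. *)
Lemma isometric_flat m n (N : riem 'M[R]_n) (U' : set 'M[R]_n) (f' phi' : 'M[R]_n -> 'M[R]_n)
    (F F' : 'M[R]_m -> 'M[R]_n) (L : {linear 'M[R]_m -> 'M[R]_n}) :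
  metric N = pullback_frob f' -> carrier N `<=` U' ->
  admissible (carrier N) (tangent N) -> (forall q, carrier N q -> f' q = phi' q) -> Cd 1 U' phi' ->
  (forall p, SPD p -> F p = F' p) -> (forall p, SPD p -> carrier N (F p)) ->
  (forall p u, SPD p -> Sym u -> tangent N ('D_u F' p)) -> Cd 1 (@SPD_nbhd R m) F' ->
  (forall p, SPD_nbhd p -> phi' (F' p) = L (slogm p)) ->
  (forall A B, Sym A -> Sym B -> frob (L A) (L B) = frob A B) ->
  isometric (SPD_LE m) N F.
Proof.
move=> Nf NU aN fphi Cphi FF' NF tF CF phiF Liso p u v Sp Su Sv.
have K w : Sym w -> 'D_('D_w F p) f' (F p) = L ('D_w (@slogm R m) p).
  move=> Sw; have -> : 'D_w F p = 'D_w F' p.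
    by apply: (line_near_eq _).1; apply: filterS (admissible_SPD Sp Sw) => h; exact: FF'.
  have -> : 'D_('D_w F' p) f' (F p) = 'D_('D_w F' p) phi' (F p).
    apply: (line_near_eq _).1; apply: filterS (aN _ _ (NF p Sp) (tF p w Sp Sw)) => h; exact: fphi.
  have dphi := Cd_diff Cphi (NU _ (NF p Sp)).
  have dF := Cd_diff CF (SPD_sub_nbhd Sp).
  have EF := FF' p Sp; rewrite EF in dphi *.
  apply: etrans (deriveE _ dphi) _; apply: etrans (esym (derive_comp w dF dphi)) _.
  have cL : continuous L by exact: linear_mx_continuous.
  apply: etrans _ (derive_lin w cL (differentiable_slogm Sp)).
  apply: near_eq_derive.
  by apply: filterS (open_nbhs_nbhs (conj (@open_SPD_nbhd R m) (SPD_sub_nbhd Sp))) => q; exact: phiF.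
have -> : metric N (F p) ('D_u F p) ('D_v F p) =
    frob ('D_('D_u F p) f' (F p)) ('D_('D_v F p) f' (F p)) by rewrite Nf.
rewrite (K u Su) (K v Sv); apply: etrans (esym (metric_SPD Sp Su Sv)).
by apply: Liso; exact: derive_slogm_sym.
Qed.

End Geodesics.

(** * Maps that are linear in logarithmic coordinates *)

Section LogLinear.
Context {R : realType}.

Lemma derive_0 (V W : normedModType R) (f : V -> W) x : differentiable f x -> 'D_0 f x = 0.
Proof. by move=> df; rewrite deriveE// linear0. Qed.

Lemma derive_slogm_inj n (p v : 'M[R]_n) : SPD p -> Sym v -> 'D_v (@slogm R n) p = 0 -> v = 0.
Proof.
move=> Sp Sv; rewrite deriveE => [h|]; last exact: differentiable_slogm.
have := dexpm_diff_slogm v (SPD_sub_nbhd Sp).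
by rewrite h linear0 symmx_id.
Qed.

Lemma Cd_expm_linear_slogm m n (L : {linear 'M[R]_m -> 'M[R]_n}) k :
  Cd k (@SPD_nbhd R m) (fun X => expm (L (slogm X))).
Proof.
apply: (Cd_comp (U' := setT) (f := L \o @slogm R m) (g := @expm R n)) => //.
- exact: open_SPD_nbhd.
- by apply: Cd_lin_comp; [exact: open_SPD_nbhd|exact: linear_mx_continuous|exact: Cd_slogm].
- by apply: Cd_expm; exact: openT.
Qed.

(** Injectivity of the differential follows from the isometry, the metric being definite. The
    continuous inverse on the image is exp o L' o log. A geodesic stays one because [L] is linear
    and so preserves the vanishing of the acceleration of its logarithm. *)
Lemma log_linear_tg_isometric m n (L : {linear 'M[R]_m -> 'M[R]_n})
    (L' : {linear 'M[R]_n -> 'M[R]_m}) (F : 'M[R]_m -> 'M[R]_n) :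
  (forall S, Sym S -> Sym (L S)) ->
  (forall A B, Sym A -> Sym B -> frob (L A) (L B) = frob A B) ->
  (forall S, Sym S -> L' (L S) = S) ->
  (forall X, SPD X -> F X = expm (L (logm X))) ->
  tg_isometric_embedding (SPD_LE m) (SPD_LE n) F.
Proof.
move=> LS Liso LK FE; pose F' (X : 'M[R]_m) := expm (L (slogm X)).
have FF' X : SPD X -> F X = F' X by move=> SX; rewrite FE// /F' slogm_logm.
have SF' X : SPD_nbhd X -> SPD (F' X).
  by move=> /slogm_sym SX; apply: SPD_expm; exact: LS.
have CF k : Cd k (@SPD_nbhd R m) F' := Cd_expm_linear_slogm L k.
have SF X : SPD X -> SPD (F X).
  by move=> SX; rewrite FF'//; apply: SF'; exact: SPD_sub_nbhd.
have slogF' X : SPD_nbhd X -> slogm (F' X) = L (slogm X).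
  by move=> /slogm_sym SX; rewrite slogm_expm//; exact: LS.
have iso : isometric (SPD_LE m) (SPD_LE n) F.
  apply: (@isometric_flat _ m n (SPD_LE n) (@SPD_nbhd R n) (@logm R n) (@slogm R n) F F' L) => //.
  - exact: SPD_sub_nbhd.
  - exact: admissible_SPD.
  - by move=> q Sq; rewrite slogm_logm.
  - exact: Cd_slogm.
  - move=> p u Sp _.
    apply: (@Cd_fixed_linear _ _ _ 0 _ _ (@trmx R n n) p u (@open_SPD_nbhd R m) (SPD_sub_nbhd Sp)) (CF 1%N) _.
      exact: linear_mx_continuous.
    by move=> q /SF'[].
split=> //.
- split=> //.
  + exact: (smooth_ext (@open_SPD_nbhd R m) (@SPD_sub_nbhd R m) (@admissible_SPD R m) FF' CF).
  + move=> p v Sp Sv DF0; have h := iso p v v Sp Sv Sv; rewrite DF0 in h.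
    have S0 : Sym (0 : 'M[R]_n) by rewrite /Sym /= trmx0.
    have h' := etrans (esym (metric_SPD (SF p Sp) S0 S0)) (etrans h (metric_SPD Sp Sv Sv)).
    apply: (derive_slogm_inj Sp Sv); apply: mxdot_eq0.
    rewrite /mxdot (derive_slogm_sym v Sp) -/(frob _ _) -h'.
    by rewrite derive_0 ?/frob ?mul0mx ?mxtrace0//; exact: differentiable_slogm (SF p Sp).
  + exists (fun Y => expm (L' (slogm Y))); split=> [p Sp|].
      rewrite (FF' p Sp) slogF'; last exact: SPD_sub_nbhd.
      rewrite LK; last by apply: slogm_sym; exact: SPD_sub_nbhd.
      by rewrite slogm_logm//; have [] := logmP Sp.
    apply: continuous_in_subspaceT => y; rewrite inE => -[p /SF Sp <-].
    exact: Cd_cont (Cd_expm_linear_slogm L' 0) (SPD_sub_nbhd Sp).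
- move=> I g /geodesic_SPD[oI iI Sg sg H]; apply/geodesic_SPD; split=> //.
  + by move=> t /Sg /SF.
  + have Ug t : I t -> SPD_nbhd (g t) by move=> /Sg; exact: SPD_sub_nbhd.
    have a1 : admissible (I : set R^o) setT := admissible_open oI.
    have a2 t : I t -> (F \o g) t = (F' \o g) t := fun It => FF' _ (Sg t It).
    have a3 k : Cd k (I : set R^o) (F' \o g) := Cd_comp oI Ug (smooth_Cd oI sg k) (CF k).
    exact: (smooth_ext oI (@subset_refl _ (I : set R^o)) a1 a2 a3).
  + move=> t It; have nI : nbhs (t : R^o) (I : set R^o) := open_nbhs_nbhs (conj oI It).
    have Cs : Cd 2 (I : set R^o) (@slogm R m \o g).
      by apply: (Cd_comp oI _ (smooth_Cd oI sg 2) (@Cd_slogm R m 2)) => s /Sg; exact: SPD_sub_nbhd.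
    have cL : continuous L by exact: linear_mx_continuous.
    have C1 : Cd 1 (I : set R^o) (fun s => 'D_(1 : R^o) (@slogm R m \o g) s) := Cs.2 1.
    have E1 s : I s -> 'D_(1 : R^o) (@slogm R n \o (F \o g)) s = L ('D_(1 : R^o) (@slogm R m \o g) s).
      move=> Is; apply: etrans _ (derive_lin (1 : R^o) cL (Cd_diff Cs Is)).
      apply: near_eq_derive; apply: filterS (open_nbhs_nbhs (conj oI Is)) => r /Sg Sr /=.
      by rewrite FF'// slogF'//; exact: SPD_sub_nbhd.
    apply: etrans (near_eq_derive _ (filterS E1 nI)) _.
    by apply: etrans (derive_lin (1 : R^o) cL (Cd_diff C1 It)) _; rewrite (H t It) linear0.
Qed.

End LogLinear.

(** * The off-log tower *)

Section OffLogTower.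
Context {R : realType}.

Fact off_linear n : linear (@off R n).
Proof. by move=> c X Y; apply/matrixP => i j; rewrite !mxE; case: eqP => // _; rewrite mulr0 addr0. Qed.

HB.instance Definition _ n :=
  GRing.isLinear.Build R 'M[R]_n 'M[R]_n *:%R (@off R n) (@off_linear n).

Lemma off_Hol n (X : 'M[R]_n) : Sym X -> Hol (off X).
Proof.
move=> SX; split=> [|i]; last by rewrite mxE eqxx.
by rewrite /Sym /=; apply/matrixP => i j; rewrite !mxE eq_sym -[in RHS]SX mxE.
Qed.

Lemma off_add_diag n (D P : 'M[R]_n) : is_diag_mx D -> Hol P -> off (D + P) = P.
Proof.
move=> /is_diag_mxP dD [_ P0]; apply/matrixP => i j; rewrite !mxE; case: eqP => [->|/eqP ij].
  by rewrite P0.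
by rewrite dD// add0r.
Qed.

Lemma psiOL_entries k (S : 'M[R]_k) :
  [/\ psiOL S ord0 ord0 = 0,
      forall j, psiOL S ord0 (lift ord0 j) = (Num.sqrt 2)^-1 * S j j,
      forall i, psiOL S (lift ord0 i) ord0 = (Num.sqrt 2)^-1 * S i i &
      forall i j, psiOL S (lift ord0 i) (lift ord0 j) = off S i j].
Proof.
have l0 : ord0 = lshift k (ord0 : 'I_1) :> 'I_k.+1 by exact: val_inj.
have r0 (i : 'I_k) : lift ord0 i = rshift 1 i :> 'I_k.+1 by exact: val_inj.
rewrite /psiOL; split=> [|j|i|i j]; rewrite ?r0 ?l0.
- by apply: etrans (block_mxEul _ _ _ _ _ _) _; rewrite mxE.
- by apply: etrans (block_mxEur _ _ _ _ _ _) _; rewrite !mxE.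
- by apply: etrans (block_mxEdl _ _ _ _ _ _) _; rewrite !mxE.
- exact: block_mxEdr.
Qed.

Fact psiOL_linear k : linear (@psiOL R k).
Proof.
move=> c X Y; apply/matrixP => i j.
have -> : (c *: psiOL X + psiOL Y) i j = c * psiOL X i j + psiOL Y i j by rewrite mxE mxE.
have [x1 x2 x3 x4] := psiOL_entries X; have [y1 y2 y3 y4] := psiOL_entries Y.
have [z1 z2 z3 z4] := psiOL_entries (c *: X + Y).
case: (unliftP ord0 i) => [i'|] ->; case: (unliftP ord0 j) => [j'|] ->.
- by rewrite x4 y4 z4 linearP !mxE.
- by rewrite x3 y3 z3 !mxE; ring.
- by rewrite x2 y2 z2 !mxE; ring.
- by rewrite x1 y1 z1 mulr0 addr0.
Qed.

HB.instance Definition _ k :=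
  GRing.isLinear.Build R 'M[R]_k 'M[R]_k.+1 *:%R (@psiOL R k) (@psiOL_linear k).

Lemma psiOL_Hol k (S : 'M[R]_k) : Sym S -> Hol (psiOL S).
Proof.
move=> SS; have [So o0] := off_Hol SS; have [e1 e2 e3 e4] := psiOL_entries S; split=> [|i].
  rewrite /Sym /=; apply/matrixP => i j; rewrite mxE.
  case: (unliftP ord0 i) => [i'|] ->; case: (unliftP ord0 j) => [j'|] ->; rewrite ?e2 ?e3//.
  by rewrite !e4 -[in LHS]So mxE.
by case: (unliftP ord0 i) => [i'|] ->; rewrite ?e4 ?o0.
Qed.

(** Each diagonal entry of a matrix occupies two places in its image, one in the first row and one
    in the first column, and (1 / sqrt 2)^2 + (1 / sqrt 2)^2 = 1. *)
Lemma frob_psiOL k (A B : 'M[R]_k) : frob (psiOL A) (psiOL B) = frob A B.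
Proof.
have s2 : (Num.sqrt 2)^-1 * (Num.sqrt 2)^-1 = 2^-1 :> R.
  by rewrite -invfM -expr2 sqr_sqrtr.
have half a b : (Num.sqrt 2)^-1 * a * ((Num.sqrt 2)^-1 * b) = 2^-1 * (a * b) :> R.
  by rewrite -s2; ring.
have h2 : 2^-1 + 2^-1 = 1 :> R by field.
have [a1 a2 a3 a4] := psiOL_entries A; have [b1 b2 b3 b4] := psiOL_entries B.
have tE n (X Y : 'M[R]_n) : frob X Y = \sum_i \sum_j X i j * Y j i.
  by apply: eq_bigr => i _; rewrite mxE.
rewrite !tE big_ord_recl big_ord_recl a1 mul0r add0r -big_split /=; apply: eq_bigr => i _.
rewrite big_ord_recl a2 b3 a3 b2 !half addrA -mulrDl h2 mul1r.
rewrite [RHS](bigD1 i)//= (bigD1 i)//= a4 !mxE eqxx mul0r add0r; congr (_ + _).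
by apply: eq_bigr => j ij; rewrite a4 b4 !mxE (negbTE ij) eq_sym (negbTE ij).
Qed.

(** The diagonal is read off the first row alone; on [Hol] the result is a two-sided inverse of
    [psiOL]. *)
Definition psiOL_inv k (Y : 'M[R]_k.+1) : 'M[R]_k :=
  \matrix_(i, j) if i == j then Num.sqrt 2 * Y ord0 (lift ord0 i) else Y (lift ord0 i) (lift ord0 j).

Fact psiOL_inv_linear k : linear (@psiOL_inv k).
Proof.
by move=> c X Y; apply/matrixP => i j; rewrite !mxE; case: eqP => // _; ring.
Qed.

HB.instance Definition _ k :=
  GRing.isLinear.Build R 'M[R]_k.+1 'M[R]_k *:%R (@psiOL_inv k) (@psiOL_inv_linear k).

Lemma psiOL_inv_sym k (Y : 'M[R]_k.+1) : Sym Y -> Sym (psiOL_inv Y).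
Proof.
move=> SY; rewrite /Sym /=; apply/matrixP => i j; rewrite !mxE eq_sym.
by case: eqP => [->//|_]; rewrite -[in LHS]SY mxE.
Qed.

Lemma sqrt2_neq0 : Num.sqrt 2 != 0 :> R.
Proof. by rewrite gt_eqF// sqrtr_gt0. Qed.

Lemma psiOLK k : cancel (@psiOL R k) (@psiOL_inv k).
Proof.
move=> S; have [_ e2 _ e4] := psiOL_entries S.
apply/matrixP => i j; rewrite mxE; case: eqP => [<-|/eqP ij].
  by rewrite e2 mulrA mulfV ?mul1r ?sqrt2_neq0.
by rewrite e4 mxE (negbTE ij).
Qed.

Lemma psiOL_invK k (P : 'M[R]_k.+1) : Hol P -> psiOL (psiOL_inv P) = P.
Proof.
move=> [SP P0]; have [e1 e2 e3 e4] := psiOL_entries (psiOL_inv P).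
apply/matrixP => i j.
case: (unliftP ord0 i) => [i'|] ->; case: (unliftP ord0 j) => [j'|] ->.
- by rewrite e4 !mxE; case: eqP => // ->; rewrite P0.
- by rewrite e3 mxE eqxx mulrA mulVf ?sqrt2_neq0// mul1r -[in LHS]SP mxE.
- by rewrite e2 mxE eqxx mulrA mulVf ?sqrt2_neq0// mul1r.
- by rewrite e1 P0.
Qed.

Lemma PhiOL_logm k (X : 'M[R]_k) : SPD X ->
  logm (PhiOL X) = calD (psiOL (logm X)) + psiOL (logm X).
Proof.
move=> /logmP[Sl _]; have [SP _] := psiOL_Hol Sl; have [dD _] := calDP SP.
by rewrite /PhiOL logm_expm// /Sym /= linearD /= SP (is_diag_sym dD).
Qed.

(** log (Phi X) is a diagonal matrix plus the hollow matrix psi (log X). Hence [off] recovers psi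
    (log X), and the diagonal term that J subtracts is the very one that Phi added. *)
Lemma FOLE k (X : 'M[R]_k) : SPD X -> FOL X = expm (psiOL (logm X)).
Proof.
move=> SX; have [Sl _] := logmP SX; have HP := psiOL_Hol Sl.
rewrite /FOL /= /JOL /incl PhiOL_logm//; have [dD _] := calDP HP.1.
by rewrite (off_add_diag dD HP) addrC addKr.
Qed.

Lemma FOL_tg k : tg_isometric_embedding (SPD_LE k) (SPD_LE k.+1) (@FOL R k).
Proof.
apply: (@log_linear_tg_isometric _ _ _ (@psiOL R k) (@psiOL_inv k)).
- by move=> S /psiOL_Hol[].
- by move=> A B _ _; exact: frob_psiOL.
- by move=> S _; exact: psiOLK.
- exact: FOLE.
Qed.

(** log and exp cancel between consecutive factors, so the composition is again linear in
    logarithms, and [log_linear_tg_isometric] applies to it as a whole. *)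
Lemma FOLcomp_log_linear m d :
  exists (L : {linear 'M[R]_m -> 'M[R]_(d + m)}) (L' : {linear 'M[R]_(d + m) -> 'M[R]_m}),
  [/\ forall S, Sym S -> Sym (L S), forall A B, frob (L A) (L B) = frob A B,
      cancel L L' & forall X, SPD X -> FOLcomp d X = expm (L (logm X))].
Proof.
elim: d => [|d [L [L' [LS Liso LK LE]]]].
  exists (@idfun 'M[R]_m : {linear _ -> _}), (@idfun 'M[R]_m : {linear _ -> _}); split=> //.
  by move=> X /logmP[].
exists (@psiOL R (d + m) \o L : {linear _ -> _}), (L' \o @psiOL_inv (d + m) : {linear _ -> _}); split=> [S SS|A B|S|X SX] /=.
- by have [] := psiOL_Hol (LS S SS).
- by rewrite frob_psiOL.
- by rewrite psiOLK LK.
- have [Sl _] := logmP SX; rewrite LE// FOLE; last by apply: SPD_expm; exact: LS.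
  by rewrite logm_expm//; exact: LS.
Qed.

Lemma FOLcomp_tg m d : tg_isometric_embedding (SPD_LE m) (SPD_LE (d + m)) (@FOLcomp R m d).
Proof.
have [L [L' [LS Liso LK LE]]] := FOLcomp_log_linear m d.
exact: (log_linear_tg_isometric LS (fun A B _ _ => Liso A B) (fun S _ => LK S) LE).
Qed.

Lemma PhiOL_isometric_isomorphism k :
  isometric_isomorphism (SPD_LE k) (Cor_OL k.+1) (@PhiOL R k).
Proof.
pose P (X : 'M[R]_k) := psiOL (slogm X).
pose Phi' (X : 'M[R]_k) := expm (scalD (P X) + P X).
have oU := @open_SPD_nbhd R k.
have HP X : SPD_nbhd X -> Hol (P X) by move=> /slogm_sym; exact: psiOL_Hol.
have scalDE (S : 'M[R]_k.+1) : Sym S -> scalD S = calD S by move=> SS; rewrite -{2}(symmx_id SS).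
have Cor' X : SPD_nbhd X -> Cor (Phi' X).
  by move=> /HP[SP _]; rewrite /Phi' scalDE// addrC; have [] := calDP SP.
have PhiE X : SPD X -> PhiOL X = Phi' X.
  move=> SX; rewrite /Phi' /P scalDE ?slogm_logm//.
  by have [] := HP X (SPD_sub_nbhd SX); rewrite /P slogm_logm.
have CP j : Cd j (@SPD_nbhd R k) P.
  apply: (Cd_lin_comp (L := @psiOL R k)) => //; [exact: linear_mx_continuous|exact: Cd_slogm].
have CPhi j : Cd j (@SPD_nbhd R k) Phi'.
  apply: (Cd_comp (U' := setT) (f := fun X => scalD (P X) + P X)) => //; last first.
    by apply: Cd_expm; exact: openT.
  apply: CdD => //; apply: (Cd_comp (U' := setT) (f := P)) => //; exact: Cd_scalD.
have CorPhi (X : 'M[R]_k) : SPD X -> Cor (PhiOL X) by move=> SX; rewrite PhiE//; apply: Cor'; exact: SPD_sub_nbhd.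
have offPhi X : SPD_nbhd X -> off (slogm (Phi' X)) = P X.
  move=> /HP HPX; have [SP _] := HPX; have [dD _] := calDP SP.
  rewrite /Phi' scalDE// slogm_expm ?off_add_diag//.
  by rewrite /Sym /= linearD /= SP (is_diag_sym dD).
have CN : @Cor R k.+1 `<=` @SPD_nbhd R k.+1 by move=> C [SC _]; exact: SPD_sub_nbhd.
split=> //.
- exact: (smooth_ext oU (@SPD_sub_nbhd R k) (@admissible_SPD R k) PhiE CPhi).
- pose L : {linear 'M[R]_k.+1 -> 'M[R]_k} := @psiOL_inv k \o @off R k.+1.
  exists (fun C => expm (L (slogm C))).
  have LS C : Cor C -> Sym (L (slogm C)).
    move=> /CN SC; apply: psiOL_inv_sym.
    by have [] := off_Hol (slogm_sym SC).
  split=> [C /LS|||C CC].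
  + exact: SPD_expm.
  + exact: (smooth_ext (@open_SPD_nbhd R k.+1) CN (@admissible_Cor R k.+1) (fun x _ => erefl)
      (Cd_expm_linear_slogm L)).
  + move=> X SX; rewrite PhiE//= offPhi; last exact: SPD_sub_nbhd.
    by rewrite /P psiOLK slogm_logm//; have [] := logmP SX.
  + have [SC C1] := CC; have [Sl el] := logmP SC.
    have HO : Hol (off (logm C)) by exact: off_Hol.
    have LC : psiOL (logm (expm (L (slogm C)))) = off (logm C).
      by rewrite (logm_expm (LS C CC)) slogm_logm//; exact: psiOL_invK.
    (* log C splits into hollow and diagonal parts, and exp of their sum is the correlation matrix
       C; uniqueness then identifies the diagonal part with [calD] of the hollow one. *)
    have E : logm C = off (logm C) + diagpart (logm C) by rewrite off_diagpart subrK.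
    have -> : PhiOL (expm (L (slogm C))) = expm (calD (off (logm C)) + off (logm C)).
      by rewrite /PhiOL LC.
    rewrite (calD_uniq HO.1 (E := diagpart (logm C))).
    * by rewrite addrC -E.
    * by apply/diagpart_is_diag; have [->] := @diagpart_projector R k.+1.
    * by rewrite -E el.
- apply: (@isometric_flat _ k k.+1 (Cor_OL k.+1) (@SPD_nbhd R k.+1) (@Logm R k.+1)
    (@off R k.+1 \o @slogm R k.+1) (@PhiOL R k) Phi' (@psiOL R k)) => //.
  + exact: admissible_Cor.
  + by move=> q [Sq _]; rewrite /= slogm_logm.
  + apply: Cd_lin_comp; [exact: open_SPD_nbhd|exact: linear_mx_continuous|exact: Cd_slogm].
  + move=> p u Sp Su; have Up := SPD_sub_nbhd Sp; split.
      apply: (@Cd_fixed_linear _ _ _ 0 _ _ (@trmx R k.+1 k.+1) p u oU Up) (CPhi 1%N) _.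
        exact: linear_mx_continuous.
      by move=> q /Cor'[[]].
    (* Tangent vectors to [Cor] are hollow: the diagonal of [Phi'] is constantly 1, so that of its
       derivative is 0. *)
    have cd : continuous (@diagpart R k.+1) by exact: linear_mx_continuous.
    have e1 := derive_lin u cd (Cd_diff (CPhi 1%N) Up).
    have e2 : 'D_u (@diagpart R k.+1 \o Phi') p = 'D_u (fun=> 1%:M : 'M[R]_k.+1) p.
      apply: near_eq_derive; apply: filterS (open_nbhs_nbhs (conj oU Up)) => q /Cor'[_ q1].
      by apply/matrixP => i j; rewrite !mxE; case: eqP => // ->; rewrite q1.
    move=> i; have /matrixP/(_ i i) := etrans (esym e1) e2.
    by rewrite derive_cst !mxE eqxx.
  + by move=> A B _ _; exact: frob_psiOL.
Qed.

End OffLogTower.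

(* n = k + 1 >= 2 in the first conjunct, n = d + m > m >= 1 in the second *)
Theorem theorem4p34 (R : realType) :
  [/\ forall k : nat, (1 <= k)%N ->
        [/\ isometric_isomorphism (@SPD_LE R k) (@Cor_OL R k.+1) (@PhiOL R k),
            tg_isometric_embedding (@SPD_LE R k) (@SPD_LE R k.+1) (@FOL R k),
            (forall X : 'M[R]_k, SPD X ->
               FOL X = expm (psiOL (logm X)) /\ KOL (FOL X)) &
            @KOL R k.+1 `<=` @SPD R k.+1],
      forall m d : nat, (1 <= m)%N -> (1 <= d)%N ->
        tg_isometric_embedding (@SPD_LE R m) (@SPD_LE R (d + m))
          (@FOLcomp R m d) &
      nested_sequence (@SPD_LE R) (@FOL R)].
Proof.
split=> [k _|m d _ _|k _]; [split|exact: FOLcomp_tg|exact: FOL_tg].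
- exact: PhiOL_isometric_isomorphism.
- exact: FOL_tg.
- move=> X SX; rewrite FOLE//; split=> //; exists (psiOL (logm X)) => //.
  by apply: psiOL_Hol; have [] := logmP SX.
- by move=> _ [S [SS _] <-]; exact: SPD_expm.
Qed.
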